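(* Let $(T_0,s_0)$, the past input $q_{\rm c}|_{(-D,0)}$ and the setpoint $s_{\rm r}$ satisfy Assumptions A1, A2 and A3 of the context, and let $c>0$ be arbitrary. Consider the closed-loop system consisting of the delayed one-phase Stefan problem $$T_t(x,t)=\alpha T_{xx}(x,t),\ 0\le x\le s(t),\qquad -kT_x(0,t)=q_{\rm c}(t-D),\qquad T(s(t),t)=T_{\rm m},\qquad \dot s(t)=-\beta T_x(s(t),t),$$ with initial values $T(x,0)=T_0(x)$, $s(0)=s_0$, and the control law $$q_{\rm c}(t)=-c\left(\int_{t-D}^{t}q_{\rm c}(\theta)\,d\theta+\frac{k}{\alpha}\int_0^{s(t)}(T(x,t)-T_{\rm m})\,dx+\frac{k}{\beta}(s(t)-s_{\rm r})\right),\qquad t\ge 0.$$ Then the closed-loop system maintains the model validity condition $$T(x,t)\ge T_{\rm m}\quad\text{for all }x\in[0,s(t)],\ t>0,$$ and it is exponentially stable in the sense of the norm $$\Xi(t)=\|T(\cdot,t)-T_{\rm m}\|_{H^1(0,s(t))}^2+(s(t)-s_{\rm r})^2+\|q_{\rm c}(t-\cdot)\|_{H^1(0,D)}^2 .$$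
   Context: Constants: $\alpha=\frac{k}{\rho C_p}>0$ and $\beta=\frac{k}{\rho\,\Delta H^*}>0$, where $\rho,C_p,k,\Delta H^*>0$ are physical parameters (density, heat capacity, heat conductivity, latent heat of fusion); $T_{\rm m}$ is the (constant) melting temperature; $D>0$ is the input delay. $T(x,t)$ is the liquid temperature on $[0,s(t)]$, $s(t)$ is the liquid-solid interface position, and $q_{\rm c}(t)$ is the manipulated boundary heat flux. The values $q_{\rm c}(t)$ for $-D<t<0$ are given data (the past input). Assumption A1: $s_0>0$ and there is $H>0$ such that $T_{\rm m}\le T_0(x)\le T_{\rm m}+H(s_0-x)$ for all $x\in(0,s_0)$. Assumption A2: $q_{\rm c}(t)\ge 0$ for all $-D<t<0$. Assumption A3: $s_{\rm r}>s_0+\beta\left(\int_{-D}^{0}\frac{q_{\rm c}(t)}{k}\,dt+\frac1\alpha\int_0^{s_0}(T_0(x)-T_{\rm m})\,dx\right)$. Exponential stability in the sense of $\Xi$ means: there exist constants $M,b>0$, depending only on the parameters ($\alpha,\beta,k,D,c,s_{\rm r}$) and not on the initial data, such that $\Xi(t)\le M\,\Xi(0)\,e^{-bt}$ for all $t\ge0$. Here $\|q_{\rm c}(t-\cdot)\|_{H^1(0,D)}$ is the $H^1(0,D)$ norm of $x\mapsto q_{\rm c}(t-x)$. *)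

(* Defs.v *)
From HB Require Import structures.
From mathcomp Require Import all_boot all_order all_algebra.
From mathcomp Require Import all_classical all_reals all_analysis.

Set Implicit Arguments.
Unset Strict Implicit.
Unset Printing Implicit Defensive.

Import Order.TTheory GRing.Theory Num.Theory.
Import numFieldNormedType.Exports.

Local Open Scope classical_set_scope.
Local Open Scope ring_scope.

Section Sobolev.
Variable R : realType.
Implicit Types (a b : R) (f g phi : R -> R).

Definition C1c a b phi : Prop :=
  [/\ forall x, derivable phi x 1,
      continuous (derive1 phi) &
      exists l r, [/\ a < l, r < b & forall x, phi x != 0 -> l <= x <= r]].

Definition square_integrable a b f : Prop :=
  measurable_fun `]a, b[ f /\
  (\int[lebesgue_measure]_(x in `]a, b[) (f x ^+ 2)%:E < +oo)%E.

(* Both f and g are required to be in L^2(a, b). *)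
Definition H1_derivative a b f g : Prop :=
  [/\ square_integrable a b f, square_integrable a b g &
      forall phi, C1c a b phi ->
        \int[lebesgue_measure]_(x in `]a, b[) (f x * derive1 phi x) =
        - \int[lebesgue_measure]_(x in `]a, b[) (g x * phi x)].

(* The weak derivative is unique almost everywhere, so the infimum ranges over
   at most one value; it is +oo when f is not in H^1(a, b). *)
Definition H1_norm_sq a b f : \bar R :=
  ereal_inf [set (\int[lebesgue_measure]_(x in `]a, b[) (f x ^+ 2)%:E +
                  \int[lebesgue_measure]_(x in `]a, b[) (g x ^+ 2)%:E)%E
            | g in H1_derivative a b f].

End Sobolev.

Section Stefan.
Variable R : realType.
Implicit Types (alpha beta k D c sr Tm : R) (qc s : R -> R)
  (T : R -> R -> R).

(* The space-time domain occupied by the liquid; points are pairs (x, t). *)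
Definition liquid s : set (R * R) :=
  [set p | 0 <= p.2 /\ 0 <= p.1 <= s p.2].

Definition liquid_pos s : set (R * R) :=
  [set p | 0 < p.2 /\ 0 <= p.1 <= s p.2].

(* Classical solutions: T is continuous on the closed domain, including t = 0,
   and is C^{2,1} up to the lateral boundaries x = 0 and x = s(t) for t > 0.
   The functions Tx, Txx, Tt are the partial derivatives in the interior and
   their continuous extensions on the lateral boundaries, where they give the
   meaning of T_x(0,t) and T_x(s(t),t).  Continuity of T_x(0,.) makes qc
   continuous on ]-D, +oo[, in particular without jump at t = 0.  The values of T outside the liquid and
   of qc on ]-oo, -D] are irrelevant. *)
Definition stefan_solution alpha beta k D Tm (s0 : R) (T0 : R -> R)
    qc T s : Prop :=
  exists Tx Txx Tt : R -> R -> R,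
    [/\ {within liquid s, continuous (fun p => T p.1 p.2)},
        [/\ {within liquid_pos s, continuous (fun p => Tx p.1 p.2)},
            {within liquid_pos s, continuous (fun p => Txx p.1 p.2)} &
            {within liquid_pos s, continuous (fun p => Tt p.1 p.2)}],
        forall x t : R, 0 < t -> 0 < x < s t ->
          [/\ is_derive x 1 (fun y => T y t) (Tx x t),
              is_derive x 1 (fun y => Tx y t) (Txx x t) &
              is_derive t 1 (fun r => T x r) (Tt x t)],
        {within `[0, +oo[, continuous s} &
        [/\ forall x t : R, 0 < t -> 0 <= x <= s t -> Tt x t = alpha * Txx x t,
            forall t : R, 0 < t -> - k * Tx 0 t = qc (t - D),
            forall t : R, 0 <= t -> T (s t) t = Tm,
            forall t : R, 0 < t -> is_derive t 1 s (- beta * Tx (s t) t) &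
            s 0 = s0 /\ forall x : R, 0 <= x <= s0 -> T x 0 = T0 x]].

Definition control_law alpha beta k D c sr Tm qc T s : Prop :=
  forall t : R, 0 <= t ->
    qc t = - c * (\int[lebesgue_measure]_(theta in `[t - D, t]) qc theta
                  + k / alpha *
                    (\int[lebesgue_measure]_(x in `[0, s t]) (T x t - Tm))
                  + k / beta * (s t - sr)).

Definition assumption_A1 Tm (s0 : R) (T0 : R -> R) : Prop :=
  0 < s0 /\
  exists2 H, 0 < H &
    forall x : R, 0 < x < s0 -> Tm <= T0 x <= Tm + H * (s0 - x).

Definition assumption_A2 D qc : Prop :=
  forall t : R, - D < t < 0 -> 0 <= qc t.

(* The integrability clause expresses that the first integral is meaningful. *)
Definition assumption_A3 alpha beta k D sr Tm (s0 : R) (T0 : R -> R)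
    qc : Prop :=
  lebesgue_measure.-integrable `]- D, 0[ (EFin \o qc) /\
  s0 + beta * (\int[lebesgue_measure]_(t in `]- D, 0[) (qc t / k)
               + alpha^-1 *
                 \int[lebesgue_measure]_(x in `]0, s0[) (T0 x - Tm)) < sr.

Definition Xi D sr Tm qc T s (t : R) : \bar R :=
  (H1_norm_sq 0 (s t) (fun x => (T x t - Tm)%R)
   + ((s t - sr) ^+ 2)%:E
   + H1_norm_sq 0 D (fun x => qc (t - x)%R))%E.

End Stefan.

(* Main.v *)
(* Write u = T - Tm. The bracket in the feedback law has left derivative
   q_c, so that q_c(t) = q_c(0) e^(-c t) for t >= 0, with q_c(0) > 0 by A3.
   The heat flux at x = 0 is therefore nonnegative, and the maximum principle
   yields u >= 0, s' >= 0 and, by the feedback law, s < s_r.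
   For the decay in H^1, let h = - T_x(0, .). The functional
   V = \int_0^s T_x^2 - 2 h u(0, .) satisfies, as an upper left Dini derivative,
   V' <= - 2 h' u(0, .) - 2 alpha \int_0^s T_xx^2; comparing two times by convexity
   of the Dirichlet energy and integrating by parts avoids T_xt. Up to time D the
   variation of h is that of the past input, which is controlled by its H^1 norm;
   beyond D, h decays exponentially and a Poincare inequality bounds the energy by
   h^2 and \int T_xx^2. At t = 0, where T is only continuous, the energy is
   compared with the weak derivative of T_0. Finally the feedback law expresses
   s - s_r through q_c and u. *)

Require Import Defs.
From HB Require Import structures.
From mathcomp Require Import all_boot all_order all_algebra.
From mathcomp Require Import all_classical all_reals all_analysis.
From mathcomp Require Import measurable_realfun.
From mathcomp Require Import ring lra.

Import Order.TTheory GRing.Theory Num.Theory.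
Import numFieldNormedType.Exports.

Local Open Scope classical_set_scope.
Local Open Scope ring_scope.

Set Implicit Arguments.
Unset Strict Implicit.
Unset Printing Implicit Defensive.

(** Sign of the input and validity of the model depend on each other: the exponential law for [qc]
    is derived from positivity and monotonicity of the flow, and these need a nonnegative flux. The
    delay breaks the circle: the flux at time t is the input at t - D, so the argument advances by
    steps of length D. Positivity of s is not part of the notion of solution and has to be obtained
    on the way. Derivatives are taken from the left because the interface does not recede: for r < t
    the liquid at time r is contained in the liquid at time t, so the slice at r can be compared
    with the slice at t on its whole interval. Weak derivatives enter through the initial
    temperature and the past input. Their test functions vanish near the end points, whereas the
    estimates need boundary terms; hence the cutoffs and the integration by parts built from them.
    The constants may depend on the setpoint but not on the data, so every length is estimated by a
    bound L for s that is fixed in advance. *)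

(** * Algebra of functions continuous on a subset *)

Section WithinContinuous.
Variables (R : realType) (T : topologicalType).
Implicit Types (f g : T -> R) (A : set T).

Lemma ctsin_cst A (c : R) : {within A, continuous (fun _ : T => c)}.
Proof. by apply: continuous_subspaceT => x; exact: cvg_cst. Qed.

Lemma ctsinD A f g : {within A, continuous f} ->
  {within A, continuous g} -> {within A, continuous (fun x => f x + g x)}.
Proof. by move=> cf cg x; exact: (cvgD (cf x) (cg x)). Qed.

Lemma ctsinN A f : {within A, continuous f} ->
  {within A, continuous (fun x => - f x)}.
Proof. by move=> cf x; exact: (cvgN (cf x)). Qed.

Lemma ctsinB A f g : {within A, continuous f} ->
  {within A, continuous g} -> {within A, continuous (fun x => f x - g x)}.
Proof. by move=> cf cg x; exact: (cvgB (cf x) (cg x)). Qed.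

Lemma ctsinM A f g : {within A, continuous f} ->
  {within A, continuous g} -> {within A, continuous (fun x => f x * g x)}.
Proof. by move=> cf cg x; exact: (cvgM (cf x) (cg x)). Qed.

Lemma ctsin_norm A f : {within A, continuous f} ->
  {within A, continuous (fun x => `|f x|)}.
Proof. by move=> cf x; exact: (cvg_norm (cf x)). Qed.

Lemma ctsinX A f n : {within A, continuous f} ->
  {within A, continuous (fun x => f x ^+ n)}.
Proof.
move=> cf; elim: n => [|n IH]; first exact: ctsin_cst.
under eq_fun do rewrite exprS.
exact: ctsinM.
Qed.

Lemma ctsin_comp (U : topologicalType) (A : set T) (B : set U) (f : U -> R)
    (h : T -> U) :
  {within B, continuous f} -> {within A, continuous h} ->
  (forall x, A x -> B (h x)) -> {within A, continuous (fun x => f (h x))}.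
Proof.
move=> cf ch AB.
apply/subspace_continuousP => x Ax.
have hx := (subspace_continuousP A h).1 ch x Ax.
have fhx := (subspace_continuousP B f).1 cf (h x) (AB _ Ax).
apply: cvg_trans fhx => V; rewrite /fmap/= => BV.
have := hx _ BV; rewrite /fmap/= => {}hx.
rewrite /nbhs/=/within/= in hx *; apply: filterS hx => z /= zV Az.
by apply: zV => //; exact: AB.
Qed.

Lemma ctsin_eq A f g : (forall x, A x -> f x = g x) ->
  {within A, continuous f} -> {within A, continuous g}.
Proof.
by move=> fg; apply: subspace_eq_continuous => x /[1!inE]; exact: fg.
Qed.

End WithinContinuous.

Lemma ctsin_id (R : realType) (A : set R) : {within A, continuous (@id R)}.
Proof. by apply: continuous_subspaceT => x; exact: cvg_id. Qed.

Lemma segment_bounded (R : realType) (a b : R) (f : R -> R) :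
  {within `[a, b], continuous f} ->
  exists2 C, 0 < C & forall x, a <= x <= b -> `|f x| <= C.
Proof.
move=> cf; have [ab|ba] := leP a b; last first.
  by exists 1 => // x /andP[ax /(le_trans ax)]; rewrite leNgt ba.
have [c _ Hc] := EVT_max ab (ctsin_norm cf).
exists (`|f c| + 1); first by rewrite ltr_wpDl.
by move=> x xab; rewrite (le_trans (Hc x _)) ?lerDl// in_itv.
Qed.

Lemma is_derive_derivable (R : realType) (f : R -> R) (x d : R) :
  is_derive x 1 f d -> derivable f x 1.
Proof. by case. Qed.

Lemma is_derive_continuous (R : realType) (f : R -> R) (x d : R) :
  is_derive x 1 f d -> {for x, continuous f}.
Proof. by case=> /derivable1_diffP/differentiable_continuous. Qed.

(** * Integrals over compact segments *)

Section SegmentIntegral.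
Variable R : realType.
Implicit Types (a b c x y : R) (f g F G : R -> R).
Local Notation mu := (@lebesgue_measure R).

Definition integrable_on a b f := mu.-integrable `[a, b] (EFin \o f).

Lemma continuous_integrable_on a b f :
  {within `[a, b], continuous f} -> integrable_on a b f.
Proof. by move=> cf; apply: continuous_compact_integrable cf; exact: segment_compact. Qed.

Lemma integrable_onS a b c d f : a <= c -> d <= b ->
  integrable_on a b f -> integrable_on c d f.
Proof.
move=> ac db; apply: integrableS => //.
by apply: subset_itv; rewrite bnd_simp.
Qed.

Lemma integrable_onD a b f g : integrable_on a b f -> integrable_on a b g ->
  integrable_on a b (fun x => f x + g x).
Proof. by move=> fi gi; exact: (integrableD _ fi gi). Qed.

Lemma integrable_onZ a b f c : integrable_on a b f ->
  integrable_on a b (fun x => c * f x).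
Proof. by move=> fi; exact: (integrableZl _ c fi). Qed.

Lemma integrable_onB a b f g : integrable_on a b f -> integrable_on a b g ->
  integrable_on a b (fun x => f x - g x).
Proof. by move=> fi gi; exact: (integrableB _ fi gi). Qed.

Lemma integrable_on_cst a b c : integrable_on a b (fun=> c).
Proof.
by apply: continuous_integrable_on; apply: continuous_subspaceT => x; exact: cvg_cst.
Qed.

Lemma integral_split a b c f : a <= c -> c <= b -> integrable_on a b f ->
  \int[mu]_(x in `[a, b]) f x =
  \int[mu]_(x in `[a, c]) f x + \int[mu]_(x in `[c, b]) f x.
Proof.
move=> ac cb fi.
have := @Rintegral_itvB R f (BLeft a) (BRight b) c fi.
rewrite !bnd_simp => /(_ ac cb) /eqP; rewrite subr_eq => /eqP ->.
rewrite addrC; congr (_ + _).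
apply: Rintegral_itv_obnd_cbnd.
by apply: integrableS fi => //; apply: subset_itv; rewrite bnd_simp.
Qed.

Lemma segment_integral_cst a b c : a <= b -> \int[mu]_(x in `[a, b]) c = c * (b - a).
Proof.
move=> ab; rewrite Rintegral_cst//=.
rewrite lebesgue_measure_itv/= lte_fin.
case: ltP => //= ba; have -> : b = a by apply/le_anti; rewrite ab ba.
by rewrite subrr.
Qed.

Lemma norm_integral_le a b f C : a <= b -> integrable_on a b f ->
  (forall x, a <= x <= b -> `|f x| <= C) ->
  `|\int[mu]_(x in `[a, b]) f x| <= C * (b - a).
Proof.
move=> ab fi fC; apply: le_trans (le_normr_Rintegral _ fi) _ => //.
rewrite -segment_integral_cst//; apply: le_Rintegral => //.
- exact: (integrable_norm fi).
- exact: integrable_on_cst.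
Qed.

(** Bridge between the Sobolev definitions, which use open intervals, and the computations, which
    use closed segments. *)
Lemma integral_oo_cc a b f : integrable_on a b f ->
  \int[mu]_(x in `]a, b[) f x = \int[mu]_(x in `[a, b]) f x.
Proof.
move=> fi.
rewrite Rintegral_itv_bndo_bndc; last first.
  by apply: integrableS fi => //; apply: subset_itv; rewrite bnd_simp.
rewrite Rintegral_itv_obnd_cbnd//.
by apply: integrableS fi => //; apply: subset_itv; rewrite bnd_simp.
Qed.

Lemma segment_integral_le_oo a b f g :
  integrable_on a b f -> integrable_on a b g ->
  (forall x, a < x < b -> f x <= g x) ->
  \int[mu]_(x in `[a, b]) f x <= \int[mu]_(x in `[a, b]) g x.
Proof.
move=> fi gi fg; rewrite -!integral_oo_cc//; apply: le_Rintegral => //.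
- by apply: integrableS fi => //; apply: subset_itv; rewrite bnd_simp.
- by apply: integrableS gi => //; apply: subset_itv; rewrite bnd_simp.
Qed.

Lemma norm_integral_le_oo a b f C : a <= b -> integrable_on a b f ->
  (forall x, a < x < b -> `|f x| <= C) ->
  `|\int[mu]_(x in `[a, b]) f x| <= C * (b - a).
Proof.
move=> ab fi fC; apply: le_trans (le_normr_Rintegral _ fi) _ => //.
rewrite -segment_integral_cst//; apply: segment_integral_le_oo fC.
  exact: (integrable_norm fi).
exact: integrable_on_cst.
Qed.

Lemma segment_integral_le a b f g :
  integrable_on a b f -> integrable_on a b g ->
  (forall x, a <= x <= b -> f x <= g x) ->
  \int[mu]_(x in `[a, b]) f x <= \int[mu]_(x in `[a, b]) g x.
Proof. by move=> fi gi fg; apply: le_Rintegral => // x /=; rewrite in_itv/=; exact: fg. Qed.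

Lemma integrable_oo_cc a b f :
  mu.-integrable `]a, b[ (EFin \o f) -> integrable_on a b f.
Proof.
move=> /integrableP[mf fi]; apply/integrableP; split.
  exact: emeasurable_fun_itv_cc mf.
rewrite integral_itv_bndoo//; exact: measurableT_comp mf.
Qed.

Lemma segment_FTC a b f F : a <= b ->
  {within `[a, b], continuous f} -> {within `[a, b], continuous F} ->
  (forall x, a < x < b -> is_derive x 1 F (f x)) ->
  \int[mu]_(x in `[a, b]) f x = F b - F a.
Proof.
rewrite le_eqVlt => /orP[/eqP <- _ _ _|ab cf cF dF].
  by rewrite set_itv1 Rintegral_set1 subrr.
have [? ? ?] := (continuous_within_itvP _ ab).1 cF.
rewrite /Rintegral (@continuous_FTC2 _ f F)//.
- split => // x; rewrite in_itv/= => /dF dFx; exact: ex_derive.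
- move=> x; rewrite in_itv/= => /dF dFx.
  by rewrite derive1E derive_val.
Qed.

Lemma segment_IBP a b f F g G : a <= b ->
  {within `[a, b], continuous f} -> {within `[a, b], continuous F} ->
  {within `[a, b], continuous g} -> {within `[a, b], continuous G} ->
  (forall x, a < x < b -> is_derive x 1 F (f x)) ->
  (forall x, a < x < b -> is_derive x 1 G (g x)) ->
  \int[mu]_(x in `[a, b]) (F x * g x) =
  F b * G b - F a * G a - \int[mu]_(x in `[a, b]) (f x * G x).
Proof.
rewrite le_eqVlt => /orP[/eqP <- *|ab cf cF cg cG dF dG].
  by rewrite set_itv1 !Rintegral_set1 !subrr.
have [? ? ?] := (continuous_within_itvP _ ab).1 cF.
have [? ? ?] := (continuous_within_itvP _ ab).1 cG.
apply: Rintegration_by_parts => //.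
- split => // x; rewrite in_itv/= => /dF dFx; exact: ex_derive.
- by move=> x; rewrite in_itv/= => /dF dFx; rewrite derive1E derive_val.
- split => // x; rewrite in_itv/= => /dG dFx; exact: ex_derive.
- by move=> x; rewrite in_itv/= => /dG dFx; rewrite derive1E derive_val.
Qed.

(* Expand the square of [f] minus its mean. *)
Lemma Cauchy_Schwarz_segment a b f : a <= b -> integrable_on a b f ->
  integrable_on a b (fun x => f x ^+ 2) ->
  (\int[mu]_(x in `[a, b]) f x) ^+ 2 <=
  (b - a) * \int[mu]_(x in `[a, b]) f x ^+ 2.
Proof.
rewrite le_eqVlt => /orP[/eqP <- _ _|ab fi f2i].
  by rewrite set_itv1 !Rintegral_set1 subrr expr0n/= mul0r.
set I := \int[mu]_(x in _) f x; set J := \int[mu]_(x in _) f x ^+ 2.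
have ba0 : 0 < b - a by rewrite subr_gt0.
pose m := I / (b - a).
have : 0 <= \int[mu]_(x in `[a, b]) (f x - m) ^+ 2.
  by apply: Rintegral_ge0 => x _; exact: sqr_ge0.
have -> : \int[mu]_(x in `[a, b]) (f x - m) ^+ 2 =
    \int[mu]_(x in `[a, b]) ((f x ^+ 2 + (- (2 * m)) * f x) + m ^+ 2).
  by apply: eq_Rintegral => x _; ring.
rewrite RintegralD//; last 2 first.
- by apply: integrable_onD => //; exact: integrable_onZ.
- exact: integrable_on_cst.
rewrite RintegralD//; last exact: integrable_onZ.
rewrite RintegralZl// segment_integral_cst ?(ltW ab)// -/I -/J => H.
have : 0 <= (b - a) * (J + - (2 * m) * I + m ^+ 2 * (b - a)).
  by rewrite mulr_ge0// ltW.
have -> : (b - a) * (J + - (2 * m) * I + m ^+ 2 * (b - a)) = (b - a) * J - I ^+ 2.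
  by rewrite /m; field; rewrite gt_eqF.
by rewrite subr_ge0.
Qed.

End SegmentIntegral.

(** * One-sided slopes and a comparison principle *)

Section LeftSlope.
Variable R : realType.
Implicit Types (a b d e t : R) (f g : R -> R).

(* The upper left Dini derivative of [f] at [t] is at most [d]. *)
Definition left_slope_le f t d :=
  forall e, 0 < e -> \forall r \near t^'-, f t - f r <= (d + e) * (t - r).

Lemma left_slope_leW f t d d' : d <= d' ->
  left_slope_le f t d -> left_slope_le f t d'.
Proof.
move=> dd' fd e e0; near=> r.
have rt : r < t by near: r; exact: nbhs_left_lt.
apply: (@le_trans _ _ ((d + e) * (t - r))); first by near: r; exact: fd.
by rewrite ler_wpM2r ?subr_ge0 ?(ltW rt)// lerD2r.
Unshelve. all: by end_near. Qed.

Lemma left_slope_leD f g t d d' :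
  left_slope_le f t d -> left_slope_le g t d' ->
  left_slope_le (fun x => f x + g x) t (d + d').
Proof.
move=> fd gd e e0.
have e2 : 0 < e / 2 by rewrite divr_gt0.
near=> r.
have Hf : f t - f r <= (d + e / 2) * (t - r) by near: r; exact: fd.
have Hg : g t - g r <= (d' + e / 2) * (t - r) by near: r; exact: gd.
have -> : f t + g t - (f r + g r) = (f t - f r) + (g t - g r) by ring.
apply: le_trans (lerD Hf Hg) _.
by rewrite le_eqVlt; apply/orP; left; apply/eqP; field.
Unshelve. all: by end_near. Qed.

(** An expansion of the increment instead of a limit of quotients: errors of several estimates can
    then simply be added. *)
Definition left_derive f t d :=
  forall e, 0 < e -> \forall r \near t^'-, `|f t - f r - d * (t - r)| <= e * (t - r).

Lemma is_derive_left_derive f t d : is_derive t 1 f d -> left_derive f t d.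
Proof.
move=> fd e e0.
have dfd := @ex_derive _ _ _ _ _ _ _ fd.
have /cvgrPdist_le/(_ _ e0) := dfd.
rewrite -/('D_1 f t) derive_val => -[dl /= dl0 H].
near=> r.
have rt : r < t by near: r; exact: nbhs_left_lt.
have rdl : t - dl < r.
  by near: r; apply: nbhs_left_gt; rewrite ltrBlDr ltrDl.
have := H (r - t); rewrite /= sub0r normrN ltr0_norm ?subr_lt0// opprB.
rewrite ltrBlDl -ltrBlDr => /(_ rdl).
rewrite subr_eq0 (lt_eqF rt) => /(_ isT).
have tr0 : 0 < t - r by rewrite subr_gt0.
rewrite /= [_ *: 1]mulr1 subrK => {}H.
have -> : f t - f r - d * (t - r) = - (d - (r - t)^-1 *: (f r - f t)) * (t - r).
  by rewrite /GRing.scale/=; field; rewrite lt_eqF// subr_lt0.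
by rewrite normrM normrN (gtr0_norm tr0) ler_wpM2r// ltW.
Unshelve. all: by end_near. Qed.

Lemma left_derive_le f t d : left_derive f t d -> left_slope_le f t d.
Proof.
move=> fd e e0; near=> r.
have : `|f t - f r - d * (t - r)| <= e * (t - r) by near: r; exact: fd.
by rewrite ler_norml => /andP[_]; rewrite mulrDl lerBlDl.
Unshelve. all: by end_near. Qed.

Lemma left_deriveD f g t d d' : left_derive f t d -> left_derive g t d' ->
  left_derive (fun x => f x + g x) t (d + d').
Proof.
move=> fd gd e e0.
have e2 : 0 < e / 2 by rewrite divr_gt0.
near=> r.
have Hf : `|f t - f r - d * (t - r)| <= e / 2 * (t - r) by near: r; exact: fd.
have Hg : `|g t - g r - d' * (t - r)| <= e / 2 * (t - r) by near: r; exact: gd.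
have -> : f t + g t - (f r + g r) - (d + d') * (t - r) =
  (f t - f r - d * (t - r)) + (g t - g r - d' * (t - r)) by ring.
by apply: le_trans (ler_normD _ _) (le_trans (lerD Hf Hg) _); rewrite -mulrDl -splitr.
Unshelve. all: by end_near. Qed.

Lemma left_deriveZ f t d c : left_derive f t d ->
  left_derive (fun x => c * f x) t (c * d).
Proof.
move=> fd e e0.
have c1 : 0 < `|c| + 1 by rewrite ltr_wpDl.
near=> r.
have rt : r < t by near: r; exact: nbhs_left_lt.
have H : `|f t - f r - d * (t - r)| <= e / (`|c| + 1) * (t - r).
  by near: r; apply: fd; rewrite divr_gt0.
have -> : c * f t - c * f r - c * d * (t - r) = c * (f t - f r - d * (t - r)) by ring.
rewrite normrM; apply: le_trans (ler_wpM2l (normr_ge0 _) H) _.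
rewrite mulrA ler_wpM2r ?subr_ge0 ?(ltW rt)//.
by rewrite mulrCA ger_pMr// ler_pdivrMr// mul1r lerDl.
Unshelve. all: by end_near. Qed.

Lemma left_derive_cst c t : left_derive (fun=> c) t 0.
Proof. exact: is_derive_left_derive (is_derive_cst c t 1). Qed.

(* If [f] became positive, then [f x - eta * (x - a)] would have a positive
   maximum, contradicting the slope bound just to the left of it. *)
Lemma left_slope_comparison a b f : a <= b ->
  {within `[a, b], continuous f} -> f a <= 0 ->
  (forall t, a < t <= b -> 0 < f t -> left_slope_le f t 0) -> f b <= 0.
Proof.
move=> ab cf fa0 fslope; rewrite leNgt; apply/negP => fb0.
have ba1 : 0 < b - a + 1 by rewrite ltr_wpDl// subr_ge0.
(* Chosen so that [f b - eta * (b - a) = eta], which is still positive. *)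
pose eta := f b / (b - a + 1).
have eta0 : 0 < eta by rewrite divr_gt0.
pose g x := f x - eta * (x - a).
have cg : {within `[a, b], continuous g}.
  apply: ctsinB => //; apply: ctsinM.
    exact: ctsin_cst.
  by apply: ctsinB; [exact: ctsin_id|exact: ctsin_cst].
have gb0 : 0 < g b.
  have -> : g b = eta by rewrite /g /eta; field; rewrite gt_eqF.
  by [].
have [c /[!in_itv]/= /andP[ac cb] cmax] := EVT_max ab cg.
have gc0 : 0 < g c by rewrite (lt_le_trans gb0)// cmax// in_itv/= ab lexx.
have fc0 : 0 < f c.
  by apply: lt_le_trans gc0 _; rewrite /g gerBl mulr_ge0 ?(ltW eta0) ?subr_ge0.
have {}ac : a < c.
  rewrite lt_neqAle ac andbT; apply/eqP => acE.
  by move: fc0; rewrite -acE ltNge fa0.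
(* Just left of the maximum [c], maximality makes the increment of [f] at least [eta * (c - r)],
   while the slope bound allows only half of that. *)
have eta2 : 0 < eta / 2 by rewrite divr_gt0.
have : \forall r \near c^'-, False; last by move=> /filter_ex[].
near=> r.
have rc : r < c by near: r; exact: nbhs_left_lt.
have ar : a < r by near: r; exact: nbhs_left_gt.
have H : f c - f r <= (0 + eta / 2) * (c - r).
  by near: r; apply: fslope; rewrite ?ac.
have := cmax r; rewrite in_itv/= (ltW ar) (le_trans (ltW rc) cb) => /(_ isT).
rewrite /g => H2; have rc0 : 0 < eta * (c - r) by rewrite mulr_gt0// subr_gt0.
move: H; rewrite add0r => H; lra.
Unshelve. all: by end_near. Qed.

End LeftSlope.

(** * Functions and integrals on a domain with moving end point *)

Section MovingDomain.
Variable R : realType.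
Local Notation mu := (@lebesgue_measure R).

Definition clamp (b x : R) := Num.min (Num.max x 0) b.

Lemma clamp_id b x : 0 <= x <= b -> clamp b x = x.
Proof. by move=> /andP[x0 xb]; rewrite /clamp (max_idPl x0) (min_idPl xb). Qed.

Lemma clamp_itv b x : 0 <= b -> 0 <= clamp b x <= b.
Proof. by move=> b0; rewrite /clamp le_min b0 le_max lexx orbT/= ge_min lexx orbT. Qed.

Definition clampt (a b t : R) := Num.min (Num.max t a) b.

Lemma clampt_id a b t : a <= t <= b -> clampt a b t = t.
Proof. by move=> /andP[ta tb]; rewrite /clampt (max_idPl ta) (min_idPl tb). Qed.

Lemma clampt_itv a b t : a <= b -> a <= clampt a b t <= b.
Proof. by move=> ab; rewrite /clampt le_min ab andbT le_max lexx orbT/= ge_min lexx orbT. Qed.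

Lemma continuous_clampt a b : continuous (clampt a b).
Proof.
move=> t; apply: (@continuous_min R _ (fun t => Num.max t a) (cst b)).
  by apply: (@continuous_max R _ id (cst a)); [exact: cvg_id|exact: cvg_cst].
exact: cvg_cst.
Qed.

(* Precomposition with [clamp] and [clampt] turns continuity up to the curved
   boundary into continuity on the whole plane. *)
Definition extend (a b : R) (s : R -> R) (G : R -> R -> R) (p : R * R) :=
  G (clamp (s (clampt a b p.2)) p.1) (clampt a b p.2).

Lemma extendE a b s G x t : a <= t <= b -> 0 <= x <= s t ->
  extend a b s G (x, t) = G x t.
Proof. by move=> tab xs; rewrite /extend/= clampt_id// clamp_id. Qed.

Lemma extend_continuous (s : R -> R) (Dom : set (R * R))
    (G : R -> R -> R) (a b : R) :
  0 <= a -> a <= b -> {within `[0, +oo[, continuous s} ->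
  (forall t : R, a <= t <= b -> 0 <= s t) ->
  (forall x t : R, a <= t <= b -> 0 <= x <= s t -> Dom (x, t)) ->
  {within Dom, continuous (fun p => G p.1 p.2)} ->
  continuous (extend a b s G).
Proof.
move=> a0 ab cs s0 domE cG; apply/continuous_subspace_setT.
have cmax : continuous (fun p : R * R => clampt a b p.2).
  move=> p; apply: (@continuous_comp _ _ _ (fun p : R * R => p.2) (clampt a b)).
    exact: cvg_snd.
  exact: continuous_clampt.
have csm : continuous (fun p : R * R => s (clampt a b p.2)).
  apply/continuous_subspace_setT; apply: (ctsin_comp (h := fun p : R * R => clampt a b p.2) cs).
    exact: continuous_subspaceT.
  move=> p _ /=; rewrite in_itv/= andbT.
  by case/andP: (clampt_itv p.2 ab) => /(le_trans a0).
apply: (ctsin_comp (h := fun p : R * R =>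
  (clamp (s (clampt a b p.2)) p.1, clampt a b p.2)) cG); last first.
  move=> p _; have tI := clampt_itv p.2 ab.
  by apply: domE => //; apply: clamp_itv; exact: s0.
apply: continuous_subspaceT.
have cc : continuous (fun p : R * R => clamp (s (clampt a b p.2)) p.1).
  move=> p.
  apply: (@continuous_min R _ (fun p : R * R => Num.max p.1 0) (fun p => s (clampt a b p.2))).
    apply: (@continuous_max R _ (fun p : R * R => p.1) (cst 0)).
      exact: cvg_fst.
    exact: cvg_cst.
  exact: csm.
move=> p; exact: (cvg_pair (cc p) (cmax p)).
Qed.

(** Tube lemma: compactness of the segment turns the neighbourhoods of the points [(x, t)] into one
    neighbourhood of [t] that serves all [x]. *)
Lemma uniform_near_segment (G : R * R -> R) (a b t e : R) : continuous G -> 0 < e ->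
  \forall r \near t, forall x, a <= x <= b -> `|G (x, r) - G (x, t)| <= e.
Proof.
move=> cG e0.
have /compact_near_coveringP cov := @segment_compact R a b.
have := cov _ (nbhs t) (fun r x => `|G (x, r) - G (x, t)| <= e) _.
apply; move=> x _.
have e2 : 0 < e / 2 by rewrite divr_gt0.
have /cvgrPdist_le /(_ _ e2) [[U V] /= [xU tV] H] := cG (x, t).
exists (U, V) => //= -[y r] [/= Uy Vr].
have H1 := H (y, r) (conj Uy Vr).
have H2 := H (y, t) (conj Uy (nbhs_singleton tV)).
rewrite -(subrKA (G (x, t))); apply: le_trans (ler_normD _ _) _.
by rewrite [leRHS]splitr lerD// distrC.
Qed.

Lemma continuous_section (G : R * R -> R) t :
  continuous G -> continuous (fun x => G (x, t)).
Proof.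
move=> cG x.
have cx : (fun y : R => (y, t)) @ x --> (x, t).
  by apply: (@cvg_pair _ _ _ _ (nbhs x) (nbhs t)); [exact: cvg_id|exact: cvg_cst].
exact: (cvg_comp _ _ cx (cG (x, t))).
Qed.

(** The difference of two such integrals consists of the change of the integrand on the shorter
    interval and of a thin strip between the end points. *)
Lemma moving_integral_continuous (s : R -> R) (G : R * R -> R) :
  continuous s -> (forall t, 0 <= s t) -> continuous G ->
  continuous (fun t => \int[mu]_(x in `[0, s t]) G (x, t)).
Proof.
move=> cs s0 cG t; apply/cvgrPdist_le => e e0.
have L0 : 0 < s t + 1 by rewrite ltr_wpDl.
have [C C0 HC] : exists2 C, 0 < C & forall x, 0 <= x <= s t + 1 -> `|G (x, t)| <= C.
  by apply: segment_bounded; apply: continuous_subspaceT; exact: continuous_section.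
(* The common interval has length at most [s t + 1] and costs [e1] per unit of length; on the strip
   the integrand is at most [C + e1] and the length at most [e2]. Each contributes [e / 2]. *)
pose e1 := e / 2 / (s t + 1).
pose e2 := e / 2 / (C + e1).
have e10 : 0 < e1 by rewrite !divr_gt0.
have Ce0 : 0 < C + e1 by rewrite addr_gt0.
have e20 : 0 < e2 by rewrite !divr_gt0.
have GI b r : integrable_on 0 b (fun x => G (x, r)).
  by apply: continuous_integrable_on; apply: continuous_subspaceT; exact: continuous_section.
have H1 : \forall r \near t, forall x, 0 <= x <= s t + 1 -> `|G (x, r) - G (x, t)| <= e1.
  exact: uniform_near_segment.
have H2 : \forall r \near t, `|s t - s r| <= e2.
  by move/cvgrPdist_le : (cs t); apply.
have H3 : \forall r \near t, `|s t - s r| <= 1.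
  by move/cvgrPdist_le : (cs t); apply.
near=> r.
have K1 : forall x, 0 <= x <= s t + 1 -> `|G (x, r) - G (x, t)| <= e1 by near: r.
have K2 : `|s t - s r| <= e2 by near: r.
have K3 : s r <= s t + 1.
  have : `|s t - s r| <= 1 by near: r.
  by rewrite ler_distlC addrC => /andP[_]; rewrite addrC.
have HCr x : 0 <= x <= s t + 1 -> `|G (x, r)| <= C + e1.
  move=> x0; rewrite -(subrK (G (x, t)) (G (x, r))) addrC.
  by rewrite (le_trans (ler_normD _ _))// lerD ?HC ?K1.
have step p : 0 <= p -> p <= s t + 1 -> `|\int[mu]_(x in `[0, p]) (G (x, t) - G (x, r))| <= e / 2.
  move=> p0 pL.
  apply: le_trans (@norm_integral_le R 0 p _ e1 p0 _ _) _.
  - exact: integrable_onB.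
  - by move=> x /andP[x0 xp]; rewrite distrC K1// x0 (le_trans xp pL).
  - by rewrite subr0 /e1 mulrAC ler_pdivrMr// ler_wpM2l// divr_ge0// ltW.
have strip p q r' : 0 <= p -> p <= q -> q <= s t + 1 -> `|p - q| <= e2 ->
    (forall x, 0 <= x <= s t + 1 -> `|G (x, r')| <= C + e1) ->
    `|\int[mu]_(x in `[p, q]) G (x, r')| <= e / 2.
  move=> p0 pq qL pqe HG.
  apply: le_trans (@norm_integral_le R p q _ (C + e1) pq _ _) _.
  - exact: (integrable_onS p0 (lexx q) (GI q r')).
  - by move=> x /andP[px xq]; rewrite HG// (le_trans p0 px) (le_trans xq qL).
  - rewrite -ler_pdivlMl// mulrC; move: pqe; rewrite distrC ger0_norm ?subr_ge0//.
rewrite [leRHS]splitr.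
have [srt|/ltW str] := leP (s r) (s t).
  rewrite (integral_split (s0 r) srt (GI (s t) t)) addrAC -RintegralB//; [|exact: GI..].
  apply: le_trans (ler_normD _ _) (lerD _ _); first by apply: step => //; exact: s0.
  apply: strip => //; first by rewrite lerDl.
    by rewrite distrC.
  by move=> x x0; rewrite (le_trans (HC _ x0))// lerDl ltW.
rewrite (integral_split (s0 t) str (GI (s r) r)) opprD addrA -RintegralB//; [|exact: GI..].
apply: le_trans (ler_normD _ _) (lerD _ _).
  by apply: step => //; rewrite lerDl.
by rewrite normrN; exact: strip.
Unshelve. all: by end_near. Qed.

End MovingDomain.

(** * Piecewise quadratic cutoff functions *)

Section Cutoff.
Variable R : realType.
Local Notation mu := (@lebesgue_measure R).
Implicit Types (a b z e : R).

Definition ramp z := Num.max z 0.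

Lemma ramp_cases z : (0 <= z /\ ramp z = z) \/ (z <= 0 /\ ramp z = 0).
Proof.
rewrite /ramp; have [z0|z0] := leP z 0; [right|left]; split => //.
exact: ltW.
Qed.

Lemma continuous_ramp : continuous ramp.
Proof.
move=> z; apply: (@continuous_max R R id (cst 0)); [exact: cvg_id|exact: cvg_cst].
Qed.

Lemma is_derive_ramp2 z : is_derive z 1 (fun x => ramp x ^+ 2) (2 * ramp z).
Proof.
have [z0|z0|->] := ltgtP z 0.
- apply: (@near_eq_is_derive R R R (fun=> 0)).
    near=> x; have x0 : x < 0 by near: x; exact: lt_nbhsl.
    by rewrite /ramp (max_idPr (ltW x0)) expr0n.
  by rewrite /ramp (max_idPr (ltW z0)) mulr0; exact: is_derive_cst.
- apply: (@near_eq_is_derive R R R (fun x => x ^+ 2)).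
    near=> x; have x0 : 0 < x by near: x; exact: lt_nbhsr.
    by rewrite /ramp (max_idPl (ltW x0)).
  rewrite /ramp (max_idPl (ltW z0)).
  have := @is_deriveX R R id 2 z 1 1 (is_derive_id _ _).
  by rewrite /GRing.scale/= mulr1 expr1.
(* At the kink, [ramp x ^+ 2 = ramp x * x], so [ramp] itself is the Caratheodory factor. *)
- apply/is_derive1_caratheodory; exists ramp; split.
  + move=> x; rewrite /ramp maxxx expr0n subr0.
    by have [x0|x0] := leP x 0; rewrite ?expr0n ?mul0r// subr0 expr2.
  + exact: continuous_ramp.
  + by rewrite /ramp maxxx mulr0.
Unshelve. all: by end_near. Qed.

(* A C^1 step from 0 to 1 across [0, 2] and its derivative, a hat function. *)
Definition cstep z := (ramp z ^+ 2 - 2 * ramp (z - 1) ^+ 2 + ramp (z - 2) ^+ 2) / 2.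
Definition hat z := ramp z - 2 * ramp (z - 1) + ramp (z - 2).

Ltac ramp_split z :=
  have [[? ->]|[? ->]] := ramp_cases z;
  have [[? ->]|[? ->]] := ramp_cases (z - 1);
  have [[? ->]|[? ->]] := ramp_cases (z - 2).

Lemma cstep_lo z : z <= 0 -> cstep z = 0.
Proof. by move=> z0; rewrite /cstep; ramp_split z; nra. Qed.

Lemma cstep_hi z : 2 <= z -> cstep z = 1.
Proof. by move=> z0; rewrite /cstep; ramp_split z; nra. Qed.

Lemma cstep_ge0 z : 0 <= cstep z.
Proof. by rewrite /cstep; ramp_split z; nra. Qed.

Lemma cstep_le1 z : cstep z <= 1.
Proof. by rewrite /cstep; ramp_split z; nra. Qed.

Lemma hat_lo z : z <= 0 -> hat z = 0.
Proof. by move=> z0; rewrite /hat; ramp_split z; lra. Qed.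

Lemma hat_hi z : 2 <= z -> hat z = 0.
Proof. by move=> z0; rewrite /hat; ramp_split z; lra. Qed.

Lemma hat_ge0 z : 0 <= hat z.
Proof. by rewrite /hat; ramp_split z; lra. Qed.

Lemma is_derive_shift_scale (f : R -> R) (c d z df : R) :
  is_derive (c * z + d) 1 f df -> is_derive z 1 (fun x => f (c * x + d)) (c * df).
Proof.
move=> /is_derive1_caratheodory[g [gE gC <-]].
apply/is_derive1_caratheodory; exists (fun x => c * g (c * x + d)); split => //.
- by move=> x; rewrite gE; ring.
- apply: cvgM; first exact: cvg_cst.
  apply: (@continuous_comp _ _ _ (fun x => c * x + d) g) => //.
  by apply: cvgD; [apply: cvgM; [exact: cvg_cst|exact: cvg_id]|exact: cvg_cst].
Qed.

Lemma is_derive_cstep z : is_derive z 1 cstep (hat z).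
Proof.
have H0 := is_derive_ramp2 z.
have H c : is_derive z 1 (fun x => ramp (x - c) ^+ 2) (2 * ramp (z - c)).
  have := @is_derive_shift_scale (fun x => ramp x ^+ 2) 1 (- c) z _ (is_derive_ramp2 _).
  by rewrite !mul1r; under eq_fun do rewrite mul1r.
have -> : cstep = fun x => 2^-1 * (ramp x ^+ 2 - 2 * ramp (x - 1) ^+ 2 + ramp (x - 2) ^+ 2).
  by apply/funext => x; rewrite mulrC.
have -> : hat z = 2^-1 * (2 * ramp z - 2 * (2 * ramp (z - 1)) + 2 * ramp (z - 2)).
  by rewrite /hat; field.
exact: (is_deriveZ 2^-1 (is_deriveD (is_deriveB H0 (is_deriveZ 2 (H 1))) (H 2))).
Qed.

Lemma continuous_hat : continuous hat.
Proof.
have cr c : continuous (fun x => ramp (x - c)).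
  move=> x; apply: (@continuous_comp _ _ _ (fun x => x - c) ramp); last exact: continuous_ramp.
  by apply: cvgB; [exact: cvg_id|exact: cvg_cst].
move=> z; apply: cvgD; last exact: cr.
apply: cvgB; first exact: continuous_ramp.
by apply: cvgM; [exact: cvg_cst|exact: cr].
Qed.

(* Equal to 1 on [a + 3e, b - 3e] and to 0 outside [a + e, b - e]. *)
Definition cutoff a b e z := cstep (e^-1 * z + (- (a + e) / e)) - cstep (e^-1 * z + (- (b - 3 * e) / e)).
Definition dcutoff a b e z :=
  e^-1 * hat (e^-1 * z + (- (a + e) / e)) - e^-1 * hat (e^-1 * z + (- (b - 3 * e) / e)).

Lemma is_derive_cutoff a b e z : is_derive z 1 (cutoff a b e) (dcutoff a b e z).
Proof.
by apply: is_deriveB; apply: is_derive_shift_scale; exact: is_derive_cstep.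
Qed.

Lemma continuous_cutoff a b e : continuous (cutoff a b e).
Proof.
move=> z; exact: is_derive_continuous (is_derive_cutoff a b e z).
Qed.

Lemma continuous_dcutoff a b e : continuous (dcutoff a b e).
Proof.
have ch d : continuous (fun z => e^-1 * hat (e^-1 * z + d)).
  move=> z; apply: cvgM; first exact: cvg_cst.
  apply: (@continuous_comp _ _ _ (fun x => e^-1 * x + d) hat); last exact: continuous_hat.
  by apply: cvgD; [apply: cvgM; [exact: cvg_cst|exact: cvg_id]|exact: cvg_cst].
by move=> z; apply: cvgB; exact: ch.
Qed.

Lemma scaleE e z p : 0 < e -> e^-1 * z + (- p / e) = (z - p) / e.
Proof. by move=> e0; field; rewrite gt_eqF. Qed.

Lemma cutoff_out a b e z : 0 < e -> 6 * e < b - a ->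
  z <= a + e \/ b - e <= z -> cutoff a b e z = 0 /\ dcutoff a b e z = 0.
Proof.
move=> e0 eab; rewrite /cutoff /dcutoff !scaleE//; case=> H.
  have H1 : (z - (a + e)) / e <= 0 by rewrite ler_pdivrMr//; lra.
  have H2 : (z - (b - 3 * e)) / e <= 0 by rewrite ler_pdivrMr//; lra.
  by rewrite !cstep_lo// !hat_lo// !mulr0 subrr.
have H1 : 2 <= (z - (a + e)) / e by rewrite ler_pdivlMr//; lra.
have H2 : 2 <= (z - (b - 3 * e)) / e by rewrite ler_pdivlMr//; lra.
by rewrite !cstep_hi// !hat_hi// !mulr0 !subrr.
Qed.

Lemma cutoff_in a b e z : 0 < e -> a + 3 * e <= z <= b - 3 * e -> cutoff a b e z = 1.
Proof.
move=> e0 /andP[az zb]; rewrite /cutoff !scaleE//.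
have H1 : 2 <= (z - (a + e)) / e by rewrite ler_pdivlMr//; lra.
have H2 : (z - (b - 3 * e)) / e <= 0 by rewrite ler_pdivrMr//; lra.
by rewrite cstep_hi// cstep_lo// subr0.
Qed.

(** As [6 * e < b - a], the two transition zones are disjoint, and at each point one of the two
    steps is constant. *)
Lemma cutoff_ge0_le1 a b e z : 0 < e -> 6 * e < b - a -> 0 <= cutoff a b e z <= 1.
Proof.
move=> e0 eab; rewrite /cutoff !scaleE//; have [za|za] := leP z (a + 3 * e).
  have H2 : (z - (b - 3 * e)) / e <= 0 by rewrite ler_pdivrMr//; lra.
  by rewrite [X in _ - X]cstep_lo// subr0 cstep_ge0 cstep_le1.
have H1 : 2 <= (z - (a + e)) / e by rewrite ler_pdivlMr//; lra.
by rewrite [X in X - _]cstep_hi// subr_ge0 cstep_le1/= gerBl cstep_ge0.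
Qed.

End Cutoff.

(** * Square integrability and removal of cutoffs *)

Section WeakDerivative.
Variable R : realType.
Local Notation mu := (@lebesgue_measure R).
Implicit Types (a b e : R) (f g P : R -> R).

Lemma measurable_within a b f : {within `[a, b], continuous f} ->
  measurable_fun `[a, b] f.
Proof. by move=> cf; apply: subspace_continuous_measurable_fun. Qed.

Lemma integrable_onM a b f g : integrable_on a b f ->
  {within `[a, b], continuous g} -> integrable_on a b (fun x => f x * g x).
Proof.
move=> fi cg; have [C C0 HC] := segment_bounded cg.
apply: (@integrableMl _ _ R mu `[a, b] _ (EFin \o f) g) => //.
- exact: measurable_within.
- exists C; split; first exact: num_real.
  by move=> D CD x /=; rewrite in_itv/= => /HC /le_trans; apply; exact: ltW.
Qed.

(** Integrability comes from [|f| <= 1 + f ^+ 2] on a bounded interval. *)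
Lemma square_integrableP a b f : square_integrable a b f <->
  integrable_on a b f /\ integrable_on a b (fun x => f x ^+ 2).
Proof.
split=> [[mf f2]|[fi f2]].
  have f2i : integrable_on a b (fun x => f x ^+ 2).
    apply: integrable_oo_cc; apply/integrableP; split.
      by apply/measurable_EFinP; exact: measurable_funX.
    by under eq_integral do rewrite /= ger0_norm ?sqr_ge0//.
  split => //.
  apply: (@le_integrable _ _ _ mu `[a, b] _ _ (EFin \o (fun x => 1 + f x ^+ 2))) => //.
  - apply/measurable_EFinP; exact: measurable_fun_itv_cc mf.
  - move=> x _ /=; rewrite lee_fin [leRHS]ger0_norm ?addr_ge0 ?sqr_ge0//.
    by rewrite ler_norml; apply/andP; split; nra.
  - by apply: integrable_onD => //; exact: integrable_on_cst.
have sub : `]a, b[ `<=` `[a, b] by apply: subset_itv; rewrite bnd_simp.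
split.
  have /integrableP[mf _] : mu.-integrable `]a, b[ (EFin \o f) by exact: integrableS fi.
  exact/measurable_EFinP.
have /integrableP[_] : mu.-integrable `]a, b[ (EFin \o (fun x => f x ^+ 2)).
  exact: integrableS f2.
by under eq_integral do rewrite /= ger0_norm ?sqr_ge0//.
Qed.

(** Only two end zones of length [3 * e] contribute, and there the integral of [|g|] is small by
    continuity of its primitive. *)
Lemma cutoff_integral_cvg a b g (d : R) : a < b -> integrable_on a b g -> 0 < d ->
  \forall e \near 0^'+,
    `|\int[mu]_(x in `[a, b]) g x - \int[mu]_(x in `[a, b]) (g x * cutoff a b e x)| <= d.
Proof.
move=> ab gi d0.
have ni : integrable_on a b (fun x => `|g x|) by exact: integrable_norm gi.
have d2 : 0 < d / 2 by rewrite divr_gt0.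
pose I x := \int[mu]_(y in `[a, x]) `|g y|.
have Icont := parameterized_integral_continuous (ltW ab) ni.
have [_ Ia Ib] := (continuous_within_itvP _ ab).1 Icont.
have I0 : I a = 0 by rewrite /I set_itv1 Rintegral_set1.
have /cvgrPdist_le/(_ _ d2)[l /= l0 Hl] := Ia.
have /cvgrPdist_le/(_ _ d2)[r /= r0 Hr] := Ib.
have {}Hl t : `|a - t| < l -> a < t -> `|I a - I t| <= d / 2 by exact: Hl.
have {}Hr t : `|b - t| < r -> t < b -> `|I b - I t| <= d / 2 by exact: Hr.
near=> e.
have e0 : 0 < e by near: e; exact: nbhs_right_gt.
have e3l : 3 * e < l.
  have : e < l / 3 by near: e; apply: nbhs_right_lt; rewrite divr_gt0.
  by rewrite ltr_pdivlMr// mulrC.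
have e3r : 3 * e < r.
  have : e < r / 3 by near: e; apply: nbhs_right_lt; rewrite divr_gt0.
  by rewrite ltr_pdivlMr// mulrC.
have eab : 6 * e < b - a.
  have : e < (b - a) / 6 by near: e; apply: nbhs_right_lt; rewrite divr_gt0// subr_gt0.
  by rewrite ltr_pdivlMr// mulrC.
have bi : integrable_on a b (fun x => g x * cutoff a b e x).
  by apply: integrable_onM => //; apply: continuous_subspaceT; exact: continuous_cutoff.
rewrite -RintegralB//.
apply: le_trans (le_normr_Rintegral _ _) _ => //; first exact: integrable_onB.
pose p := a + 3 * e; pose q := b - 3 * e.
have [ap pq qb] : [/\ a <= p, p <= q & q <= b] by rewrite /p /q; clear -e0 eab; split; lra.
have pb := le_trans pq qb; have aq := le_trans ap pq.
pose w (x : R) : R := `|g x - g x * cutoff a b e x|.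
have wi : integrable_on a b w by exact: integrable_norm (integrable_onB gi bi).
have wle x : w x <= `|g x|.
  have /andP[b0 b1] := cutoff_ge0_le1 x e0 eab.
  rewrite /w -{1}(mulr1 (g x)) -mulrBr normrM ler_piMr// ger0_norm ?subr_ge0//.
  by rewrite gerBl.
rewrite -/w (integral_split (le_trans ap pq) qb wi).
rewrite (integral_split ap pq); last exact: integrable_onS wi.
have -> : \int[mu]_(x in `[p, q]) w x = 0.
  have -> : 0 = \int[mu]_(x in `[p, q]) (fun=> 0 : R) x by rewrite Rintegral_cst// mul0r.
  apply: eq_Rintegral => x; rewrite inE/= in_itv/= => pxq.
  by rewrite /w (cutoff_in e0 pxq) mulr1 subrr normr0.
rewrite addr0 [leRHS]splitr lerD//.
  apply: (@le_trans _ _ (I p)).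
    apply: segment_integral_le => //.
      exact: integrable_onS (lexx a) pb wi.
    exact: integrable_onS (lexx a) pb ni.
  have := Hl p; rewrite /= distrC.
  have -> : p - a = 3 * e by rewrite /p; ring.
  rewrite gtr0_norm ?mulr_gt0// => /(_ e3l).
  rewrite ltrDl mulr_gt0// => /(_ isT).
  rewrite I0 sub0r normrN; exact: le_trans (ler_norm _).
apply: (@le_trans _ _ (I b - I q)).
  rewrite /I (integral_split (le_trans ap pq) qb ni) addrAC subrr add0r.
  apply: segment_integral_le => //.
    exact: integrable_onS aq (lexx b) wi.
  exact: integrable_onS aq (lexx b) ni.
have := Hr q; rewrite /=.
have -> : b - q = 3 * e by rewrite /q; ring.
rewrite gtr0_norm ?mulr_gt0// => /(_ e3r).
rewrite gtrBl mulr_gt0// => /(_ isT).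
exact: le_trans (ler_norm _).
Unshelve. all: by end_near. Qed.

End WeakDerivative.

(** * Integration by parts against a weak derivative *)

Section WeakIBP.
Variable R : realType.
Local Notation mu := (@lebesgue_measure R).
Implicit Types (a b e d p : R) (f g K P : R -> R).

(** The rescaled hat is a probability density carried by [[p, p + 2 * e]], so the integral is an
    average of [K] over that interval. *)
Lemma hat_average a b e p d (kc : R) K : 0 < e -> a <= p -> p + 2 * e <= b ->
  {within `[a, b], continuous K} ->
  (forall x, p <= x <= p + 2 * e -> `|K x - kc| <= d) ->
  `|\int[mu]_(x in `[a, b]) (K x * (e^-1 * hat (e^-1 * x + (- p / e)))) - kc| <= d.
Proof.
move=> e0 ap pb cK HK.
pose rho x := e^-1 * hat (e^-1 * x + (- p / e)).
have ab : a <= b by clear -ap pb e0; lra.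
have crho : {within `[a, b], continuous rho}.
  apply: continuous_subspaceT => x; apply: cvgM; first exact: cvg_cst.
  apply: (@continuous_comp _ _ _ (fun x => e^-1 * x + (- p / e)) (@hat R)).
    by apply: cvgD; [apply: cvgM; [exact: cvg_cst|exact: cvg_id]|exact: cvg_cst].
  exact: continuous_hat.
have rho0 x : 0 <= rho x by rewrite mulr_ge0 ?hat_ge0// invr_ge0 ltW.
have rhoi : integrable_on a b rho by exact: continuous_integrable_on.
have rho1 : \int[mu]_(x in `[a, b]) rho x = 1.
  pose F (x : R) : R := cstep (e^-1 * x + (- p / e)).
  have dF (x : R) : is_derive x 1 F (rho x).
    by apply: is_derive_shift_scale; exact: is_derive_cstep.
  have cF : {within `[a, b], continuous F}.
    by apply: continuous_subspaceT => x; exact: is_derive_continuous (dF x).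
  rewrite (segment_FTC ab crho cF (fun x _ => dF x)) /F !scaleE//.
  rewrite cstep_hi; last by rewrite ler_pdivlMr//; lra.
  by rewrite cstep_lo ?subr0// ler_pdivrMr//; lra.
have Ki : integrable_on a b (fun x => K x * rho x).
  by apply: continuous_integrable_on; exact: ctsinM.
have -> : kc = \int[mu]_(x in `[a, b]) (kc * rho x) by rewrite RintegralZl// rho1 mulr1.
rewrite -RintegralB//; last exact: integrable_onZ.
have Di : integrable_on a b (fun x => K x * rho x - kc * rho x).
  by apply: integrable_onB => //; exact: integrable_onZ.
apply: le_trans (le_normr_Rintegral _ Di) _ => //.
have -> : d = \int[mu]_(x in `[a, b]) (d * rho x) by rewrite RintegralZl// rho1 mulr1.
apply: segment_integral_le; [exact: integrable_norm Di|exact: integrable_onZ|].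
move=> x _; rewrite -mulrBl normrM (ger0_norm (rho0 x)).
have [xp|px] := leP x p.
  by rewrite /rho scaleE// hat_lo ?mulr0// ler_pdivrMr// mul0r subr_le0.
have [xp|px2] := leP (p + 2 * e) x.
  by rewrite /rho scaleE// hat_hi ?mulr0// ler_pdivlMr// lerBrDl.
by rewrite ler_wpM2r// HK// (ltW px) (ltW px2).
Qed.

(** The derivative of the cutoff is a unit mass near [a] minus a unit mass near [b]; this is where
    boundary terms come from. *)
Lemma dcutoff_integral_cvg a b d K : a < b -> {within `[a, b], continuous K} -> 0 < d ->
  \forall e \near 0^'+,
    `|\int[mu]_(x in `[a, b]) (K x * dcutoff a b e x) - (K a - K b)| <= d.
Proof.
move=> ab cK d0.
have d2 : 0 < d / 2 by rewrite divr_gt0.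
have [_ Ka Kb] := (continuous_within_itvP _ ab).1 cK.
have /cvgrPdist_le/(_ _ d2)[l /= l0 {}Hl] := Ka.
have /cvgrPdist_le/(_ _ d2)[r /= r0 {}Hr] := Kb.
near=> e.
have e0 : 0 < e by near: e; exact: nbhs_right_gt.
have e3l : 3 * e < l.
  have : e < l / 3 by near: e; apply: nbhs_right_lt; rewrite divr_gt0.
  by rewrite ltr_pdivlMr// mulrC.
have e3r : 3 * e < r.
  have : e < r / 3 by near: e; apply: nbhs_right_lt; rewrite divr_gt0.
  by rewrite ltr_pdivlMr// mulrC.
have eab : 6 * e < b - a.
  have : e < (b - a) / 6 by near: e; apply: nbhs_right_lt; rewrite divr_gt0// subr_gt0.
  by rewrite ltr_pdivlMr// mulrC.
pose rho p x := e^-1 * hat (e^-1 * x + (- p / e)).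
have crho p : {within `[a, b], continuous rho p}.
  apply: continuous_subspaceT => x; apply: cvgM; first exact: cvg_cst.
  apply: (@continuous_comp _ _ _ (fun x => e^-1 * x + (- p / e)) (@hat R)).
    by apply: cvgD; [apply: cvgM; [exact: cvg_cst|exact: cvg_id]|exact: cvg_cst].
  exact: continuous_hat.
have Ki p : integrable_on a b (fun x => K x * rho p x).
  by apply: continuous_integrable_on; apply: ctsinM => //; exact: crho.
have HA : `|\int[mu]_(x in `[a, b]) (K x * rho (a + e) x) - K a| <= d / 2.
  apply: hat_average => //; try (clear -e0 eab; lra).
  move=> x xa; rewrite distrC; apply: Hl; last by clear -xa e0; lra.
  by rewrite /= ltr_distlC; clear -xa e0 e3l; apply/andP; split; lra.
have HB : `|\int[mu]_(x in `[a, b]) (K x * rho (b - 3 * e) x) - K b| <= d / 2.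
  apply: hat_average => //; try (clear -e0 eab; lra).
  move=> x xa; rewrite distrC; apply: Hr; last by clear -xa e0; lra.
  by rewrite /= ltr_distlC; clear -xa e0 e3r; apply/andP; split; lra.
have -> : \int[mu]_(x in `[a, b]) (K x * dcutoff a b e x) =
   \int[mu]_(x in `[a, b]) (K x * rho (a + e) x) - \int[mu]_(x in `[a, b]) (K x * rho (b - 3 * e) x).
  rewrite -RintegralB//; last 2 first.
  - exact: Ki.
  - exact: Ki.
  by apply: eq_Rintegral => x _; rewrite /dcutoff mulrBr.
move: HA HB; set A := \int[mu]_(x in _) _; set B := \int[mu]_(x in _) _ => HA HB.
have -> : A - B - (K a - K b) = (A - K a) - (B - K b) by ring.
by rewrite [leRHS]splitr; exact: le_trans (ler_normB _ _) (lerD HA HB).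
Unshelve. all: by end_near. Qed.

(** Nothing is known about [P] outside []a, b[]; the product is nevertheless C^1 on the whole line,
    since the cutoff vanishes on a neighbourhood of the complement. *)
Lemma C1c_cutoff a b e P P' : 0 < e -> 6 * e < b - a ->
  {within `[a, b], continuous P} -> {within `[a, b], continuous P'} ->
  (forall x, a < x < b -> is_derive x 1 P (P' x)) ->
  let phi (x : R) := P x * cutoff a b e x in
  C1c a b phi /\
  derive1 phi = fun x => P' x * cutoff a b e x + P x * dcutoff a b e x.
Proof.
move=> e0 eab cP cP' dP phi.
have ab : a < b by clear -e0 eab; lra.
have near_out x : x <= a \/ b <= x -> \forall y \near x, y <= a + e \/ b - e <= y.
  case=> H; near=> y; [left|right].
    apply: ltW; near: y; apply: lt_nbhsl; clear -e0 H; lra.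
  apply: ltW; near: y; apply: lt_nbhsr; clear -e0 H; lra.
pose phi' (x : R) : R := P' x * cutoff a b e x + P x * dcutoff a b e x.
have inout x : a < x < b \/ (x <= a \/ b <= x).
  have [xa|xa] := leP x a; first by right; left.
  by have [xb|xb] := leP b x; [right; right|left].
have out0 y : y <= a + e \/ b - e <= y -> phi y = 0 /\ phi' y = 0.
  by move=> /(cutoff_out e0 eab)[c0 dc0]; rewrite /phi /phi' c0 dc0 !mulr0 addr0.
have dphi (x : R) : is_derive x 1 phi (phi' x).
  case: (inout x) => [xab|xout].
    have H := is_deriveM (dP _ xab) (is_derive_cutoff a b e x).
    apply: (is_derive_eq H).
    by rewrite /phi' /GRing.scale/= addrC [cutoff _ _ _ _ * _]mulrC.
  have [_ ->] := out0 _ (nbhs_singleton (near_out _ xout)).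
  apply: (@near_eq_is_derive R R R (fun=> 0)).
  by apply: filterS (near_out _ xout) => y /out0[].
have dphiE : derive1 phi = phi'.
  by apply/funext => x; rewrite derive1E; apply: derive_val; exact: dphi.
split=> //; split.
- by move=> x; exact: is_derive_derivable (dphi x).
- rewrite dphiE => x; case: (inout x) => [xab|xout].
    have xi : x \in `]a, b[ by rewrite in_itv.
    apply: cvgD; apply: cvgM.
    + exact: (within_continuous_continuous ab cP' xi).
    + exact: continuous_cutoff.
    + exact: (within_continuous_continuous ab cP xi).
    + exact: continuous_dcutoff.
  rewrite /continuous_at (out0 _ (nbhs_singleton (near_out _ xout))).2.
  apply: (cvg_trans _ (@cvg_cst _ (0 : R) _ (nbhs x) _)).
  apply: near_eq_cvg; apply: filterS (near_out _ xout) => y /out0[_ ->]//.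
- exists (a + e), (b - e); split; [clear -e0; lra|clear -e0; lra|].
  move=> x phix; apply/andP; split; rewrite leNgt; apply/negP => H;
    move/negP : phix; apply; apply/eqP.
    by apply: (out0 _ _).1; left; exact: ltW.
  by apply: (out0 _ _).1; right; exact: ltW.
Unshelve. all: by end_near. Qed.

(* Test the weak derivative against [P] times cutoffs increasing to 1. *)
Lemma weak_IBP a b f g P P' : a < b -> {within `[a, b], continuous f} ->
  H1_derivative a b f g ->
  {within `[a, b], continuous P} -> {within `[a, b], continuous P'} ->
  (forall x, a < x < b -> is_derive x 1 P (P' x)) ->
  \int[mu]_(x in `[a, b]) (f x * P' x) + \int[mu]_(x in `[a, b]) (g x * P x) =
  f b * P b - f a * P a.
Proof.
move=> ab cf [_ /square_integrableP[gi _] H] cP cP' dP.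
have fPi : integrable_on a b (fun x => f x * P' x).
  by apply: continuous_integrable_on; exact: ctsinM.
have gPi : integrable_on a b (fun x => g x * P x) by exact: integrable_onM.
rewrite -RintegralD//; set G := fun x => f x * P' x + g x * P x.
have Gi : integrable_on a b G by exact: integrable_onD.
have cfP : {within `[a, b], continuous (fun x => f x * P x)} by exact: ctsinM.
apply/eqP; rewrite -subr_eq0 -normr_eq0 eq_le normr_ge0 andbT.
apply/ler_addgt0Pl => d d0; rewrite addr0.
have d2 : 0 < d / 2 by rewrite divr_gt0.
have : \forall e \near (0 : R)^'+, `|\int[mu]_(x in `[a, b]) G x - (f b * P b - f a * P a)| <= d.
  near=> e.
  have e0 : 0 < e by near: e; exact: nbhs_right_gt.
  have eab : 6 * e < b - a.
    have : e < (b - a) / 6 by near: e; apply: nbhs_right_lt; rewrite divr_gt0// subr_gt0.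
    by rewrite ltr_pdivlMr// mulrC.
  have [phiC phiE] := C1c_cutoff e0 eab cP cP' dP.
  have HG : `|\int[mu]_(x in `[a, b]) G x - \int[mu]_(x in `[a, b]) (G x * cutoff a b e x)| <= d / 2.
    by near: e; exact: cutoff_integral_cvg.
  have HD : `|\int[mu]_(x in `[a, b]) ((f x * P x) * dcutoff a b e x) - (f a * P a - f b * P b)| <= d / 2.
    by near: e; exact: (dcutoff_integral_cvg ab cfP).
  have cC : {within `[a, b], continuous (cutoff a b e)}.
    by apply: continuous_subspaceT; exact: continuous_cutoff.
  have cD : {within `[a, b], continuous (dcutoff a b e)}.
    by apply: continuous_subspaceT; exact: continuous_dcutoff.
  have Gci : integrable_on a b (fun x => G x * cutoff a b e x) by exact: integrable_onM.
  have fPDi : integrable_on a b (fun x => f x * P x * dcutoff a b e x).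
    by apply: continuous_integrable_on; exact: ctsinM.
  have {}H := H _ phiC; rewrite phiE in H.
  have i1 : integrable_on a b (fun x => f x * (P' x * cutoff a b e x + P x * dcutoff a b e x)).
    apply: continuous_integrable_on; apply: ctsinM => //.
    by apply: ctsinD; exact: ctsinM.
  have i2 : integrable_on a b (fun x => g x * (P x * cutoff a b e x)).
    by apply: integrable_onM => //; exact: ctsinM.
  rewrite !integral_oo_cc// in H.
  (* The weak derivative identity for [phi], regrouped: the first integral tends to the integral of
     [G], the second to [f a * P a - f b * P b]. *)
  have {}H : \int[mu]_(x in `[a, b]) (G x * cutoff a b e x) +
      \int[mu]_(x in `[a, b]) (f x * P x * dcutoff a b e x) = 0.
    move/eqP: H; rewrite -subr_eq0 opprK => /eqP H; rewrite -[RHS]H.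
    rewrite -!RintegralD//; apply: eq_Rintegral => x _.
    by rewrite /G; ring.
  move: HG HD; set A := \int[mu]_(x in `[a, b]) G x.
  have -> : \int[mu]_(x in `[a, b]) (G x * cutoff a b e x) =
      - \int[mu]_(x in `[a, b]) (f x * P x * dcutoff a b e x).
    by apply/eqP; rewrite -addr_eq0 H.
  set B := \int[mu]_(x in `[a, b]) _; rewrite opprK => HG HD.
  have -> : A - (f b * P b - f a * P a) = (A + B) - (B - (f a * P a - f b * P b)) by ring.
  rewrite [leRHS]splitr; apply: le_trans (ler_normB _ _) _.
  exact: lerD.
by move=> /filter_ex[].
Unshelve. all: by end_near. Qed.

End WeakIBP.

(** * Gluing and translating integrals *)

Section SegmentTransfer.
Variable R : realType.
Local Notation mu := (@lebesgue_measure R).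
Implicit Types (a b c t : R) (f g : R -> R).

Lemma integrable_on_eq_oo a b f g : (forall x, a < x < b -> f x = g x) ->
  integrable_on a b f -> integrable_on a b g.
Proof.
move=> fg fi; apply: integrable_oo_cc.
have fi' : mu.-integrable `]a, b[ (EFin \o f).
  by apply: integrableS fi => //; apply: subset_itv; rewrite bnd_simp.
apply: eq_integrable fi' => // x.
by rewrite inE/= in_itv/= => /fg ->.
Qed.

Lemma integral_eq_oo a b f g : (forall x, a < x < b -> f x = g x) ->
  integrable_on a b f ->
  \int[mu]_(x in `[a, b]) g x = \int[mu]_(x in `[a, b]) f x.
Proof.
move=> fg fi; rewrite -!integral_oo_cc//; last exact: integrable_on_eq_oo fi.
by apply: eq_Rintegral => x; rewrite inE/= in_itv/= => /fg ->.
Qed.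

Lemma integrable_on_cat a c b f : a <= c <= b ->
  integrable_on a c f -> integrable_on c b f -> integrable_on a b f.
Proof.
move=> /andP[ac cb] /integrableP[mf1 f1] f2.
have /integrableP[mf2 {}f2] : mu.-integrable `]c, b] (EFin \o f).
  by apply: integrableS f2 => //; apply: subset_itv; rewrite bnd_simp.
have E : `[a, c] `|` `]c, b] = `[a, b]%classic.
  by rewrite -itv_bndbnd_setU// bnd_simp.
have mf : measurable_fun (`[a, c] `|` `]c, b]) (EFin \o f) by exact/measurable_funU.
apply/integrableP; rewrite -E; split => //.
rewrite ge0_integral_setU//; last 2 first.
- exact: measurableT_comp mf.
- apply/disj_setPS => y [/=]; rewrite 2!in_itv/= => /andP[_ yx] /andP[].
  by rewrite ltNge yx.
exact: lte_add_pinfty.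
Qed.

Lemma measurable_shift c : measurable_fun setT
  ((fun x => x + c) : measurableTypeR R -> measurableTypeR R).
Proof. exact: measurable_funD. Qed.

(** Both measures agree on half-open intervals, which determine Lebesgue measure. *)
Lemma lebesgue_measure_shift c (A : set R) : measurable A ->
  pushforward mu ((fun x => x + c) : _ -> measurableTypeR R) A = mu A.
Proof.
move=> mA; apply/esym/lebesgue_measure_unique => //.
  exact: measurable_shift.
move=> mphi _ [[a b]] _ <- /=.
rewrite /pushforward/=.
have -> : (fun x => x + c) @^-1` `]a, b] = `]a - c, b - c]%classic.
  by apply/seteqP; split => x /=; rewrite !in_itv/= ltrBlDr lerBrDr.
by rewrite !lebesgue_measure_itv/= !lte_fin ltrD2r; case: ifP => // _; rewrite -!EFinB; congr EFin; ring.
Qed.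

Lemma preimage_shift_segment a b c :
  ((fun x : R => x + c) : _ -> measurableTypeR R) @^-1` `[a, b] = `[a - c, b - c]%classic.
Proof. by apply/seteqP; split => x /=; rewrite !in_itv/= lerBlDr lerBrDr. Qed.

(** The nonnegative case comes first because, applied to [|f|], it yields the integrability that the
    signed case requires. *)
Lemma ge0_integral_shift a b c (h : R -> \bar R) :
  measurable_fun `[a, b] h -> (forall x, 0 <= h x)%E ->
  (\int[mu]_(x in `[(a - c)%R, (b - c)%R]) h (x + c)%R = \int[mu]_(x in `[a, b]) h x)%E.
Proof.
move=> mh h0; rewrite -preimage_shift_segment.
rewrite -(ge0_integral_pushforward (measurable_shift c))//.
apply: eq_measure_integral; first exact: measurable_shift.
by move=> mphi A mA _; exact: lebesgue_measure_shift.
Qed.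

Lemma integrable_on_shift a b c f : integrable_on a b f ->
  integrable_on (a - c) (b - c) (fun x => f (x + c)).
Proof.
move=> /integrableP[mf fi]; apply/integrableP; split.
  rewrite -[EFin \o _]/((EFin \o f) \o (fun x => x + c)).
  apply: (measurable_comp _ _ mf) => //.
    by move=> _ [x /= + <-]; rewrite !in_itv/= lerBlDr lerBrDr.
  exact: measurable_funS (measurable_shift c).
rewrite (@ge0_integral_shift a b c (fun x => `|(f x)%:E|%E))//.
exact: measurableT_comp mf.
Qed.

Lemma integral_shift a b c f : integrable_on a b f ->
  \int[mu]_(x in `[a - c, b - c]) f (x + c) = \int[mu]_(x in `[a, b]) f x.
Proof.
(* [f] is measurable on the segment only; its extension by zero is measurable on the line, as the
   change of variables demands. *)
move=> fi; pose h := (EFin \o f) \_ `[a, b].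
have mh : measurable_fun setT h.
  by apply/(measurable_restrictT _ _).1 => //; case/integrableP: fi.
have hE x : `[a, b]%classic x -> h x = (f x)%:E.
  by move=> xab; rewrite /h patchE mem_set.
rewrite /Rintegral; congr fine.
transitivity (\int[mu]_(x in `[(a - c)%R, (b - c)%R]) (h \o (fun x => x + c)%R) x)%E.
  apply: eq_integral => x; rewrite inE/= in_itv/= lerBlDr lerBrDr => xab.
  by rewrite hE//= in_itv.
rewrite -preimage_shift_segment -integral_pushforward//.
- transitivity (\int[mu]_(x in `[a, b]) h x)%E.
    apply: eq_measure_integral; first exact: measurable_shift.
    by move=> mphi A mA _; exact: lebesgue_measure_shift.
  by apply: eq_integral => x; rewrite inE => /hE.
- exact: measurable_shift.
- rewrite preimage_shift_segment.
  apply: eq_integrable (integrable_on_shift c fi) => // x.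
  rewrite inE/= in_itv/= lerBlDr lerBrDr => xab.
  by rewrite hE//= in_itv.
Qed.

End SegmentTransfer.

(** * Weak derivatives: restriction, classical case, gluing *)

Section H1.
Variable R : realType.
Local Notation mu := (@lebesgue_measure R).
Implicit Types (a b c t x y D : R) (f g phi : R -> R).

Lemma C1c_off a b phi : C1c a b phi ->
  exists l r, [/\ a < l, r < b &
    forall x, x < l \/ r < x -> phi x = 0 /\ derive1 phi x = 0].
Proof.
move=> [dphi _ [l [r [al rb H]]]].
have off x : x < l \/ r < x -> phi x = 0.
  move=> Hx; apply/eqP/negPn/negP => /H /andP[lx xr].
  by case: Hx; rewrite ltNge ?lx ?xr.
exists l, r; split => // x Hx; split; first exact: off.
rewrite derive1E; apply: derive_val; apply: (@near_eq_is_derive R R R (fun=> 0)).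
case: Hx => Hx; near=> y; rewrite off//; [left|right]; near: y.
- exact: lt_nbhsl.
- exact: lt_nbhsr.
Unshelve. all: by end_near. Qed.

Lemma C1c_ends a b phi : C1c a b phi ->
  (forall x, x <= a \/ b <= x -> phi x = 0 /\ derive1 phi x = 0).
Proof.
move=> /C1c_off[l [r [al rb off]]] x Hx; apply: off.
case: Hx => [xa|bx]; [left; exact: le_lt_trans al|right; exact: lt_le_trans bx].
Qed.

Lemma C1c_is_derive a b phi (x : R) : C1c a b phi -> is_derive x 1 phi (derive1 phi x).
Proof. by case=> dphi _ _; rewrite derive1E; apply/derivableP. Qed.

Lemma C1cS a b c d phi : a <= c -> d <= b -> C1c c d phi -> C1c a b phi.
Proof.
move=> ac db [dphi cphi [l [r [cl rd H]]]]; split => //.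
by exists l, r; split => //; [exact: le_lt_trans cl|exact: lt_le_trans db].
Qed.

Lemma integral_subsegment a c d b f : a <= c -> c <= d -> d <= b ->
  integrable_on a b f -> (forall x, x <= c \/ d <= x -> f x = 0) ->
  \int[mu]_(x in `[a, b]) f x = \int[mu]_(x in `[c, d]) f x.
Proof.
move=> ac cd db fi f0.
rewrite (integral_split (le_trans ac cd) db fi).
rewrite (integral_split ac cd (integrable_onS (lexx a) db fi)).
have zero p q : (forall x, p < x < q -> f x = 0) ->
    \int[mu]_(x in `[p, q]) f x = 0.
  move=> H; rewrite (@integral_eq_oo _ p q (fun=> 0))//.
  - by rewrite Rintegral_cst// mul0r.
  - by move=> x /H ->.
  - exact: integrable_on_cst.
rewrite (zero a c) ?add0r ?(zero d b) ?addr0//.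
- by move=> x /andP[/ltW dx _]; rewrite f0//; right.
- by move=> x /andP[_ /ltW xc]; rewrite f0//; left.
Qed.

(** A test function on the smaller interval is also one on the larger, and it kills both integrands
    outside the smaller. *)
Lemma H1_derivativeS a b c d f g : a <= c -> c <= d -> d <= b ->
  H1_derivative a b f g -> H1_derivative c d f g.
Proof.
move=> ac cd db [/square_integrableP[fi f2] /square_integrableP[gi g2] H].
have S h := integrable_onS (f := h) ac db.
split; [by apply/square_integrableP; split; exact: S..|].
move=> phi phiC; have := H _ (C1cS ac db phiC).
have [_ cphi' _] := phiC.
have cphi : continuous phi.
  by move=> x; exact: is_derive_continuous (C1c_is_derive x phiC).
have i1 : integrable_on a b (fun x => f x * phi^`()%classic x).
  by apply: integrable_onM => //; exact: continuous_subspaceT.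
have i2 : integrable_on a b (fun x => g x * phi x).
  by apply: integrable_onM => //; exact: continuous_subspaceT.
have ends := C1c_ends phiC.
rewrite !integral_oo_cc//; [|exact: S..].
rewrite (integral_subsegment ac cd db i1); last first.
  by move=> x /ends[_ ->]; rewrite mulr0.
rewrite (integral_subsegment ac cd db i2)//.
by move=> x /ends[-> _]; rewrite mulr0.
Qed.

Lemma continuous_square_integrable a b f : {within `[a, b], continuous f} ->
  square_integrable a b f.
Proof.
move=> cf; apply/square_integrableP; split; apply: continuous_integrable_on => //.
exact: ctsinX.
Qed.

Lemma classical_H1_derivative a b f g : a <= b ->
  {within `[a, b], continuous f} -> {within `[a, b], continuous g} ->
  (forall x, a < x < b -> is_derive x 1 f (g x)) -> H1_derivative a b f g.
Proof.
move=> ab cf cg df; split; [exact: continuous_square_integrable..|].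
move=> phi phiC; have [_ cphi' _] := phiC.
have dphi x := C1c_is_derive x phiC.
have cphi : {within `[a, b], continuous phi}.
  by apply: continuous_subspaceT => x; exact: is_derive_continuous (dphi x).
have cphi'' : {within `[a, b], continuous phi^`()%classic}.
  exact: continuous_subspaceT.
rewrite !integral_oo_cc; last 2 first.
- by apply: continuous_integrable_on; exact: ctsinM.
- by apply: continuous_integrable_on; exact: ctsinM.
rewrite (segment_IBP ab cg cf cphi'' cphi df (fun x _ => dphi x)).
have ends := C1c_ends phiC.
have [-> _] : phi a = 0 /\ phi^`()%classic a = 0 by apply: ends; left.
have [-> _] : phi b = 0 /\ phi^`()%classic b = 0 by apply: ends; right.
by rewrite !mulr0 subrr sub0r.
Qed.

(** The constant 1 is not a test function, but [weak_IBP] admits it. *)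
Lemma weak_FTC a b f g : a <= b -> {within `[a, b], continuous f} ->
  H1_derivative a b f g -> f b - f a = \int[mu]_(x in `[a, b]) g x.
Proof.
rewrite le_eqVlt => /orP[/eqP -> _ _|ab cf H].
  by rewrite subrr set_itv1 Rintegral_set1.
have := @weak_IBP R a b f g (fun=> 1) (fun=> 0) ab cf H (@ctsin_cst _ _ _ _) (@ctsin_cst _ _ _ _)
  (fun x _ => is_derive_cst _ _ _).
rewrite !mulr1 => <-.
under eq_Rintegral do rewrite mulr0.
under [in X in _ + X]eq_Rintegral do rewrite mulr1.
by rewrite Rintegral_cst// mul0r add0r.
Qed.

(** Meant for the input window at a time [t < D]: its first part is the closed-loop exponential, the
    rest a translate of the past input. The condition [e t = f 0] makes the boundary terms at the
    junction cancel. Continuity of [f] is asked only below [D], because the input is not controlled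
    at time [- D]. *)
Lemma glued_H1_derivative D t f g (e e' : R -> R) : 0 < t -> t < D ->
  H1_derivative 0 D f g ->
  (forall y, y < D -> {within `[0, y], continuous f}) ->
  {within `[0, t], continuous e} -> {within `[0, t], continuous e'} ->
  (forall x, 0 < x < t -> is_derive x 1 e (e' x)) -> e t = f 0 ->
  let F x := if x <= t then e x else f (x - t) in
  let G x := if x <= t then e' x else g (x - t) in
  H1_derivative 0 D F G /\
  \int[mu]_(x in `[0, D]) G x ^+ 2 <=
  \int[mu]_(x in `[0, t]) e' x ^+ 2 + \int[mu]_(x in `[0, D]) g x ^+ 2.
Proof.
move=> t0 tD HF cf ce ce' de etf F G.
have [/square_integrableP[fi f2] /square_integrableP[gi g2] H] := HF.
have D0 : 0 < D by exact: lt_trans tD.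
have Dt0 : 0 <= D - t by rewrite subr_ge0 ltW.
have Dt : D - t <= D by rewrite gerBl ltW.
have sh (h : R -> R) : integrable_on 0 D h -> integrable_on t D (fun x => h (x - t)).
  move=> /(integrable_onS (lexx 0) Dt) /(@integrable_on_shift _ _ _ (- t)).
  by rewrite sub0r opprK subrK.
have glue (h k : R -> R) : integrable_on 0 t h -> integrable_on 0 D k ->
    integrable_on 0 D (fun x => if x <= t then h x else k (x - t)).
  move=> hi ki; apply: (@integrable_on_cat _ 0 t D); first by rewrite !ltW.
    apply: integrable_on_eq_oo hi => x /andP[_ /ltW ->]//.
  apply: integrable_on_eq_oo (sh k ki) => x /andP[tx _].
  by rewrite leNgt tx.
have glueE (h k : R -> R) : integrable_on 0 t h -> integrable_on 0 D k ->
    \int[mu]_(x in `[0, D]) (if x <= t then h x else k (x - t)) =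
    \int[mu]_(x in `[0, t]) h x + \int[mu]_(x in `[0, D - t]) k x.
  move=> hi ki; rewrite (integral_split (ltW t0) (ltW tD)); last exact: glue.
  congr (_ + _).
    by apply: integral_eq_oo hi => x /andP[_ /ltW ->].
  rewrite (@integral_eq_oo _ _ _ (fun x => k (x - t))); last 2 first.
  - by move=> x /andP[tx _]; rewrite leNgt tx.
  - exact: sh.
  have := @integral_shift _ _ _ (- t) _ (integrable_onS (lexx 0) Dt ki).
  by rewrite sub0r opprK subrK.
have ei : integrable_on 0 t e by exact: continuous_integrable_on.
have e'i : integrable_on 0 t e' by exact: continuous_integrable_on.
have e2i : integrable_on 0 t (fun x => e x ^+ 2).
  by apply: continuous_integrable_on; exact: ctsinX.
have e'2i : integrable_on 0 t (fun x => e' x ^+ 2).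
  by apply: continuous_integrable_on; exact: ctsinX.
have F2E : (fun x => F x ^+ 2) = (fun x => if x <= t then e x ^+ 2 else f (x - t) ^+ 2).
  by apply/funext => x; rewrite /F; case: ifP.
have G2E : (fun x => G x ^+ 2) = (fun x => if x <= t then e' x ^+ 2 else g (x - t) ^+ 2).
  by apply/funext => x; rewrite /G; case: ifP.
have Fi := glue _ _ ei fi; have Gi := glue _ _ e'i gi.
have F2i : integrable_on 0 D (fun x => F x ^+ 2).
  by rewrite F2E; exact: (glue (fun x => e x ^+ 2) (fun x => f x ^+ 2)).
have G2i : integrable_on 0 D (fun x => G x ^+ 2).
  by rewrite G2E; exact: (glue (fun x => e' x ^+ 2) (fun x => g x ^+ 2)).
split; last first.
  rewrite G2E (glueE (fun x => e' x ^+ 2) (fun x => g x ^+ 2))// lerD2l.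
  rewrite [leRHS](integral_split Dt0 Dt g2) lerDl.
  by apply: Rintegral_ge0 => x _; exact: sqr_ge0.
split; [by apply/square_integrableP; split..|].
move=> phi phiC; have [_ cphi' _] := phiC.
have dphi x := C1c_is_derive x phiC.
have cphi A : {within A, continuous phi}.
  by apply: continuous_subspaceT => x; exact: is_derive_continuous (dphi x).
have cphi'' A : {within A, continuous phi^`()%classic} by exact: continuous_subspaceT.
have [l [r [l0 rD off]]] := C1c_off phiC.
pose y := (Num.max r t + D) / 2.
have mD : Num.max r t < D by rewrite gt_max rD.
have [mr mt] : r <= Num.max r t /\ t <= Num.max r t by rewrite !le_max !lexx orbT.
have [ry ty yD] : [/\ r < y, t < y & y < D].
  by rewrite /y; clear -mD mr mt; split; lra.
pose w := y - t.
have w0 : 0 < w by rewrite subr_gt0.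
have wD : w < D by rewrite /w; clear -t0 yD; lra.
have FP : integrable_on 0 D (fun x => F x * phi^`()%classic x) by exact: integrable_onM.
have GP : integrable_on 0 D (fun x => G x * phi x) by exact: integrable_onM.
have csh A : {within A, continuous (fun z : R => z + t)}.
  by apply: ctsinD; [exact: ctsin_id|exact: ctsin_cst].
have psh : {within `[0, w], continuous (fun z => phi (z + t))}.
  by apply: (ctsin_comp (cphi setT)).
have psh' : {within `[0, w], continuous (fun z => phi^`()%classic (z + t))}.
  by apply: (ctsin_comp (cphi'' setT)).
have iw (h : R -> R) : integrable_on 0 D h -> integrable_on 0 w h.
  by apply: integrable_onS => //; exact: ltW.
have i1 := integrable_onM (iw _ fi) psh'.
have i2 := integrable_onM (iw _ gi) psh.
(* both integrals are cut at [t] and at [y], beyond the support of [phi] *)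
have cut (K k : R -> R) (p : R -> R) : integrable_on 0 D (fun x => K x * p x) ->
    (forall x, y <= x -> p x = 0) -> (forall x, t < x -> K x = k (x - t)) ->
    integrable_on 0 w (fun z => k z * p (z + t)) ->
    \int[mu]_(x in `[t, D]) (K x * p x) = \int[mu]_(z in `[0, w]) (k z * p (z + t)).
  move=> Kpi p0 Kk kpi.
  rewrite (integral_split (ltW ty) (ltW yD)); last first.
    exact: integrable_onS (ltW t0) (lexx D) Kpi.
  rewrite [X in _ + X](@integral_eq_oo _ _ _ (fun=> 0)); last 2 first.
  - by move=> x /andP[/ltW /p0 -> _]; rewrite mulr0.
  - exact: integrable_on_cst.
  rewrite Rintegral_cst// mul0r addr0.
  have := @integral_shift _ _ _ (- t) _ kpi.
  rewrite sub0r opprK /w subrK => <-.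
  apply: integral_eq_oo.
    by move=> x /andP[/Kk -> _]; rewrite subrK.
  have := @integrable_on_shift _ _ _ (- t) _ kpi.
  by rewrite sub0r opprK /w subrK.
rewrite !integral_oo_cc//.
rewrite (integral_split (ltW t0) (ltW tD) FP) (integral_split (ltW t0) (ltW tD) GP).
rewrite (cut F f) => //; last 2 first.
- by move=> x yx; apply: (off _ _).2; right; exact: lt_le_trans yx.
- by move=> x tx; rewrite /F leNgt tx.
rewrite (cut G g) => //; last 2 first.
- by move=> x yx; apply: (off _ _).1; right; exact: lt_le_trans yx.
- by move=> x tx; rewrite /G leNgt tx.
rewrite [X in X + _ = _](@integral_eq_oo _ _ _ (fun x => e x * phi^`()%classic x)); last 2 first.
- by move=> x /andP[_ /ltW xt]; rewrite /F xt.
- exact: integrable_onM.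
rewrite [in X in _ = - X](@integral_eq_oo _ 0 t (fun x => e' x * phi x)); last 2 first.
- by move=> x /andP[_ /ltW xt]; rewrite /G xt.
- exact: integrable_onM.
rewrite (segment_IBP (ltW t0) ce' ce (cphi'' _) (cphi _) de (fun x _ => dphi x)).
have dsh (x : R) : is_derive x 1 (fun z => phi (z + t)) (phi^`()%classic (x + t)).
  have := @is_derive_shift_scale R phi 1 t x _ (dphi _).
  by rewrite !mul1r; under eq_fun do rewrite mul1r.
have := weak_IBP w0 (cf _ wD) (H1_derivativeS (lexx 0) (ltW w0) (ltW wD) HF) psh psh'
  (fun x _ => dsh x).
rewrite add0r /w subrK (off y _).1; last by right.
have -> : phi 0 = 0 by apply: (C1c_ends phiC _).1; left.
rewrite -etf !mulr0 !subr0 sub0r.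
move=> /eqP; rewrite eq_sym -subr_eq => /eqP <-.
by rewrite opprD addrAC addrA subrr sub0r addrC.
Qed.

End H1.

(* The Stefan flow: maximum principle, left derivatives, input equation *)
Generalizable Variables alpha beta k D c sr Tm qc s T Tx Txx Tt.

Section StefanFlow.
Variable R : realType.
Local Notation mu := (@lebesgue_measure R).

(** Opens the existential of [stefan_solution] once and for all. The initial data are not recorded,
    as they can be read off from [s 0] and [T x 0]. *)
Record stefan_flow (alpha beta k D Tm : R) (qc s : R -> R)
    (T Tx Txx Tt : R -> R -> R) : Prop := StefanFlow {
  alpha_gt0 : 0 < alpha;
  beta_gt0 : 0 < beta;
  k_gt0 : 0 < k;
  T_cont : {within liquid s, continuous (fun p => T p.1 p.2)};
  Tx_cont : {within liquid_pos s, continuous (fun p => Tx p.1 p.2)};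
  Txx_cont : {within liquid_pos s, continuous (fun p => Txx p.1 p.2)};
  Tt_cont : {within liquid_pos s, continuous (fun p => Tt p.1 p.2)};
  T_derive : forall x t : R, 0 < t -> 0 < x < s t ->
     [/\ is_derive x 1 (fun y => T y t) (Tx x t),
         is_derive x 1 (fun y => Tx y t) (Txx x t) &
         is_derive t 1 (fun r => T x r) (Tt x t)];
  s_cont : {within `[0, +oo[, continuous s};
  heat_eq : forall x t : R, 0 < t -> 0 <= x <= s t -> Tt x t = alpha * Txx x t;
  flux_eq : forall t : R, 0 < t -> - k * Tx 0 t = qc (t - D);
  interface_eq : forall t : R, 0 <= t -> T (s t) t = Tm;
  s_derive : forall t : R, 0 < t -> is_derive t 1 s (- beta * Tx (s t) t) }.

Lemma liquid_slice_cont (s : R -> R) (G : R -> R -> R) (t : R) : 0 <= t ->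
  {within liquid s, continuous (fun p => G p.1 p.2)} ->
  {within `[0, s t], continuous (fun x => G x t)}.
Proof.
move=> t0 cG; apply: (ctsin_comp (h := fun x => (x, t)) cG).
  apply: continuous_subspaceT => x.
  by apply: (@cvg_pair _ _ _ _ (nbhs x) (nbhs t)); [exact: cvg_id|exact: cvg_cst].
by move=> x; rewrite /= in_itv.
Qed.

Lemma liquid_pos_slice_cont (s : R -> R) (G : R -> R -> R) (t : R) : 0 < t ->
  {within liquid_pos s, continuous (fun p => G p.1 p.2)} ->
  {within `[0, s t], continuous (fun x => G x t)}.
Proof.
move=> t0 cG; apply: (ctsin_comp (h := fun x => (x, t)) cG).
  apply: continuous_subspaceT => x.
  by apply: (@cvg_pair _ _ _ _ (nbhs x) (nbhs t)); [exact: cvg_id|exact: cvg_cst].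
by move=> x; rewrite /= in_itv.
Qed.

(** The argument is one-sided so that it also covers the boundary point [x0 = 0]. *)
Lemma neg_right_of (f : R -> R) (L x0 : R) : {within `[0, L], continuous f} ->
  0 <= x0 < L -> f x0 < 0 ->
  exists d, x0 < d <= L /\ forall x, x0 <= x <= d -> f x < 0.
Proof.
move=> cf /andP[x00 x0L] fx0.
have cf' : {within `[x0, L], continuous f}.
  by apply: continuous_subspaceW cf; apply: subset_itv; rewrite bnd_simp.
have [_ + _] := (continuous_within_itvP _ x0L).1 cf'.
have fx0' : 0 < - f x0 / 2 by rewrite divr_gt0// oppr_gt0.
move=> /cvgrPdist_lt/(_ _ fx0')[r /= r0 H].
exists (Num.min L (x0 + r / 2)); split.
  by rewrite lt_min x0L ltrDl divr_gt0//= ge_min lexx.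
move=> x /andP[]; rewrite le_eqVlt => /orP[/eqP <- //|x0x].
rewrite le_min => /andP[_ xr].
have : `|x0 - x| < r by rewrite ltr_distlC; clear -x0x xr r0; apply/andP; split; lra.
move=> /H /(_ x0x); rewrite ltr_distlC => /andP[_].
by move=> H2; clear -H2 fx0; lra.
Qed.

Lemma not_min_of_neg_derive (f f' : R -> R) (x0 d : R) : x0 < d ->
  {within `[x0, d], continuous f} ->
  (forall x, x0 < x < d -> is_derive x 1 f (f' x)) ->
  (forall x, x0 < x < d -> f' x < 0) -> f d < f x0.
Proof.
move=> x0d cf df f'0.
have df' x : x \in `]x0, d[ -> is_derive x 1 f (f' x) by rewrite in_itv; exact: df.
have [c /[!in_itv]/= cI E] := MVT x0d df' cf.
by rewrite -subr_lt0 E nmulr_rlt0 ?f'0// subr_gt0.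
Qed.

Lemma s_continuous_pos `(sf : stefan_flow alpha beta k D Tm qc s T Tx Txx Tt) (t : R) : 0 < t -> {for t, continuous s}.
Proof. by move=> t0; exact: is_derive_continuous (s_derive sf t0). Qed.

(* Weak maximum principle: [T - Tm + eps * (t + B - x)] cannot have a negative
   minimum, the added term making all the inequalities strict. *)
Lemma maximum_principle `(sf : stefan_flow alpha beta k D Tm qc s T Tx Txx Tt) (t1 : R) : 0 < t1 ->
  (forall t : R, 0 <= t <= t1 -> 0 < s t) ->
  (forall t : R, 0 < t <= t1 -> 0 <= qc (t - D)) ->
  (forall x : R, 0 <= x <= s 0 -> Tm <= T x 0) ->
  forall x t : R, 0 <= t <= t1 -> 0 <= x <= s t -> Tm <= T x t.
Proof.
move=> t10 s0 qc0 T0 x t tI xI.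
have cs1 : {within `[0, t1], continuous s}.
  by apply: continuous_subspaceW (s_cont sf); apply: subset_itvl; rewrite bnd_simp.
have [B0 B00 sB0] := segment_bounded cs1.
(* Then [t + B - x >= 1] on the liquid up to time [t1], so the perturbation is positive there. *)
pose B := B0 + 1.
have sB r : 0 <= r <= t1 -> s r + 1 <= B.
  by move=> rI; rewrite lerD2r (le_trans (ler_norm _))// sB0.
suff H eps : 0 < eps -> 0 <= T x t - Tm + eps * (t + B - x).
  have W0 : 0 < t + B - x.
    have := sB _ tI; move: tI xI => /andP[? ?] /andP[? ?] ?; lra.
  rewrite -subr_ge0; apply/ler_addgt0Pl => e e0.
  have := H (e / (t + B - x)) (divr_gt0 e0 W0).
  by rewrite divfK ?gt_eqF// addrC.
move=> eps0; rewrite leNgt; apply/negP => wneg.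
pose w (p : R * R) := T p.1 p.2 - Tm + eps * (p.2 + B - p.1).
(* The curved domain is the image of a rectangle, whose compactness provides the minimum. *)
pose h (p : R * R) := (p.1 * s p.2, p.2).
pose K : set (R * R) := `[0, 1] `*` `[0, t1].
have Kc : compact K by apply: compact_setX; exact: segment_compact.
have hK p : K p -> liquid s (h p).
  move=> [] /=; rewrite !in_itv/= => /andP[p0 p1] /andP[r0 r1]; split => //=.
  have sp : 0 < s p.2 by rewrite s0// r0.
  by rewrite mulr_ge0 ?(ltW sp)// ler_piMl// ltW.
have cfst : {within K, continuous (fun p : R * R => p.1)}.
  by apply: continuous_subspaceT => p; exact: cvg_fst.
have csnd : {within K, continuous (fun p : R * R => p.2)}.
  by apply: continuous_subspaceT => p; exact: cvg_snd.
have ch1 : {within K, continuous (fun p : R * R => p.1 * s p.2)}.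
  apply: ctsinM => //; apply: (ctsin_comp (h := fun p : R * R => p.2) (s_cont sf) csnd).
  by move=> p [_ /=]; rewrite !in_itv/= andbT => /andP[].
have ch : {within K, continuous h}.
  by move=> p; exact: (cvg_pair (ch1 p) (csnd p)).
have cw : {within K, continuous (fun p => w (h p))}.
  apply: ctsinD.
    apply: ctsinB; last exact: ctsin_cst.
    exact: (ctsin_comp (h := h) (T_cont sf) ch hK).
  apply: ctsinM; first exact: ctsin_cst.
  apply: ctsinB; last exact: ch1.
  by apply: ctsinD => //; exact: ctsin_cst.
have K0 : K !=set0 by exists (0, 0); split => /=; rewrite in_itv/= ?lexx ?ler01// ltW.
have [[y tm] /[!inE] Ky wmin] := compact_EVT_min K0 Kc cw.
have {}wmin z r : 0 <= r <= t1 -> 0 <= z <= s r -> w (h (y, tm)) <= w (z, r).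
  move=> rI /andP[z0 zs]; have sr := s0 _ rI.
  have := wmin (z / s r, r); rewrite /h /= divfK ?gt_eqF//; apply.
  rewrite inE; split => /=; rewrite in_itv//=.
  by rewrite divr_ge0 ?(ltW sr)//= ler_pdivrMr// mul1r.
have [/= [tm0 +]] := hK _ Ky; have [_ /=] := Ky; rewrite in_itv/= => tmI.
move: wmin; rewrite /h/=; set x0 := y * s tm => wmin x0I.
have {wneg} w0 : w (x0, tm) < 0 by apply: le_lt_trans wneg; exact: wmin.
have eps0' := eps0.
have tmp : 0 < tm.
  rewrite lt_neqAle tm0 andbT; apply/eqP => tmE.
  have x0I0 : 0 <= x0 <= s 0 by rewrite [in s 0]tmE.
  move: w0; rewrite /w/= -tmE add0r ltNge => /negP; apply.
  have := sB _ tmI; rewrite -tmE => H1; have := T0 _ x0I0 => H2.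
  move: x0I0 => /andP[H3 H4].
  by rewrite addr_ge0 ?subr_ge0// mulr_ge0 ?(ltW eps0)//; lra.
have sBm := sB _ tmI.
have x0s : x0 < s tm.
  move: x0I => /andP[x00]; rewrite le_eqVlt => /orP[/eqP x0E|//].
  move: w0; rewrite /w/= x0E (interface_eq sf)// subrr add0r pmulr_rlt0// => ?.
  have tmp' := tmp; lra.
have x00 : 0 <= x0 by case/andP: x0I.
have spos := s0 _ tmI.
have cT := liquid_slice_cont tm0 (T_cont sf).
have cTx := liquid_pos_slice_cont tmp (Tx_cont sf).
have cTxx := liquid_pos_slice_cont tmp (Txx_cont sf).
(* A profile that decreases strictly to the right of [x0] contradicts minimality, whether [x0] lies
   on the fixed boundary or inside. *)
suff [d [/andP[x0d ds] Hd]] : exists d, x0 < d <= s tm /\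
    forall x, x0 < x < d -> Tx x tm - eps < 0.
  have := wmin d tm tmI; rewrite /w/= (le_trans x00 (ltW x0d)) ds => /(_ isT).
  apply/negP; rewrite -ltNge.
  apply: (@not_min_of_neg_derive (fun x => T x tm - Tm + eps * (tm + B - x))
    (fun x => Tx x tm - eps)) => //.
  - have sub : `[x0, d] `<=` `[0, s tm] by apply: subset_itv; rewrite bnd_simp.
    apply: ctsinD.
      by apply: ctsinB; [exact: continuous_subspaceW cT|exact: ctsin_cst].
    apply: ctsinM; first exact: ctsin_cst.
    by apply: ctsinB; [exact: ctsin_cst|exact: ctsin_id].
  - move=> z /andP[xz zd].
    have [dT _ _] : [/\ is_derive z 1 (fun y => T y tm) (Tx z tm),
         is_derive z 1 (fun y => Tx y tm) (Txx z tm) &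
         is_derive tm 1 (fun r => T z r) (Tt z tm)].
      by apply: (T_derive sf) => //; rewrite (le_lt_trans x00 xz) (lt_le_trans zd ds).
    have -> : Tx z tm - eps = (Tx z tm - 0) + eps * (0 - 1) by ring.
    exact: (is_deriveD (is_deriveB dT (is_derive_cst Tm z 1))
      (is_deriveZ eps (is_deriveB (is_derive_cst (tm + B) z 1) (is_derive_id z 1)))).
have [x0E|x0ne] := eqVneq x0 0.
  have Tx0 : Tx x0 tm - eps < 0.
    have : - k * Tx 0 tm = qc (tm - D) by exact: (flux_eq sf).
    have : 0 <= qc (tm - D) by apply: qc0; rewrite tmp; case/andP: tmI.
    move=> q0 fE; have : Tx 0 tm <= 0.
      by rewrite -(pmulr_rle0 _ (k_gt0 sf)) -oppr_ge0 -mulNr fE.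
    by rewrite x0E; lra.
  have cF : {within `[0, s tm], continuous (fun x => Tx x tm - eps)}.
    by apply: ctsinB => //; exact: ctsin_cst.
  have x0I' : 0 <= x0 < s tm by rewrite x00.
  have [d [dI Hd]] := neg_right_of cF x0I' Tx0.
  by exists d; split => // z /andP[/ltW ? /ltW ?]; apply: Hd; apply/andP.
have x0p : 0 < x0 by rewrite lt_neqAle eq_sym x0ne.
have x0I' : 0 < x0 < s tm by rewrite x0p.
have [dT dTx dTt] := T_derive sf tmp x0I'.
(* Only earlier times are compared, since [tm] may be the last one; [x0] is still in the liquid
   there by continuity of [s]. The heat equation then makes [Txx] negative, and with
   [Tx x0 tm = eps] the profile decreases just right of [x0]. *)
have Ttle : Tt x0 tm + eps <= 0.
  rewrite leNgt; apply/negP => H.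
  have e2 : 0 < (Tt x0 tm + eps) / 2 by rewrite divr_gt0.
  have : \forall r \near tm^'-, False; last by move=> /filter_ex[].
  near=> r.
  have rt : r < tm by near: r; exact: nbhs_left_lt.
  have r0 : 0 < r by near: r; exact: nbhs_left_gt.
  have Hs : `|T x0 tm - T x0 r - Tt x0 tm * (tm - r)| <= (Tt x0 tm + eps) / 2 * (tm - r).
    by near: r; exact: is_derive_left_derive.
  have xr : x0 < s r.
    by near: r; apply: cvgr_gt x0s; apply: cvg_at_left_filter; exact: (s_continuous_pos sf tmp).
  have rI : 0 <= r <= t1 by rewrite (ltW r0)/= (le_trans (ltW rt))//; case/andP: tmI.
  have := wmin x0 r rI; rewrite x00 (ltW xr) => /(_ isT); rewrite /w/=.
  move: Hs; rewrite ler_norml => /andP[Hs _] Hw.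
  have : 0 < (Tt x0 tm + eps) * (tm - r) by rewrite mulr_gt0// subr_gt0.
  move: Hs Hw; clear; lra.
have Txxlt : Txx x0 tm < 0.
  have E : Tt x0 tm = alpha * Txx x0 tm by apply: (heat_eq sf).
  by rewrite -(pmulr_rlt0 _ (alpha_gt0 sf)) -E; lra.
have Tx0 : Tx x0 tm - eps = 0.
  pose f z := w (z, tm).
  have df (z : R) : 0 < z < s tm -> is_derive z 1 f (Tx z tm - eps).
    move=> zI; have [dTz _ _] := T_derive sf tmp zI.
    have -> : Tx z tm - eps = (Tx z tm - 0) + eps * (0 - 1) by ring.
    exact: (is_deriveD (is_deriveB dTz (is_derive_cst Tm z 1))
      (is_deriveZ eps (is_deriveB (is_derive_cst (tm + B) z 1) (is_derive_id z 1)))).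
  have : is_derive x0 1 f 0.
    apply: (@derive1_at_min _ f 0 (s tm)) => //.
    - exact: ltW.
    - by move=> z; rewrite in_itv/= => /df; exact: is_derive_derivable.
    - by move=> z; rewrite in_itv/= => /andP[/ltW z0 /ltW zs]; apply: wmin => //; rewrite z0.
  by move=> H0; rewrite -(@derive_val _ _ _ _ _ _ _ (df _ x0I')) derive_val.
have x0J : 0 <= x0 < s tm by rewrite x00.
have [d [/andP[x0d ds] Hd]] := neg_right_of cTxx x0J Txxlt.
exists d; split; first by rewrite x0d.
move=> z /andP[x0z zd]; rewrite -Tx0 ltrD2r.
apply: (@not_min_of_neg_derive (fun x => Tx x tm) (fun x => Txx x tm)) => //.
- apply: continuous_subspaceW cTx; apply: subset_itv; rewrite bnd_simp//.
  exact: le_trans (ltW zd) ds.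
- move=> z' /andP[x0z' z'z].
  have z'I : 0 < z' < s tm by rewrite (lt_trans x0p x0z') (lt_le_trans (lt_trans z'z zd) ds).
  by have [] := T_derive sf tmp z'I.
- by move=> z' /andP[/ltW x0z' z'z]; apply: Hd; rewrite x0z' (ltW (lt_trans z'z zd)).
Unshelve. all: by end_near. Qed.

Lemma T_derive_x `(sf : stefan_flow alpha beta k D Tm qc s T Tx Txx Tt) (x t : R) :
  0 < t -> 0 < x < s t -> is_derive x 1 (fun y => T y t) (Tx x t).
Proof. by move=> t0 /(T_derive sf t0)[]. Qed.

Lemma T_derive_xx `(sf : stefan_flow alpha beta k D Tm qc s T Tx Txx Tt) (x t : R) :
  0 < t -> 0 < x < s t -> is_derive x 1 (fun y => Tx y t) (Txx x t).
Proof. by move=> t0 /(T_derive sf t0)[]. Qed.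

Lemma T_derive_t `(sf : stefan_flow alpha beta k D Tm qc s T Tx Txx Tt) (x t : R) :
  0 < t -> 0 < x < s t -> is_derive t 1 (fun r => T x r) (Tt x t).
Proof. by move=> t0 /(T_derive sf t0)[]. Qed.

(** A positive slope would persist on a small interval left of the interface and push [T] below the
    value [Tm] taken at [s t]. *)
Lemma Tx_interface_le0 `(sf : stefan_flow alpha beta k D Tm qc s T Tx Txx Tt) (t : R) :
  0 < t -> 0 < s t -> (forall x : R, 0 <= x <= s t -> Tm <= T x t) -> Tx (s t) t <= 0.
Proof.
move=> t0 st0 TTm; rewrite leNgt; apply/negP => H.
have cTx := liquid_pos_slice_cont t0 (Tx_cont sf).
have cT := liquid_slice_cont (ltW t0) (T_cont sf).
have [_ _ lTx] := (continuous_within_itvP _ st0).1 cTx.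
have [d /= d0 Hd] : \forall x \near (s t)^'-, 0 < Tx x t by exact: (cvgr_gt _ lTx).
have [x [x0 xs Hx]] : exists x, [/\ 0 <= x, x < s t & forall z, x < z < s t -> 0 < Tx z t].
  exists (Num.max 0 (s t - d / 2)); split.
  - by rewrite le_max lexx.
  - by rewrite gt_max st0 gtrBl divr_gt0.
  - move=> z /andP[]; rewrite gt_max => /andP[_ zd] zs; apply: Hd => //=.
    by rewrite ltr_distlC; clear -zd zs d0; apply/andP; split; lra.
have cT' : {within `[x, s t], continuous (fun y => - T y t)}.
  apply: ctsinN; apply: continuous_subspaceW cT.
  by apply: subset_itv; rewrite bnd_simp.
have := not_min_of_neg_derive (f' := fun y => - Tx y t) xs cT'.
rewrite ltrN2 (interface_eq sf (ltW t0)) ltNge TTm ?x0 ?(ltW xs)//.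
move=> HH; suff: false by []; apply: HH.
- move=> z /andP[xz zs]; apply: is_deriveN; apply: (T_derive_x sf) => //.
  by rewrite (le_lt_trans x0 xz).
- by move=> z /Hx; rewrite oppr_lt0.
Qed.

(** The mean value theorem only looks at times before [t1], so [s] may be assumed positive strictly
    before [t1] while the conclusion includes [t1]. This is what rules out a first collapse of the
    liquid. *)
Lemma interface_nondecreasing_pos `(sf : stefan_flow alpha beta k D Tm qc s T Tx Txx Tt) (t1 : R) :
  0 < t1 -> (forall t : R, 0 <= t < t1 -> 0 < s t) ->
  (forall t : R, 0 < t < t1 -> 0 <= qc (t - D)) ->
  (forall x : R, 0 <= x <= s 0 -> Tm <= T x 0) ->
  forall a b : R, 0 <= a -> a <= b -> b <= t1 -> s a <= s b.
Proof.
move=> t10 spos qc0 T0 a b a0 ab bt.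
have cs : {within `[a, b], continuous s}.
  apply: continuous_subspaceW (s_cont sf) => x /=; rewrite !in_itv/= andbT => /andP[ax _].
  exact: le_trans ax.
move: ab; rewrite le_eqVlt => /orP[/eqP -> //|ab].
have ds x : x \in `]a, b[ -> is_derive x 1 s (- beta * Tx (s x) x).
  by rewrite in_itv/= => /andP[ax _]; apply: (s_derive sf); exact: le_lt_trans ax.
have [c /[!in_itv]/= /andP[ac cb] E] := MVT ab ds cs.
rewrite -subr_ge0 E mulr_ge0 ?subr_ge0 ?(ltW ab)// mulNr oppr_ge0.
have c0 : 0 < c by exact: le_lt_trans ac.
have ct : c < t1 by exact: lt_le_trans bt.
rewrite pmulr_rle0 ?(beta_gt0 sf)//; apply: (Tx_interface_le0 sf) => //.
  by apply: spos; rewrite ct ltW.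
move=> x xI; apply: (maximum_principle sf c0) => //; last by rewrite lexx (ltW c0).
- by move=> t /andP[t0 tc]; apply: spos; rewrite t0 (le_lt_trans tc ct).
- by move=> t /andP[t0 tc]; apply: qc0; rewrite t0 (le_lt_trans tc ct).
Qed.

Lemma first_nonpos `(sf : stefan_flow alpha beta k D Tm qc s T Tx Txx Tt) (t : R) :
  0 < s 0 -> 0 <= t -> s t <= 0 ->
  exists i, [/\ 0 < i, s i <= 0 & forall r : R, 0 <= r < i -> 0 < s r].
Proof.
move=> s00 t0 st0.
pose A : set R := [set r | 0 <= r /\ s r <= 0].
have At : A t by [].
have infA : has_inf A by split; [exists t|exists 0 => r []].
pose i := inf A.
have i0 : 0 <= i by apply: lb_le_inf; [exists t|move=> r []].
have Alb r : A r -> i <= r by move=> Ar; apply: ge_inf => //; exists 0 => z [].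
have si : s i <= 0.
  rewrite leNgt; apply/negP => si0.
  have := (subspace_continuousP _ _).1 (s_cont sf) i.
  rewrite /= in_itv/= andbT => /(_ i0) /cvgrPdist_lt/(_ _ si0)[d /= d0 Hd].
  have [r Ar ri] := inf_adherent d0 infA.
  have [r0 sr] := Ar; have ir := Alb _ Ar.
  have := Hd r; rewrite /= in_itv/= andbT distrC ger0_norm ?subr_ge0// ltrBlDl.
  move=> /(_ ri r0); rewrite ltr_distlC => /andP[]; rewrite subrr => H _.
  by move: sr; rewrite leNgt H.
exists i; split => //.
  rewrite lt_neqAle i0 andbT; apply/eqP => iE.
  by move: si; rewrite -iE leNgt s00.
move=> r /andP[r0 ri]; rewrite ltNge; apply/negP => sr.
have : i <= r by exact: Alb.
by rewrite leNgt ri.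
Qed.

(** The bound [t1] allows these facts to be used before they are known for all times, as the
    induction on delays needs. *)
Record admissible_upto (t1 Tm : R) (s : R -> R) (T : R -> R -> R) : Prop := {
  s_gt0 : forall t : R, 0 <= t <= t1 -> 0 < s t;
  s_mono : forall a b : R, 0 <= a -> a <= b -> b <= t1 -> s a <= s b;
  T_ge : forall x t : R, 0 <= t <= t1 -> 0 <= x <= s t -> Tm <= T x t }.

Lemma nonneg_flux_admissible `(sf : stefan_flow alpha beta k D Tm qc s T Tx Txx Tt) (t1 : R) :
  0 < t1 -> (forall t : R, 0 <= t <= t1 -> 0 < s t) ->
  (forall t : R, 0 < t <= t1 -> 0 <= qc (t - D)) ->
  (forall x : R, 0 <= x <= s 0 -> Tm <= T x 0) ->
  admissible_upto t1 Tm s T.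
Proof.
move=> t10 spos qc0 T0; split => //.
- apply: (interface_nondecreasing_pos sf t10) => //.
  + by move=> t /andP[t0 /ltW tt]; apply: spos; rewrite t0.
  + by move=> t /andP[t0 /ltW tt]; apply: qc0; rewrite t0.
- exact: (maximum_principle sf t10).
Qed.

(** Mean value theorem in time at fixed [x]. A point with [x < s r] stays in the liquid during
    [[r, t]] because [s] is nondecreasing, which would fail to the right of [t]. *)
Lemma Tt_increment `(sf : stefan_flow alpha beta k D Tm qc s T Tx Txx Tt) (t e : R) :
  0 < t -> admissible_upto t Tm s T -> 0 < e ->
  \forall r \near t^'-, forall x : R, 0 < x < s r ->
    `|T x t - T x r - (t - r) * Tt x t| <= e * (t - r).
Proof.
move=> t0 adm e0.
(* [Tt] is continuous at positive times only, hence the extension from [[t / 2, t]]. *)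
have t20 : 0 < t / 2 by rewrite divr_gt0.
have t2t : t / 2 <= t by clear -t0; lra.
have cG : continuous (extend (t / 2) t s Tt).
  apply: (extend_continuous (ltW t20) t2t (s_cont sf) _ _ (Tt_cont sf)).
    move=> r /andP[r0 rt]; apply: ltW; apply: (s_gt0 adm).
    by rewrite rt andbT (le_trans (ltW t20)).
  by move=> x r /andP[r0 rt] xI; split => //=; exact: lt_le_trans r0.
have [d /= d0 Hd] := @uniform_near_segment _ _ 0 (s t) t e cG e0.
near=> r => x /andP[x0 xr].
have rt : r < t by near: r; exact: nbhs_left_lt.
have r2 : t / 2 < r by near: r; apply: nbhs_left_gt; clear -t0; lra.
have rd : t - d < r by near: r; apply: nbhs_left_gt; rewrite gtrBl.
have r0 : 0 < r by exact: lt_trans r2.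
have dT c : r <= c <= t -> is_derive c 1 (fun r => T x r) (Tt x c).
  move=> /andP[rc ct]; apply: (T_derive_t sf); first exact: lt_le_trans rc.
  by rewrite x0 (lt_le_trans xr)//; apply: (s_mono adm) => //; exact: ltW.
have dT' c : c \in `]r, t[ -> is_derive c 1 (fun r => T x r) (Tt x c).
  by rewrite in_itv/= => /andP[/ltW rc /ltW ct]; apply: dT; rewrite rc.
have cT : {within `[r, t], continuous (fun r => T x r)}.
  apply: derivable_within_continuous => c; rewrite in_itv/= => /dT.
  exact: is_derive_derivable.
have [c /[!in_itv]/= /andP[rc ct] ->] := MVT rt dT' cT.
rewrite [(t - r) * _]mulrC -mulrBl normrM (gtr0_norm (_ : 0 < t - r)) ?subr_gt0//.
rewrite ler_wpM2r ?subr_ge0 ?(ltW rt)//.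
have xs r' : r <= r' -> r' <= t -> 0 <= x <= s r'.
  move=> rr' rt'; rewrite (ltW x0)/= (le_trans (ltW xr))//.
  by apply: (s_mono adm) => //; exact: ltW.
rewrite -(@extendE _ (t / 2) t s Tt x c); last 2 first.
- by rewrite (ltW ct) (le_trans (ltW r2) (ltW rc)).
- by apply: xs; exact: ltW.
rewrite -[Tt x t](@extendE _ (t / 2) t s Tt x t) ?lexx ?andbT//; last first.
  by apply: xs => //; exact: ltW.
apply: Hd; last by apply: xs => //; exact: ltW.
rewrite /= ger0_norm ?subr_ge0 ?(ltW ct)//.
by move: rd rc ct; clear; lra.
Unshelve. all: by end_near. Qed.

(* The moving end point does not contribute, because T = Tm there. *)
Lemma moment_left_derive `(sf : stefan_flow alpha beta k D Tm qc s T Tx Txx Tt) (t : R) (p : R -> R) :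
  0 < t -> admissible_upto t Tm s T -> {within `[0, s t], continuous p} ->
  left_derive (fun r => \int[mu]_(x in `[0, s r]) (p x * (T x r - Tm))) t
    (\int[mu]_(x in `[0, s t]) (p x * Tt x t)).
Proof.
move=> t0 adm cp e e0.
have tI : 0 <= t <= t by rewrite lexx ltW.
have st0 : 0 < s t by exact: (s_gt0 adm).
have cT := liquid_slice_cont (ltW t0) (T_cont sf).
have cTx := liquid_pos_slice_cont t0 (Tx_cont sf).
have cTt := liquid_pos_slice_cont t0 (Tt_cont sf).
have [P P0 HP] := segment_bounded cp.
have [C1 C10 HC1] := segment_bounded cTx.
have [C2 C20 HC2] := segment_bounded cTt.
pose C3 := `|- beta * Tx (s t) t| + 1.
have C30 : 0 < C3 by rewrite ltr_wpDl.
(* On the strip between [s r] and [s t] the temperature differs from [Tm] by at most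
   [C1 * C3 * (t - r)], so the integrand is at most [N * (t - r)]. The strip has length at most
   [C3 * (t - r)]: its contribution is of second order. *)
pose N := P * (C1 * C3 + C2).
have N0 : 0 < N by rewrite mulr_gt0// addr_gt0// mulr_gt0.
pose e1 := e / 2 / (P * s t).
have e10 : 0 < e1 by rewrite !divr_gt0// mulr_gt0.
pose e2 := e / 2 / (N * C3).
have e20 : 0 < e2 by rewrite !divr_gt0// mulr_gt0.
near=> r.
have rt : r < t by near: r; exact: nbhs_left_lt.
have r0 : 0 < r by near: r; exact: nbhs_left_gt.
have re2 : t - r <= e2.
  rewrite lerBlDr -lerBlDl; near: r; apply: nbhs_left_ge; rewrite gtrBl//.
have K1 : forall x : R, 0 < x < s r -> `|T x t - T x r - (t - r) * Tt x t| <= e1 * (t - r).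
  by near: r; exact: (Tt_increment sf).
have srt : s r <= s t by apply: (s_mono adm) => //; exact: ltW.
have sr0 : 0 < s r by apply: (s_gt0 adm); rewrite !ltW.
have tr0 : 0 < t - r by rewrite subr_gt0.
have K2 : s t - s r <= C3 * (t - r).
  have : `|s t - s r - (- beta * Tx (s t) t) * (t - r)| <= 1 * (t - r).
    by near: r; apply: is_derive_left_derive; [exact: (s_derive sf)|].
  rewrite ler_norml => /andP[_]; rewrite lerBlDl -mulrDl => /le_trans; apply.
  by rewrite ler_wpM2r ?(ltW tr0)// lerD2r ler_norm.
have sub : `[0, s r] `<=` `[0, s t] by apply: subset_itv; rewrite bnd_simp.
have cTr := liquid_slice_cont (ltW r0) (T_cont sf).
have i1 : integrable_on 0 (s t) (fun x => p x * (T x t - Tm)).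
  by apply: continuous_integrable_on; apply: ctsinM => //; apply: ctsinB => //; exact: ctsin_cst.
have i2 : integrable_on 0 (s r) (fun x => p x * (T x r - Tm)).
  apply: continuous_integrable_on; apply: ctsinM; first exact: continuous_subspaceW cp.
  by apply: ctsinB => //; exact: ctsin_cst.
have i3 : integrable_on 0 (s t) (fun x => p x * Tt x t).
  by apply: continuous_integrable_on; exact: ctsinM.
have i3' := integrable_onZ (t - r) i3.
have S (f : R -> R) : integrable_on 0 (s t) f -> integrable_on 0 (s r) f.
  exact: integrable_onS.
have S' (f : R -> R) : integrable_on 0 (s t) f -> integrable_on (s r) (s t) f.
  by apply: integrable_onS => //; exact: ltW.
rewrite [_ * (t - r)]mulrC -RintegralZl//.
rewrite (integral_split (ltW sr0) srt i1) (integral_split (ltW sr0) srt i3').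
set A1 := \int[mu]_(x in `[0, s r]) (p x * (T x t - Tm)).
set A2 := \int[mu]_(x in `[s r, s t]) (p x * (T x t - Tm)).
set A3 := \int[mu]_(x in `[0, s r]) (p x * (T x r - Tm)).
set A4 := \int[mu]_(x in `[0, s r]) ((t - r) * _).
set A5 := \int[mu]_(x in `[s r, s t]) ((t - r) * _).
have -> : A1 + A2 - A3 - (A4 + A5) = (A1 - A3 - A4) + (A2 - A5) by ring.
have Si1 := S _ i1; have Si3 := S _ i3'.
have Si1' := S' _ i1; have Si3' := S' _ i3'.
have HA : `|A1 - A3 - A4| <= e / 2 * (t - r).
  rewrite -RintegralB// -RintegralB//; last exact: integrable_onB.
  apply: (@le_trans _ _ (P * (e1 * (t - r)) * (s r - 0))).
    apply: norm_integral_le_oo; first exact: ltW.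
      by apply: integrable_onB => //; exact: integrable_onB.
    move=> x /andP[x0 xs].
    have -> : p x * (T x t - Tm) - p x * (T x r - Tm) - (t - r) * (p x * Tt x t) =
      p x * (T x t - T x r - (t - r) * Tt x t) by ring.
    rewrite normrM ler_pM//; last by apply: K1; rewrite x0.
    by apply: HP; rewrite (ltW x0) (le_trans (ltW xs)).
  have -> : e / 2 * (t - r) = P * (e1 * (t - r)) * s t.
    by rewrite /e1; field; rewrite !gt_eqF.
  rewrite subr0; apply: ler_wpM2l => //.
  by apply: mulr_ge0; [exact: ltW|apply: mulr_ge0; exact: ltW].
have HB : `|A2 - A5| <= e / 2 * (t - r).
  rewrite -RintegralB//.
  apply: (@le_trans _ _ (N * (t - r) * (s t - s r))).
    apply: norm_integral_le_oo => //; first exact: integrable_onB.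
    move=> x /andP[sx xs].
    have x0 : 0 < x by exact: lt_trans sx.
    have xI : 0 <= x <= s t by rewrite !ltW.
    have -> : p x * (T x t - Tm) - (t - r) * (p x * Tt x t) =
      p x * ((T x t - Tm) - (t - r) * Tt x t) by ring.
    rewrite normrM /N -mulrA ler_pM//; first exact: HP.
    apply: le_trans (ler_normB _ _) _; rewrite [leRHS]mulrDl; apply: lerD; last first.
      by rewrite normrM mulrC (gtr0_norm tr0) ler_wpM2r ?HC2// ltW.
    have cT' : {within `[x, s t], continuous (fun y => T y t)}.
      by apply: continuous_subspaceW cT; apply: subset_itv; rewrite bnd_simp// ltW.
    have dT y : y \in `]x, s t[ -> is_derive y 1 (fun y => T y t) (Tx y t).
      rewrite in_itv/= => /andP[xy ys]; apply: (T_derive_x sf) => //.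
      by rewrite ys (lt_trans x0).
    have [y /[!in_itv]/= /andP[xy ys]] := MVT xs dT cT'.
    rewrite (interface_eq sf (ltW t0)) => E.
    rewrite distrC E normrM -mulrA ler_pM//.
      by apply: HC1; rewrite (ltW ys) (ltW (lt_trans x0 xy)).
    rewrite gtr0_norm ?subr_gt0//; apply: le_trans K2.
    by rewrite lerD2l lerN2 ltW.
  have -> : e / 2 * (t - r) = N * (t - r) * (C3 * e2).
    by rewrite /e2; field; rewrite !gt_eqF.
  apply: ler_wpM2l; first exact: mulr_ge0 (ltW N0) (ltW tr0).
  by apply: le_trans K2 _; rewrite ler_wpM2l// ltW.
apply: le_trans (ler_normD _ _) (le_trans (lerD HA HB) _).
by rewrite -mulrDl -splitr.
Unshelve. all: by end_near. Qed.

(** By the flux condition [qc t] equals [- k * Tx 0 (t + D)], so the regularity of the solution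
    makes even the past input continuous. *)
Lemma qc_continuous `(sf : stefan_flow alpha beta k D Tm qc s T Tx Txx Tt) (t1 t : R) :
  (forall r : R, 0 <= r < t1 -> 0 < s r) -> - D < t -> t < t1 - D ->
  {for t, continuous qc}.
Proof.
move=> spos Dt tt1.
(* Two times enclosing [t + D], both positive and before [t1], between which [Tx] can be
   extended. *)
have [a0 at' tb bt1] : [/\ 0 < (t + D) / 2, (t + D) / 2 < t + D,
    t + D < (t + D + t1) / 2 & (t + D + t1) / 2 < t1].
  by move: Dt tt1; clear; split; lra.
set a := (t + D) / 2 in a0 at' *; set b := (t + D + t1) / 2 in tb bt1 *.
have ab : a <= b by exact: ltW (lt_trans at' tb).
have cG : continuous (extend a b s Tx).
  apply: (extend_continuous (ltW a0) ab (s_cont sf) _ _ (Tx_cont sf)).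
    move=> r /andP[ar rb]; apply: ltW; apply: spos.
    by rewrite (le_trans (ltW a0) ar) (le_lt_trans rb bt1).
  by move=> x r /andP[ar rb] xI; split => //=; exact: lt_le_trans ar.
have qcE r : a <= r + D <= b -> - k * extend a b s Tx (0, r + D) = qc r.
  move=> /andP[ar rb]; have r0 : 0 < r + D by exact: lt_le_trans ar.
  rewrite extendE ?ar// ?(flux_eq sf)// ?addrK//.
  by rewrite lexx ltW// spos// (ltW r0) (le_lt_trans rb bt1).
have cq : {for t, continuous (fun r => - k * extend a b s Tx (0, r + D))}.
  apply: cvgM; first exact: cvg_cst.
  have ch : (fun r : R => ((0 : R), r + D)) @ t --> ((0 : R), t + D).
    apply: (@cvg_pair _ _ _ _ (nbhs (0 : R)) (nbhs (t + D))); first exact: cvg_cst.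
    by apply: cvgD; [exact: cvg_id|exact: cvg_cst].
  exact: (cvg_comp _ _ ch (cG (0, t + D))).
suff : qc x @[x --> t] --> qc t by [].
rewrite -(qcE t) ?(ltW at') ?(ltW tb)//.
apply: (cvg_trans _ cq); apply: near_eq_cvg; near=> r; apply: qcE.
have ra : a - D < r by near: r; apply: lt_nbhsr; rewrite ltrBlDr.
have rb : r < b - D by near: r; apply: lt_nbhsl; rewrite ltrBrDr.
by apply/andP; split; apply: ltW; [rewrite -ltrBlDr|rewrite -ltrBrDr].
Unshelve. all: by end_near. Qed.

Lemma continuous_within (f : R -> R) (a b : R) :
  (forall x, a <= x <= b -> {for x, continuous f}) -> {within `[a, b], continuous f}.
Proof.
move=> cf; apply: continuous_in_subspaceT => x; rewrite inE/= in_itv/=; exact: cf.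
Qed.

Lemma primitive_left_increment (f : R -> R) (t e : R) : {for t, continuous f} -> 0 < e ->
  exists2 d, 0 < d & forall r, t - d < r < t -> integrable_on r t f ->
    `|\int[mu]_(x in `[r, t]) f x - f t * (t - r)| <= e * (t - r).
Proof.
move=> /cvgrPdist_le cf e0.
have [d /= d0 Hd] := cf _ e0; exists d => // r /andP[dr rt] fi.
have -> : f t * (t - r) = \int[mu]_(x in `[r, t]) f t by rewrite segment_integral_cst// ltW.
rewrite -RintegralB//; last exact: integrable_on_cst.
apply: norm_integral_le_oo; first exact: ltW.
  by apply: integrable_onB => //; exact: integrable_on_cst.
move=> x /andP[rx xt]; rewrite distrC; apply: Hd => /=.
by rewrite ger0_norm ?subr_ge0 ?(ltW xt)//; move: dr rx; clear; lra.
Qed.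

Lemma window_left_derive (f : R -> R) (D t : R) : 0 < D ->
  {for t, continuous f} -> {for t - D, continuous f} ->
  (\forall r \near t^'-, integrable_on (r - D) t f) ->
  left_derive (fun r => \int[mu]_(x in `[r - D, r]) f x) t (f t - f (t - D)).
Proof.
move=> D0 ct ctD fi e e0.
have e2 : 0 < e / 2 by rewrite divr_gt0.
have [d1 d10 H1] := primitive_left_increment ct e2.
have [d2 d20 H2] := primitive_left_increment ctD e2.
near=> r.
have rt : r < t by near: r; exact: nbhs_left_lt.
have rd1 : t - d1 < r by near: r; apply: nbhs_left_gt; rewrite gtrBl.
have rd2 : t - d2 < r by near: r; apply: nbhs_left_gt; rewrite gtrBl.
have rD : t - D < r by near: r; apply: nbhs_left_gt; rewrite gtrBl.
have i : integrable_on (r - D) t f by near: r.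
have rDt : r - D <= t - D by rewrite lerD2r ltW.
have tDt : t - D <= t by rewrite gerBl ltW.
have rDr : r - D <= r by rewrite gerBl ltW.
have E := integral_split rDt tDt i.
rewrite (integral_split rDr (ltW rt) i) in E.
have {H1} : `|\int[mu]_(x in `[r, t]) f x - f t * (t - r)| <= e / 2 * (t - r).
  by apply: H1; rewrite ?rd1//; exact: integrable_onS i.
have {H2} : `|\int[mu]_(x in `[r - D, t - D]) f x - f (t - D) * (t - r)| <= e / 2 * (t - r).
  have -> : t - r = t - D - (r - D) by ring.
  apply: H2; last exact: integrable_onS i.
  by apply/andP; split; move: rd2 rt; clear; lra.
move: E.
set A := \int[mu]_(x in `[r - D, r]) f x; set B := \int[mu]_(x in `[r, t]) f x.
set A' := \int[mu]_(x in `[r - D, t - D]) f x; set B' := \int[mu]_(x in `[t - D, t]) f x.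
move=> E HA HB.
have -> : B' - A - (f t - f (t - D)) * (t - r) =
    (B - f t * (t - r)) - (A' - f (t - D) * (t - r)).
  have -> : B' = A + B - A' by rewrite E; ring.
  by ring.
by apply: le_trans (ler_normB _ _) (le_trans (lerD HB HA) _); rewrite -mulrDl -splitr.
Unshelve. all: by end_near. Qed.

(** The delayed terms cancel: the heat content contributes [k * (Tx (s t) t - Tx 0 t)] and the
    interface [- k * Tx (s t) t]; what remains is the flux [qc (t - D)], which the window integral
    subtracts. *)
Lemma closed_loop_input_ode `(sf : stefan_flow alpha beta k D Tm qc s T Tx Txx Tt)
    (c sr t1 : R) :
  0 < D -> 0 < c -> control_law alpha beta k D c sr Tm qc T s ->
  integrable_on (- D) 0 qc ->
  (forall r : R, - D < r -> r <= t1 -> {for r, continuous qc}) ->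
  admissible_upto t1 Tm s T ->
  forall t : R, 0 <= t <= t1 -> qc t = qc 0 * expR (- c * t).
Proof.
move=> D0 c0 ctrl qi qcont adm.
have a0 := alpha_gt0 sf; have b0 := beta_gt0 sf; have k0 := k_gt0 sf.
have qi' b : b <= t1 -> integrable_on (- D) b qc.
  move=> bt1; have [b0'|b0'] := leP b 0.
    exact: integrable_onS qi.
  apply: (@integrable_on_cat _ _ 0) => //; first by rewrite oppr_le0 !ltW.
  apply: continuous_integrable_on; apply: continuous_within => x /andP[x0 xb].
  apply: qcont; last exact: le_trans bt1.
  by apply: lt_le_trans x0; rewrite oppr_lt0.
(* the bracket in the control law has derivative [qc t] *)
have Qd t : 0 < t <= t1 -> left_derive qc t (- c * qc t).
  move=> /andP[t0 tt1].
  have admt : admissible_upto t Tm s T.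
    case: adm => H1 H2 H3; split.
    - by move=> r /andP[r0 rt]; apply: H1; rewrite r0 (le_trans rt).
    - by move=> a b a0' ab bt; apply: H2 => //; exact: le_trans tt1.
    - by move=> x r /andP[r0 rt]; apply: H3; rewrite r0 (le_trans rt).
  have st0 : 0 < s t by apply: (s_gt0 admt); rewrite lexx ltW.
  have tD : - D < t - D by rewrite ltrBrDr addNr.
  pose Q r := \int[mu]_(x in `[r - D, r]) qc x
    + (k / alpha * \int[mu]_(x in `[0, s r]) (1 * (T x r - Tm)) + k / beta * (s r - sr)).
  have QE r : 0 <= r -> qc r = - c * Q r.
    move=> r0; rewrite ctrl// /Q -addrA; congr (- c * (_ + (_ * _ + _))).
    by apply: eq_Rintegral => x _; rewrite mul1r.
  have dQ : left_derive Q t (qc t).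
    have -> : qc t = (qc t - qc (t - D)) + (k / alpha * \int[mu]_(x in `[0, s t]) (1 * Tt x t)
        + k / beta * (- beta * Tx (s t) t + 0)).
      have cTxx := liquid_pos_slice_cont t0 (Txx_cont sf).
      have -> : \int[mu]_(x in `[0, s t]) (1 * Tt x t) = alpha * (Tx (s t) t - Tx 0 t).
        rewrite -(segment_FTC (ltW st0) cTxx (liquid_pos_slice_cont t0 (Tx_cont sf))
          (fun x xI => T_derive_xx sf t0 xI)).
        rewrite -RintegralZl//; last exact: continuous_integrable_on.
        apply: eq_Rintegral => x; rewrite inE/= in_itv/= => xI.
        by rewrite mul1r (heat_eq sf).
      rewrite -[qc (t - D)](flux_eq sf)//.
      by field; rewrite !gt_eqF.
    apply: left_deriveD.
      apply: window_left_derive => //.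
      - by apply: qcont => //; apply: lt_trans t0; rewrite oppr_lt0.
      - apply: qcont => //; apply: le_trans tt1; rewrite gerBl; exact: ltW.
      - near=> r; have r0 : 0 < r by near: r; exact: nbhs_left_gt.
        apply: integrable_onS (qi' t tt1) => //.
        by rewrite lerBrDr addNr ltW.
    apply: left_deriveD.
      apply: left_deriveZ; apply: (moment_left_derive sf) => //.
      exact: ctsin_cst.
    apply: left_deriveZ; apply: left_deriveD; last exact: left_derive_cst.
    by apply: is_derive_left_derive; exact: (s_derive sf).
  move=> e e0; have := left_deriveZ (- c) dQ e0.
  apply: filterS2 (nbhs_left_gt t0) => r r0.
  by rewrite -!QE// ltW.
move=> t /andP[t0 tt1].
have dexp (r : R) : is_derive r 1 (fun r => expR (- c * r)) (- c * expR (- c * r)).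
  have := @is_derive_shift_scale R expR (- c) 0 r _ (is_derive_expR _).
  by rewrite !addr0; under eq_fun do rewrite addr0.
have cqc : {within `[0, t], continuous qc}.
  apply: continuous_within => x /andP[x0 xt]; apply: qcont; last exact: le_trans tt1.
  by apply: lt_le_trans x0; rewrite oppr_lt0.
have cexp C : {within `[0, t], continuous (fun r => C * expR (- c * r))}.
  apply: ctsinM; first exact: ctsin_cst.
  by apply: continuous_subspaceT => x; exact: is_derive_continuous (dexp x).
(* Where this difference is positive its left derivative, [- c] times itself, is not. The signs 1
   and -1 together give equality from a one-sided comparison. *)
pose f sg r := sg * (qc r + - qc 0 * expR (- c * r)).
have key sg : f sg t <= 0.
  apply: (left_slope_comparison t0).
  - by apply: ctsinM; [exact: ctsin_cst|exact: ctsinD].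
  - by rewrite /f mulr0 expR0 mulr1 subrr mulr0.
  move=> r /andP[r0 rt] fr0.
  have rI : 0 < r <= t1 by rewrite r0 (le_trans rt).
  have df := left_deriveZ sg (left_deriveD (Qd _ rI)
    (left_deriveZ (- qc 0) (is_derive_left_derive (dexp r)))).
  apply: left_slope_leW (left_derive_le df).
  have -> : sg * (- c * qc r + - qc 0 * (- c * expR (- c * r))) = - c * f sg r.
    by rewrite /f; ring.
  by rewrite mulNr oppr_le0 mulr_ge0// ltW.
have := key 1; have := key (- 1); rewrite /f mul1r mulN1r oppr_le0 => H1 H2.
by apply/eqP; rewrite -subr_eq0 -mulNr eq_le H1 H2.
Unshelve. all: by end_near. Qed.

(* A flow whose input obeys the feedback law; the last fields are consequences
   of it, see [closed_loop_of_feedback]. *)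
Record closed_loop (alpha beta k D c sr Tm : R) (qc s : R -> R)
    (T Tx Txx Tt : R -> R -> R) : Prop := ClosedLoop {
  cl_flow : stefan_flow alpha beta k D Tm qc s T Tx Txx Tt;
  cl_D : 0 < D;
  cl_c : 0 < c;
  cl_law : control_law alpha beta k D c sr Tm qc T s;
  cl_past : integrable_on (- D) 0 qc;
  cl_adm : forall t1 : R, 0 < t1 -> admissible_upto t1 Tm s T;
  cl_cont : forall t : R, - D < t -> {for t, continuous qc};
  cl_exp : forall t : R, 0 <= t -> qc t = qc 0 * expR (- c * t);
  cl_qc0 : 0 < qc 0;
  cl_qc_ge0 : forall t : R, - D < t -> 0 <= qc t }.

(** * Positivity of input and interface for all times *)

Section Bootstrap.
Context (alpha beta k D Tm : R) (qc s : R -> R) (T Tx Txx Tt : R -> R -> R)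
  (sf : stefan_flow alpha beta k D Tm qc s T Tx Txx Tt).
Variables (c sr : R).
Hypotheses (D0 : 0 < D) (c0 : 0 < c) (ctrl : control_law alpha beta k D c sr Tm qc T s)
  (qi : integrable_on (- D) 0 qc) (q_past : assumption_A2 D qc) (q0 : 0 < qc 0)
  (s00 : 0 < s 0) (T0 : forall x : R, 0 <= x <= s 0 -> Tm <= T x 0).

(** Method of steps: a nonnegative input before [n * D] is a nonnegative flux for one delay longer.
    The flow is then admissible there, and the exponential law gives the sign of the input on the
    next interval. *)
Lemma qc_ge0_upto (t1 : R) n : (forall r : R, 0 <= r < t1 -> 0 < s r) ->
  forall t : R, - D < t -> t < n%:R * D -> t < t1 - D -> 0 <= qc t.
Proof.
move=> spos; elim: n => [|n IH] t Dt tn tt1.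
  by apply: q_past; rewrite Dt -(mul0r D).
have [t0|t0] := ltP t 0; first by apply: q_past; rewrite Dt.
(* Assumption A2 stops short of time 0, where the sign is supplied by [q0]. *)
move: t0; rewrite le_eqVlt => /orP[/eqP <-|t0]; first exact: ltW.
have tt : t < t1 by apply: lt_trans tt1 _; rewrite gtrBl.
have adm : admissible_upto t Tm s T.
  apply: (nonneg_flux_admissible sf t0) => //.
    by move=> r /andP[r0 rt]; apply: spos; rewrite r0 (le_lt_trans rt).
  move=> r /andP[r0 rt]; apply: IH.
  - by rewrite ltrBrDr addNr.
  - by rewrite ltrBlDr (le_lt_trans rt)// -[X in _ < _ + X]mul1r -mulrDl natr1.
  - by rewrite ltrD2r (le_lt_trans rt).
rewrite (closed_loop_input_ode sf D0 c0 ctrl qi _ adm) ?lexx ?(ltW t0)//.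
  by rewrite mulr_ge0 ?expR_ge0 ?ltW.
by move=> r Dr rt; apply: (qc_continuous sf spos Dr); exact: le_lt_trans tt1.
Qed.

Lemma qc_ge0_before (t1 t : R) : (forall r : R, 0 <= r < t1 -> 0 < s r) ->
  - D < t -> t < t1 - D -> 0 <= qc t.
Proof.
move=> spos Dt tt1; apply: (@qc_ge0_upto t1 (Num.bound `|t / D|)) => //.
rewrite -ltr_pdivrMr//; apply: le_lt_trans (ler_norm _) _.
exact: archi_boundP (normr_ge0 _).
Qed.

(** Up to a first collapse the flux is nonnegative, so the interface could not have receded from
    [s 0]. *)
Lemma interface_gt0 (t : R) : 0 <= t -> 0 < s t.
Proof.
move=> t0; rewrite ltNge; apply/negP => st0.
have [i [i0 si spos]] := first_nonpos sf s00 t0 st0.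
have : s 0 <= s i.
  apply: (interface_nondecreasing_pos sf i0 spos) => //; last exact: ltW.
  move=> r /andP[r0 ri]; apply: (qc_ge0_before spos); last by rewrite ltrD2r.
  by rewrite ltrBrDr addNr.
by rewrite leNgt (le_lt_trans si s00).
Qed.

Lemma closed_loop_of_feedback :
  closed_loop alpha beta k D c sr Tm qc s T Tx Txx Tt.
Proof.
have spos t1 r : 0 <= r < t1 -> 0 < s r by move=> /andP[r0 _]; exact: interface_gt0.
have qpos t : - D < t -> 0 <= qc t.
  by move=> Dt; apply: (@qc_ge0_before (t + D + 1) t (spos _) Dt); rewrite addrAC addrK ltrDl.
have adm t1 : 0 < t1 -> admissible_upto t1 Tm s T.
  move=> t10; apply: (nonneg_flux_admissible sf t10) => //.
    by move=> t /andP[t0 _]; exact: interface_gt0.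
  by move=> t /andP[t0 _]; apply: qpos; rewrite ltrBrDr addNr.
have qcont t : - D < t -> {for t, continuous qc}.
  move=> Dt; apply: (qc_continuous sf (spos (t + D + 1)) Dt).
  by rewrite addrAC addrK ltrDl.
split => // t; rewrite le_eqVlt => /orP[/eqP <-|t0]; first by rewrite mulr0 expR0 mulr1.
apply: (closed_loop_input_ode sf D0 c0 ctrl qi _ (adm _ t0)); last by rewrite lexx ltW.
by move=> r Dr _; exact: qcont.
Qed.

End Bootstrap.

End StefanFlow.

(** * The Dirichlet energy and its increments *)

Section Energy.
Variable R : realType.
Local Notation mu := (@lebesgue_measure R).

Lemma moving_integral_within (s : R -> R) (Dom : set (R * R)) (G : R -> R -> R) (a b : R) :
  0 <= a -> a <= b -> {within `[0, +oo[, continuous s} ->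
  (forall t : R, a <= t <= b -> 0 <= s t) ->
  (forall x t : R, a <= t <= b -> 0 <= x <= s t -> Dom (x, t)) ->
  {within Dom, continuous (fun p => G p.1 p.2)} ->
  {within `[a, b], continuous (fun t => \int[mu]_(x in `[0, s t]) G x t)}.
Proof.
move=> a0 ab cs s0 domE cG.
have cE := extend_continuous a0 ab cs s0 domE cG.
have csm : continuous (fun t => s (clampt a b t)).
  apply/continuous_subspace_setT; apply: (ctsin_comp (h := clampt a b) cs).
    by apply: continuous_subspaceT; exact: continuous_clampt.
  move=> t _ /=; rewrite in_itv/= andbT.
  by case/andP: (clampt_itv t ab) => /(le_trans a0).
have sm0 t : 0 <= s (clampt a b t) by apply: s0; exact: clampt_itv.
have := moving_integral_continuous csm sm0 cE.
move=> /(@continuous_subspaceT _ _ `[a, b]); apply: ctsin_eq => t /=.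
rewrite in_itv/= => tab; rewrite clampt_id//.
by apply: eq_Rintegral => x; rewrite inE/= in_itv/= => xs; rewrite extendE.
Qed.

Definition energy (s : R -> R) (Tx : R -> R -> R) (t : R) :=
  \int[mu]_(x in `[0, s t]) Tx x t ^+ 2.

Lemma energy_ge0 (s : R -> R) (Tx : R -> R -> R) t : 0 <= energy s Tx t.
Proof. by apply: Rintegral_ge0 => x _; exact: sqr_ge0. Qed.

(** The energy increment has a boundary term with the increment of [T 0], about which nothing is
    known. The subtracted product shifts the difference onto the flux, which is the given input. *)
Definition flux_energy (s : R -> R) (Tm : R) (T Tx : R -> R -> R) (t : R) :=
  energy s Tx t - 2 * (- Tx 0 t * (T 0 t - Tm)).

Lemma cl_s_gt0 `(cl : closed_loop alpha beta k D c sr Tm qc s T Tx Txx Tt)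
    (t : R) : 0 <= t -> 0 < s t.
Proof.
rewrite le_eqVlt => /orP[/eqP <-|t0]; last by apply: (s_gt0 (cl_adm cl t0)); rewrite lexx ltW.
by apply: (s_gt0 (cl_adm cl ltr01)); rewrite lexx ler01.
Qed.

Lemma cl_s_mono `(cl : closed_loop alpha beta k D c sr Tm qc s T Tx Txx Tt)
    (a b : R) : 0 <= a -> a <= b -> s a <= s b.
Proof.
move=> a0; rewrite le_eqVlt => /orP[/eqP -> //|ab].
apply: (s_mono (cl_adm cl (le_lt_trans a0 ab))) => //; exact: ltW.
Qed.

Lemma cl_T_ge `(cl : closed_loop alpha beta k D c sr Tm qc s T Tx Txx Tt)
    (x t : R) : 0 <= t -> 0 <= x <= s t -> Tm <= T x t.
Proof.
rewrite le_eqVlt => /orP[/eqP <-|t0].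
  by apply: (T_ge (cl_adm cl ltr01)); rewrite lexx ler01.
by apply: (T_ge (cl_adm cl t0)); rewrite lexx ltW.
Qed.

Lemma T_slice `(cl : closed_loop alpha beta k D c sr Tm qc s T Tx Txx Tt)
    (t : R) : 0 <= t -> {within `[0, s t], continuous (fun x => T x t - Tm)}.
Proof.
move=> t0; apply: ctsinB; last exact: ctsin_cst.
exact: liquid_slice_cont (T_cont (cl_flow cl)).
Qed.

Lemma Tx_slice `(cl : closed_loop alpha beta k D c sr Tm qc s T Tx Txx Tt)
    (t : R) : 0 < t -> {within `[0, s t], continuous (fun x => Tx x t)}.
Proof. by move=> t0; exact: liquid_pos_slice_cont (Tx_cont (cl_flow cl)). Qed.

Lemma Txx_slice `(cl : closed_loop alpha beta k D c sr Tm qc s T Tx Txx Tt)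
    (t : R) : 0 < t -> {within `[0, s t], continuous (fun x => Txx x t)}.
Proof. by move=> t0; exact: liquid_pos_slice_cont (Txx_cont (cl_flow cl)). Qed.

Lemma T_derive_shifted `(cl : closed_loop alpha beta k D c sr Tm qc s T Tx Txx Tt)
    (t x : R) : 0 < t -> 0 < x < s t ->
  is_derive x 1 (fun y => T y t - Tm) (Tx x t).
Proof.
move=> t0 xI; rewrite -[Tx x t]subr0.
exact: (is_deriveB (T_derive_x (cl_flow cl) t0 xI) (is_derive_cst Tm x 1)).
Qed.

Lemma T_H1_derivative `(cl : closed_loop alpha beta k D c sr Tm qc s T Tx Txx Tt)
    (t : R) : 0 < t ->
  H1_derivative 0 (s t) (fun x => T x t - Tm) (fun x => Tx x t).
Proof.
move=> t0; apply: classical_H1_derivative.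
- exact: ltW (cl_s_gt0 cl (ltW t0)).
- exact: (T_slice cl (ltW t0)).
- exact: (Tx_slice cl).
- by move=> x; exact: (T_derive_shifted cl).
Qed.

(* Convexity of the Dirichlet energy and integration by parts; comparing the
   times [r] and [t] directly avoids the derivative T_xt, which need not exist. *)
Lemma energy_increment_le `(cl : closed_loop alpha beta k D c sr Tm qc s T Tx Txx Tt)
    (r t : R) (g : R -> R) : 0 <= r -> r < t ->
  H1_derivative 0 (s r) (fun x => T x r - Tm) g ->
  energy s Tx t - \int[mu]_(x in `[0, s r]) g x ^+ 2 <=
  2 * (- Tx 0 t * (T 0 t - T 0 r)
       - (\int[mu]_(x in `[0, s t]) (Txx x t * (T x t - Tm))
          - \int[mu]_(x in `[0, s r]) (Txx x t * (T x r - Tm)))).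
Proof.
move=> r0 rt Hg.
have t0 : 0 < t by exact: le_lt_trans rt.
have sr0 := cl_s_gt0 cl r0; have st0 := cl_s_gt0 cl (ltW t0).
have srt : s r <= s t by apply: (cl_s_mono cl) => //; exact: ltW.
have [_ /square_integrableP[gi g2i] _] := Hg.
have cTx := Tx_slice cl t0; have cTxx := Txx_slice cl t0; have cT := T_slice cl (ltW t0).
have sub : `[0, s r] `<=` `[0, s t] by apply: subset_itv; rewrite bnd_simp.
have E1 : energy s Tx t = - Tx 0 t * (T 0 t - Tm) - \int[mu]_(x in `[0, s t]) (Txx x t * (T x t - Tm)).
  have := segment_IBP (ltW st0) cTxx cTx cTx cT
    (fun x xI => T_derive_xx (cl_flow cl) t0 xI) (fun x xI => T_derive_shifted cl t0 xI).
  rewrite (interface_eq (cl_flow cl) (ltW t0)) subrr mulr0 sub0r -mulNr => <-.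
  by apply: eq_Rintegral => x _; rewrite expr2.
have E2 : \int[mu]_(x in `[0, s r]) (g x * Tx x t) =
    - Tx 0 t * (T 0 r - Tm) - \int[mu]_(x in `[0, s r]) (Txx x t * (T x r - Tm)).
  have dTx (x : R) : 0 < x < s r -> is_derive x 1 (fun y => Tx y t) (Txx x t).
    move=> /andP[x0 xr]; apply: (T_derive_xx (cl_flow cl) t0); rewrite x0.
    exact: lt_le_trans srt.
  have := weak_IBP sr0 (T_slice cl r0) Hg (continuous_subspaceW sub cTx)
    (continuous_subspaceW sub cTxx) dTx.
  rewrite (interface_eq (cl_flow cl) r0) subrr mul0r sub0r => E.
  have -> : - Tx 0 t * (T 0 r - Tm) = - ((T 0 r - Tm) * Tx 0 t) by ring.
  rewrite -E; under [in RHS]eq_Rintegral do rewrite mulrC.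
  by rewrite addrAC subrr add0r.
have Tx2i b : b <= s t -> integrable_on 0 b (fun x => Tx x t ^+ 2).
  move=> bst; apply: (integrable_onS (lexx 0) bst).
  by apply: continuous_integrable_on; exact: ctsinX.
have gTxi : integrable_on 0 (s r) (fun x => g x * Tx x t).
  by apply: integrable_onM => //; exact: continuous_subspaceW cTx.
have E3 : 0 <= energy s Tx t - 2 * \int[mu]_(x in `[0, s r]) (g x * Tx x t)
    + \int[mu]_(x in `[0, s r]) g x ^+ 2.
  have : 0 <= \int[mu]_(x in `[0, s r]) (Tx x t - g x) ^+ 2.
    by apply: Rintegral_ge0 => x _; exact: sqr_ge0.
  have -> : \int[mu]_(x in `[0, s r]) (Tx x t - g x) ^+ 2 =
      \int[mu]_(x in `[0, s r]) (Tx x t ^+ 2 - 2 * (g x * Tx x t) + g x ^+ 2).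
    by apply: eq_Rintegral => x _; ring.
  rewrite RintegralD//; last by apply: integrable_onB; [exact: Tx2i|exact: integrable_onZ].
  rewrite RintegralB//; [|exact: Tx2i|exact: integrable_onZ].
  rewrite RintegralZl//; move/le_trans; apply; rewrite !lerD2r.
  rewrite /energy (integral_split (ltW sr0) srt (Tx2i _ (lexx _))) lerDl.
  by apply: Rintegral_ge0 => x _; exact: sqr_ge0.
move: E3; rewrite E2.
set A := \int[mu]_(x in `[0, s t]) _ in E1 *; set B := \int[mu]_(x in `[0, s r]) (_ * _).
by move: E1; clear; lra.
Qed.

(** Poincare inequality, integrating from the interface, where [T - Tm] vanishes. *)
Lemma temperature_sq_le `(cl : closed_loop alpha beta k D c sr Tm qc s T Tx Txx Tt)
    (t x : R) : 0 < t -> 0 <= x <= s t ->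
  (T x t - Tm) ^+ 2 <= s t * energy s Tx t.
Proof.
move=> t0 /andP[x0 xs].
have sub : `[x, s t] `<=` `[0, s t] by apply: subset_itv; rewrite bnd_simp.
have cTx := continuous_subspaceW sub (Tx_slice cl t0).
have cT := continuous_subspaceW sub (T_slice cl (ltW t0)).
have Tx2i : integrable_on 0 (s t) (fun x => Tx x t ^+ 2).
  by apply: continuous_integrable_on; apply: ctsinX; exact: (Tx_slice cl).
have dT (y : R) : x < y < s t -> is_derive y 1 (fun y => T y t - Tm) (Tx y t).
  move=> /andP[xy ys]; apply: (T_derive_shifted cl) => //.
  by rewrite (le_lt_trans x0 xy).
have := segment_FTC xs cTx cT dT.
rewrite (interface_eq (cl_flow cl) (ltW t0)) subrr sub0r => E.
rewrite -sqrrN -E.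
apply: le_trans (Cauchy_Schwarz_segment xs _ _) _.
- exact: continuous_integrable_on.
- by apply: continuous_integrable_on; exact: ctsinX.
apply: ler_pM; rewrite ?subr_ge0//.
- by apply: Rintegral_ge0 => y _; exact: sqr_ge0.
- by rewrite gerBl.
rewrite /energy (integral_split x0 xs Tx2i) lerDr.
by apply: Rintegral_ge0 => y _; exact: sqr_ge0.
Qed.

(** Poincare inequality for [Tx]; it need not vanish anywhere, so its value at [x = 0], known from
    the input, appears. *)
Lemma energy_le_Txx `(cl : closed_loop alpha beta k D c sr Tm qc s T Tx Txx Tt)
    (t : R) : 0 < t ->
  energy s Tx t <= 2 * s t * Tx 0 t ^+ 2 + 2 * s t ^+ 2 * \int[mu]_(x in `[0, s t]) Txx x t ^+ 2.
Proof.
move=> t0; have st0 := cl_s_gt0 cl (ltW t0).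
have Txx2i : integrable_on 0 (s t) (fun x => Txx x t ^+ 2).
  by apply: continuous_integrable_on; apply: ctsinX; exact: (Txx_slice cl).
set J := \int[mu]_(x in `[0, s t]) _.
apply: (@le_trans _ _ (\int[mu]_(x in `[0, s t]) (2 * Tx 0 t ^+ 2 + 2 * (s t * J)))).
  apply: segment_integral_le.
  - by apply: continuous_integrable_on; apply: ctsinX; exact: (Tx_slice cl).
  - exact: integrable_on_cst.
  move=> x /andP[x0 xs].
  have sub : `[0, x] `<=` `[0, s t] by apply: subset_itv; rewrite bnd_simp.
  have cTx := continuous_subspaceW sub (Tx_slice cl t0).
  have cTxx := continuous_subspaceW sub (Txx_slice cl t0).
  have dTx (y : R) : 0 < y < x -> is_derive y 1 (fun y => Tx y t) (Txx y t).
    move=> /andP[y0 yx]; apply: (T_derive_xx (cl_flow cl) t0).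
    by rewrite y0 (lt_le_trans yx xs).
  have := segment_FTC x0 cTxx cTx dTx.
  set I := \int[mu]_(y in `[0, x]) _ => E.
  have CS : I ^+ 2 <= s t * J.
    apply: le_trans (Cauchy_Schwarz_segment x0 _ _) _.
    - exact: continuous_integrable_on.
    - by apply: continuous_integrable_on; exact: ctsinX.
    apply: ler_pM; rewrite ?subr0//.
      by apply: Rintegral_ge0 => y _; exact: sqr_ge0.
    rewrite /J (integral_split x0 xs Txx2i) lerDl.
    by apply: Rintegral_ge0 => y _; exact: sqr_ge0.
  have -> : Tx x t = Tx 0 t + I by rewrite E; ring.
  have := sqr_ge0 (Tx 0 t - I).
  by move: CS; clear; rewrite !expr2; nra.
rewrite segment_integral_cst ?subr0; last exact: ltW.
by rewrite le_eqVlt; apply/orP; left; apply/eqP; ring.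
Qed.

Lemma flux_input `(cl : closed_loop alpha beta k D c sr Tm qc s T Tx Txx Tt)
    (t : R) : 0 < t -> - Tx 0 t = qc (t - D) / k.
Proof.
move=> t0; rewrite -(flux_eq (cl_flow cl) t0) mulNr mulrC mulrN mulKf//.
by rewrite gt_eqF// (k_gt0 (cl_flow cl)).
Qed.

Lemma flux_ge0 `(cl : closed_loop alpha beta k D c sr Tm qc s T Tx Txx Tt)
    (t : R) : 0 < t -> 0 <= - Tx 0 t.
Proof.
move=> t0; rewrite (flux_input cl)// divr_ge0 ?(ltW (k_gt0 (cl_flow cl)))//.
by apply: (cl_qc_ge0 cl); rewrite ltrBrDr addNr.
Qed.

Lemma energy_within `(cl : closed_loop alpha beta k D c sr Tm qc s T Tx Txx Tt)
    (a b : R) : 0 < a -> a <= b -> {within `[a, b], continuous (energy s Tx)}.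
Proof.
move=> a0 ab; apply: (@moving_integral_within _ (liquid_pos s)) => //.
- exact: ltW.
- exact: (s_cont (cl_flow cl)).
- by move=> t /andP[at' _]; apply: ltW; apply: (cl_s_gt0 cl); exact: le_trans (ltW a0) at'.
- by move=> x t /andP[at' _] xI; split => //=; exact: lt_le_trans at'.
- exact: ctsinX (Tx_cont (cl_flow cl)).
Qed.

Lemma T_boundary_within `(cl : closed_loop alpha beta k D c sr Tm qc s T Tx Txx Tt)
    (a b : R) : 0 <= a -> {within `[a, b], continuous (fun t => T 0 t - Tm)}.
Proof.
move=> a0; apply: ctsinB; last exact: ctsin_cst.
apply: (ctsin_comp (h := fun t => (0, t)) (T_cont (cl_flow cl))).
  apply: continuous_subspaceT => t.
  by apply: (@cvg_pair _ _ _ _ (nbhs 0) (nbhs t)); [exact: cvg_cst|exact: cvg_id].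
move=> t; rewrite /= in_itv/= => /andP[at' _].
have t0 := le_trans a0 at'; split => //=.
by rewrite lexx ltW// (cl_s_gt0 cl).
Qed.

(** In [energy_increment_le] the weight [Txx x t] is frozen at time [t], so [moment_left_derive]
    applies and the heat equation turns its derivative into dissipation. The variation of the flux
    is kept as a difference, since before [D] it has only a weak derivative to rely on. *)
Lemma flux_energy_increment `(cl : closed_loop alpha beta k D c sr Tm qc s T Tx Txx Tt)
    (t e : R) : 0 < t -> 0 < e ->
  \forall r \near t^'-, flux_energy s Tm T Tx t - flux_energy s Tm T Tx r <=
    2 * ((- Tx 0 r - - Tx 0 t) * (T 0 r - Tm))
    - (2 * alpha * \int[mu]_(x in `[0, s t]) Txx x t ^+ 2 - e) * (t - r).
Proof.
move=> t0 e0.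
have e2 : 0 < e / 2 by rewrite divr_gt0.
have dM := moment_left_derive (cl_flow cl) t0 (cl_adm cl t0) (Txx_slice cl t0) e2.
have ME : \int[mu]_(x in `[0, s t]) (Txx x t * Tt x t) =
    alpha * \int[mu]_(x in `[0, s t]) Txx x t ^+ 2.
  rewrite -RintegralZl//.
    apply: eq_Rintegral => x; rewrite inE/= in_itv/= => xI.
    by rewrite (heat_eq (cl_flow cl))//; ring.
  by apply: continuous_integrable_on; apply: ctsinX; exact: (Txx_slice cl).
rewrite ME in dM.
near=> r.
have rt : r < t by near: r; exact: nbhs_left_lt.
have r0 : 0 < r by near: r; exact: nbhs_left_gt.
have H1 := energy_increment_le cl (ltW r0) rt (T_H1_derivative cl r0).
have : `|\int[mu]_(x in `[0, s t]) (Txx x t * (T x t - Tm)) -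
    \int[mu]_(x in `[0, s r]) (Txx x t * (T x r - Tm)) -
    alpha * \int[mu]_(x in `[0, s t]) Txx x t ^+ 2 * (t - r)| <= e / 2 * (t - r).
  by near: r.
rewrite ler_norml => /andP[H2 _].
move: H1 H2; rewrite /flux_energy /energy.
set A := \int[mu]_(x in `[0, s t]) (_ * _); set B := \int[mu]_(x in `[0, s r]) (_ * _).
set E1 := \int[mu]_(x in `[0, s t]) (Tx x t ^+ 2).
set E2 := \int[mu]_(x in `[0, s r]) _; set J := \int[mu]_(x in `[0, s t]) _.
set M := alpha * J * (t - r) => H1 H2.
have -> : (2 * alpha * J - e) * (t - r) = 2 * M - e * (t - r) by rewrite /M; ring.
have K : - (e * (t - r)) <= 2 * (A - B - M).
  by move: H2; clear; lra.
move: H1 K; clear; lra.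
Unshelve. all: by end_near. Qed.

End Energy.

(** * The energy shortly after time 0 *)

Section InitialEnergy.
Variable R : realType.
Local Notation mu := (@lebesgue_measure R).

(* The initial temperature, extended by [Tm] beyond the initial interface. *)
Definition initial_temperature (s : R -> R) (Tm : R) (T : R -> R -> R) (x : R) :=
  T (Num.min x (s 0)) 0 - Tm.

(** From [p^2 - q^2 <= 2 p (p - q)], with the weight [p] frozen at time [t], the bound reduces to
    [moment_left_derive]. On the strip beyond [s r] the extended initial temperature is zero, and
    [p^2 <= 2 p^2] suffices. *)
Lemma deviation_left_slope `(cl : closed_loop alpha beta k D c sr Tm qc s T Tx Txx Tt) (t : R) :
  0 < t ->
  let u0 := initial_temperature s Tm T in
  left_slope_le (fun t => \int[mu]_(x in `[0, s t]) (T x t - Tm - u0 x) ^+ 2) t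
    (2 * (alpha * \int[mu]_(x in `[0, s t]) ((T x t - Tm - u0 x) * Txx x t))).
Proof.
move=> t0 u0.
have s0 := cl_s_gt0 cl (lexx 0).
have cu0 b : {within `[0, b], continuous u0}.
  apply: (ctsin_comp (h := fun x => Num.min x (s 0)) (T_slice cl (lexx 0))).
    apply: continuous_subspaceT => x.
    by apply: (@continuous_min R R id (cst (s 0))); [exact: cvg_id|exact: cvg_cst].
  move=> x; rewrite /= !in_itv/= => /andP[x0 _].
  by rewrite le_min x0 (ltW s0)/= ge_min lexx orbT.
pose p x := T x t - Tm - u0 x.
have cT := T_slice cl (ltW t0).
have cp : {within `[0, s t], continuous p} by exact: ctsinB.
have := moment_left_derive (cl_flow cl) t0 (cl_adm cl t0) cp.
have -> : \int[mu]_(x in `[0, s t]) (p x * Tt x t) =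
    alpha * \int[mu]_(x in `[0, s t]) (p x * Txx x t).
  rewrite -RintegralZl//.
    apply: eq_Rintegral => x; rewrite inE/= in_itv/= => xI.
    by rewrite (heat_eq (cl_flow cl))//; ring.
  by apply: continuous_integrable_on; apply: ctsinM => //; exact: (Txx_slice cl t0).
set J := alpha * _ => dM.
have d2M := left_derive_le (left_deriveZ 2 dM).
move=> e e0; near=> r.
have rt : r < t by near: r; exact: nbhs_left_lt.
have r0 : 0 < r by near: r; exact: nbhs_left_gt.
apply: (@le_trans _ _ (2 * (\int[mu]_(x in `[0, s t]) (p x * (T x t - Tm))) -
   2 * (\int[mu]_(x in `[0, s r]) (p x * (T x r - Tm))))); last by near: r; exact: d2M.
have sr0 := cl_s_gt0 cl (ltW r0); have st0 := cl_s_gt0 cl (ltW t0).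
have srt : s r <= s t by apply: (cl_s_mono cl) => //; exact: ltW.
have s0r : s 0 <= s r by apply: (cl_s_mono cl) => //; exact: ltW.
have sub : `[0, s r] `<=` `[0, s t] by apply: subset_itv; rewrite bnd_simp.
have cTr := T_slice cl (ltW r0).
have i1 : integrable_on 0 (s t) (fun x => p x * (T x t - Tm)).
  by apply: continuous_integrable_on; exact: ctsinM.
have i2 : integrable_on 0 (s r) (fun x => p x * (T x r - Tm)).
  by apply: continuous_integrable_on; apply: ctsinM => //; exact: continuous_subspaceW cp.
have i3 : integrable_on 0 (s t) (fun x => p x ^+ 2).
  by apply: continuous_integrable_on; exact: ctsinX.
have i4 : integrable_on 0 (s r) (fun x => (T x r - Tm - u0 x) ^+ 2).
  by apply: continuous_integrable_on; apply: ctsinX; exact: ctsinB.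
rewrite -/(p _).
rewrite (integral_split (ltW sr0) srt i1).
rewrite [X in X - _](integral_split (ltW sr0) srt i3).
have S (f : R -> R) : integrable_on 0 (s t) f -> integrable_on 0 (s r) f.
  exact: integrable_onS.
have S' (f : R -> R) : integrable_on 0 (s t) f -> integrable_on (s r) (s t) f.
  by apply: integrable_onS => //; exact: ltW.
have HA : \int[mu]_(x in `[0, s r]) p x ^+ 2 - \int[mu]_(x in `[0, s r]) (T x r - Tm - u0 x) ^+ 2 <=
    2 * (\int[mu]_(x in `[0, s r]) (p x * (T x t - Tm)) - \int[mu]_(x in `[0, s r]) (p x * (T x r - Tm))).
  rewrite -RintegralB//; last exact: S.
  rewrite -RintegralB//; last exact: S.
  rewrite -RintegralZl//; last by apply: integrable_onB => //; exact: S.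
  apply: segment_integral_le.
  - by apply: integrable_onB => //; exact: S.
  - by apply: integrable_onZ; apply: integrable_onB => //; exact: S.
  move=> x _; rewrite /p; have := sqr_ge0 (T x t - T x r).
  by rewrite !expr2; clear; nra.
have HB : \int[mu]_(x in `[s r, s t]) p x ^+ 2 <= 2 * \int[mu]_(x in `[s r, s t]) (p x * (T x t - Tm)).
  rewrite -RintegralZl//; last exact: S'.
  apply: segment_integral_le; [exact: S'|by apply: integrable_onZ; exact: S'|].
  move=> x /andP[sx _]; have -> : p x = T x t - Tm.
    by rewrite /p /u0 /initial_temperature (min_idPr (le_trans s0r sx)) (interface_eq (cl_flow cl))// subrr subr0.
  by rewrite -expr2; have := sqr_ge0 (T x t - Tm); clear; lra.
move: HA HB; clear.
set A := \int[mu]_(x in `[0, s r]) _; set B := \int[mu]_(x in `[0, s r]) _.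
set C := \int[mu]_(x in `[0, s r]) _; set C' := \int[mu]_(x in `[0, s r]) _.
set E := \int[mu]_(x in `[s r, s t]) _; set E' := \int[mu]_(x in `[s r, s t]) _.
lra.
Unshelve. all: by end_near. Qed.

(* Otherwise the L^2 distance to the initial temperature, which vanishes at
   t = 0, would decrease. *)
Lemma energy_near0 `(cl : closed_loop alpha beta k D c sr Tm qc s T Tx Txx Tt)
    (g : R -> R) (H d eta : R) :
  H1_derivative 0 (s 0) (fun x => T x 0 - Tm) g ->
  (forall t : R, - D < t -> qc t <= H) -> 0 < d -> 0 < eta ->
  exists t1, 0 < t1 < d /\ energy s Tx t1 <= \int[mu]_(x in `[0, s 0]) g x ^+ 2 + eta.
Proof.
move=> Hg qH d0 eta0; apply: contrapT => Hno.
have a0 := alpha_gt0 (cl_flow cl); have k0 := k_gt0 (cl_flow cl).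
have s0 := cl_s_gt0 cl (lexx 0).
set G := \int[mu]_(x in `[0, s 0]) g x ^+ 2 in Hno *.
have {}Hno t : 0 < t < d -> G + eta < energy s Tx t.
  move=> tI; rewrite ltNge; apply/negP => Et; apply: Hno.
  by exists t.
have H0 : 0 < H.
  by apply: lt_le_trans (cl_qc0 cl) (qH _ _); rewrite oppr_lt0 (cl_D cl).
(* With the flux at most [H / k], the boundary term then stays below [eta / 4]. *)
pose nu := eta * k / (4 * H).
have nu0 : 0 < nu by rewrite divr_gt0 ?mulr_gt0.
have [_ + _] := (continuous_within_itvP _ d0).1 (T_boundary_within cl (b := d) (lexx 0)).
move=> /cvgrPdist_le/(_ _ nu0)[d' /= d'0 Hd'].
pose tau := Num.min (d / 2) (d' / 2).
have tau0 : 0 < tau by rewrite lt_min !divr_gt0.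
have [taud taud'] : tau < d /\ tau < d'.
  have : tau <= d / 2 by rewrite ge_min lexx.
  have : tau <= d' / 2 by rewrite ge_min lexx orbT.
  by move: d0 d'0; clear; split; lra.
pose u0 := initial_temperature s Tm T.
pose W t := \int[mu]_(x in `[0, s t]) (T x t - Tm - u0 x) ^+ 2.
have u0_in x : 0 <= x <= s 0 -> u0 x = T x 0 - Tm.
  by move=> /andP[_ xs]; rewrite /u0 /initial_temperature (min_idPl xs).
have u0_out x : s 0 <= x -> u0 x = 0.
  by move=> xs; rewrite /u0 /initial_temperature (min_idPr xs) (interface_eq (cl_flow cl))// subrr.
have W0 : W 0 = 0.
  rewrite /W (@eq_Rintegral _ _ _ _ _ (fun=> 0)) ?Rintegral_cst ?mul0r//.
  by move=> x; rewrite inE/= in_itv/= => /u0_in ->; rewrite subrr expr0n.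
(* An energy excess [eta] makes the slope of [W] at most [- alpha * eta / 2], so [phi] cannot
   increase; but [W >= 0] makes it positive at [tau]. *)
pose phi t := W t + alpha * eta / 2 * t.
suff : phi tau <= 0.
  apply/negP; rewrite -ltNge /phi ltr_wpDl//.
    by apply: Rintegral_ge0 => x _; exact: sqr_ge0.
  by rewrite !mulr_gt0 ?divr_gt0 ?mulr_gt0.
apply: (left_slope_comparison (ltW tau0)).
- apply: ctsinD; last by apply: ctsinM; [exact: ctsin_cst|exact: ctsin_id].
  apply: (@moving_integral_within _ _ (liquid s) (fun x t => (T x t - Tm - u0 x) ^+ 2)) => //.
  + exact: ltW.
  + exact: (s_cont (cl_flow cl)).
  + by move=> t /andP[t0 _]; apply: ltW; exact: (cl_s_gt0 cl).
  + by move=> x t /andP[t0 _] xI; split.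
  + apply: ctsinX; apply: ctsinB.
      by apply: ctsinB; [exact: (T_cont (cl_flow cl))|exact: ctsin_cst].
    apply: (ctsin_comp (h := fun p : R * R => Num.min p.1 (s 0)) (T_slice cl (lexx 0))).
      apply: continuous_subspaceT => p.
      by apply: (@continuous_min R _ (fun p : R * R => p.1) (cst (s 0))); [exact: cvg_fst|exact: cvg_cst].
    move=> p [_ /andP[p0 _]]; rewrite /= in_itv/=.
    by rewrite le_min p0 (ltW s0)/= ge_min lexx orbT.
- by rewrite /phi W0 mulr0 addr0.
move=> t /andP[t0 ttau] _.
have td : t < d by exact: le_lt_trans taud.
have dW := deviation_left_slope cl t0.
have dlin : is_derive t 1 (fun t => alpha * eta / 2 * t) (alpha * eta / 2 * 1).
  exact: (is_deriveZ (alpha * eta / 2) (is_derive_id t 1)).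
apply: left_slope_leW (left_slope_leD dW (left_derive_le (is_derive_left_derive dlin))).
rewrite -/u0; set J := \int[mu]_(x in `[0, s t]) _.
have E1 := energy_increment_le cl (lexx 0) t0 Hg.
have st0 := cl_s_gt0 cl (ltW t0).
have s0t : s 0 <= s t by apply: (cl_s_mono cl) => //; exact: ltW.
have cTxx := Txx_slice cl t0.
have cu0 : {within `[0, s t], continuous u0}.
  apply: (ctsin_comp (h := fun x => Num.min x (s 0)) (T_slice cl (lexx 0))).
    apply: continuous_subspaceT => x.
    by apply: (@continuous_min R R id (cst (s 0))); [exact: cvg_id|exact: cvg_cst].
  move=> x; rewrite /= !in_itv/= => /andP[x0 _].
  by rewrite le_min x0 (ltW s0)/= ge_min lexx orbT.
have i1 : integrable_on 0 (s t) (fun x => Txx x t * (T x t - Tm)).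
  by apply: continuous_integrable_on; apply: ctsinM => //; exact: (T_slice cl (ltW t0)).
have i2 : integrable_on 0 (s t) (fun x => Txx x t * u0 x).
  by apply: continuous_integrable_on; exact: ctsinM.
have JE : J = \int[mu]_(x in `[0, s t]) (Txx x t * (T x t - Tm)) -
    \int[mu]_(x in `[0, s 0]) (Txx x t * (T x 0 - Tm)).
  have -> : \int[mu]_(x in `[0, s 0]) (Txx x t * (T x 0 - Tm)) = \int[mu]_(x in `[0, s t]) (Txx x t * u0 x).
    rewrite [RHS](integral_split (ltW s0) s0t i2).
    rewrite [X in _ = _ + X](@eq_Rintegral _ _ _ _ _ (fun=> 0)); last first.
      by move=> x; rewrite inE/= in_itv/= => /andP[/u0_out -> _]; rewrite mulr0.
    rewrite Rintegral_cst// mul0r addr0.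
    by apply: eq_Rintegral => x; rewrite inE/= in_itv/= => /u0_in ->.
  rewrite -RintegralB//; apply: eq_Rintegral => x _; ring.
rewrite -JE -/G in E1.
have Et : G + eta < energy s Tx t by apply: Hno; rewrite t0.
have ht0 := flux_ge0 cl t0.
have hH : - Tx 0 t <= H / k.
  rewrite (flux_input cl t0) ler_pM2r ?invr_gt0//; apply: qH.
  by rewrite ltrBrDr addNr.
have Hu : T 0 t - T 0 0 <= nu.
  have := Hd' t; rewrite /= sub0r normrN (gtr0_norm t0) => /(_ (le_lt_trans ttau taud') t0).
  rewrite distrC => /(le_trans (ler_norm _)); apply: le_trans.
  by rewrite le_eqVlt; apply/orP; left; apply/eqP; ring.
have hu : - Tx 0 t * (T 0 t - T 0 0) <= eta / 4.
  apply: (@le_trans _ _ (H / k * nu)).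
    apply: (@le_trans _ _ (- Tx 0 t * nu)); first exact: ler_wpM2l.
    by apply: ler_wpM2r => //; exact: ltW.
  by rewrite /nu le_eqVlt; apply/orP; left; apply/eqP; field; rewrite !gt_eqF.
have J0 : 2 * J <= - (eta / 2) by move: E1 Et hu; clear; lra.
have := ler_wpM2l (ltW a0) J0; clear; lra.
Qed.

End InitialEnergy.

(** * Energy bounds up to one delay and beyond it *)

Section EnergyDecay.
Variable R : realType.
Local Notation mu := (@lebesgue_measure R).

Lemma flux_T_within `(cl : closed_loop alpha beta k D c sr Tm qc s T Tx Txx Tt) (a b : R) :
  0 < a -> {within `[a, b], continuous (fun t => - Tx 0 t * (T 0 t - Tm))}.
Proof.
move=> a0; apply: ctsinM; last exact: (T_boundary_within cl (ltW a0)).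
apply: (@ctsin_eq _ _ _ (fun t => qc (t - D) / k)).
  by move=> t; rewrite /= in_itv/= => /andP[at' _]; rewrite (flux_input cl)//; exact: lt_le_trans at'.
apply: ctsinM; last exact: ctsin_cst.
apply: continuous_within => t /andP[at' _].
have Dt : - D < t - D by rewrite ltrBrDr addNr; exact: lt_le_trans at'.
have cD : {for t, continuous (fun t => t - D)}.
  by apply: cvgB; [exact: cvg_id|exact: cvg_cst].
exact: (cvg_comp _ _ cD (cl_cont cl Dt)).
Qed.

Lemma flux_energy_within `(cl : closed_loop alpha beta k D c sr Tm qc s T Tx Txx Tt) (a b : R) :
  0 < a -> a <= b -> {within `[a, b], continuous (flux_energy s Tm T Tx)}.
Proof.
move=> a0 ab; apply: ctsinB; first exact: (energy_within cl).
apply: ctsinM; first exact: ctsin_cst.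
exact: (flux_T_within cl).
Qed.

Lemma T_boundary_sq_le `(cl : closed_loop alpha beta k D c sr Tm qc s T Tx Txx Tt) (L t : R) :
  s t <= L -> 0 < t -> (T 0 t - Tm) ^+ 2 <= L * energy s Tx t.
Proof.
move=> sL t0; apply: le_trans (temperature_sq_le cl t0 (x := 0) _) _.
  by rewrite lexx ltW// (cl_s_gt0 cl)// ltW.
by apply: ler_wpM2r => //; exact: energy_ge0.
Qed.

Lemma T_boundary_ge0 `(cl : closed_loop alpha beta k D c sr Tm qc s T Tx Txx Tt) (t : R) :
  0 <= t -> 0 <= T 0 t - Tm.
Proof.
move=> t0; rewrite subr_ge0; apply: (cl_T_ge cl t0).
by rewrite lexx ltW// (cl_s_gt0 cl).
Qed.

(* Up to time [D] the flux is the past input; its variation is controlled by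
   the increments of [P]. *)
Lemma energy_short `(cl : closed_loop alpha beta k D c sr Tm qc s T Tx Txx Tt)
    (g P : R -> R) (L H V : R) :
  H1_derivative 0 (s 0) (fun x => T x 0 - Tm) g ->
  0 < L -> (forall t : R, 0 <= t -> s t <= L) ->
  (forall t : R, - D < t -> qc t <= H) ->
  (forall a b : R, - D < a -> a <= b -> b <= 0 -> `|qc b - qc a| <= P b - P a <= V) ->
  (forall a : R, - D < a -> {within `[a, 0], continuous P}) ->
  forall t : R, 0 < t <= D ->
    energy s Tx t <= 2 * \int[mu]_(x in `[0, s 0]) g x ^+ 2 + 4 * L * ((H + V) / k) ^+ 2.
Proof.
move=> Hg L0 sL qH PV cP t /andP[t0 tD].
have k0 := k_gt0 (cl_flow cl).
apply/ler_addgt0Pr => eta eta0.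
have eta2 : 0 < eta / 2 by rewrite divr_gt0.
(* The energy is continuous at positive times only, so the comparison starts at a small [t1]. The
   slack is [eta / 2] because the final absorption doubles it. *)
have [t1 [/andP[t10 t1t] Et1]] := energy_near0 cl Hg qH t0 eta2.
have t1D : t1 <= D by exact: ltW (lt_le_trans t1t tD).
have cE := energy_within cl t10 t1D.
have [tm /[!in_itv]/= /andP[t1m mD] tmax] := EVT_max t1D cE.
have tm0 : 0 < tm by exact: lt_le_trans t1m.
set Em := energy s Tx tm in tmax *.
have Em0 : 0 <= Em by exact: energy_ge0.
(* A bound for [T 0 - Tm] on all of [[t1, D]] in terms of the maximal energy; it enters the final
   estimate linearly, so it can be absorbed. *)
pose U := Num.sqrt (L * Em).
have U2 : U ^+ 2 = L * Em by rewrite sqr_sqrtr// mulr_ge0// ltW.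
have U0 : 0 <= U by exact: sqrtr_ge0.
have uU r : t1 <= r <= D -> 0 <= T 0 r - Tm <= U.
  move=> /andP[t1r rD]; have r0 : 0 < r by exact: lt_le_trans t1r.
  rewrite (T_boundary_ge0 cl (ltW r0))/=.
  rewrite -(ler_pXn2r (n := 2)) ?nnegrE ?(T_boundary_ge0 cl (ltW r0))// U2.
  apply: le_trans (T_boundary_sq_le cl (sL _ (ltW r0)) r0) _.
  by apply: ler_wpM2l; [exact: ltW|apply: tmax; rewrite in_itv/= t1r].
have DtD r : 0 < r -> - D < r - D by move=> r0; rewrite ltrBrDr addNr.
(* the flux energy, corrected by the variation of the flux, decreases *)
have FE : flux_energy s Tm T Tx tm <= flux_energy s Tm T Tx t1 + 2 * U * V / k.
  pose phi r := (flux_energy s Tm T Tx r - flux_energy s Tm T Tx t1)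
    - 2 * U / k * (P (r - D) - P (t1 - D)).
  have : phi tm <= 0.
    apply: (left_slope_comparison t1m).
    - apply: ctsinB.
        by apply: ctsinB; [exact: (flux_energy_within cl t10)|exact: ctsin_cst].
      apply: ctsinM; first exact: ctsin_cst.
      apply: ctsinB; last exact: ctsin_cst.
      apply: (ctsin_comp (h := fun r => r - D) (cP _ (DtD _ t10))).
        by apply: ctsinB; [exact: ctsin_id|exact: ctsin_cst].
      move=> r; rewrite /= !in_itv/= => /andP[t1r rtm].
      by rewrite lerD2r t1r subr_le0 (le_trans rtm).
    - by rewrite /phi !subrr mulr0 subrr.
    move=> r /andP[t1r rtm] _ e e0.
    have r0 : 0 < r by exact: lt_trans t1r.
    near=> z.
    have zr : z < r by near: z; exact: nbhs_left_lt.
    have t1z : t1 < z by near: z; exact: nbhs_left_gt.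
    have z0 : 0 < z by exact: lt_trans t1z.
    have : flux_energy s Tm T Tx r - flux_energy s Tm T Tx z <=
      2 * ((- Tx 0 z - - Tx 0 r) * (T 0 z - Tm))
      - (2 * alpha * \int[mu]_(x in `[0, s r]) Txx x r ^+ 2 - e) * (r - z).
      by near: z; exact: (flux_energy_increment cl).
    have J0 : 0 <= 2 * alpha * \int[mu]_(x in `[0, s r]) Txx x r ^+ 2.
      rewrite mulr_ge0 ?mulr_ge0 ?(ltW (alpha_gt0 (cl_flow cl)))//.
      by apply: Rintegral_ge0 => x _; exact: sqr_ge0.
    have rz0 : 0 < r - z by rewrite subr_gt0.
    have /andP[u0 uz] : 0 <= T 0 z - Tm <= U.
      by apply: uU; rewrite (ltW t1z) (le_trans (ltW zr)) ?(le_trans rtm).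
    have hP : - Tx 0 z - - Tx 0 r <= (P (r - D) - P (z - D)) / k.
      rewrite !(flux_input cl)// -mulrBl ler_pM2r ?invr_gt0//.
      have /andP[+ _] : `|qc (r - D) - qc (z - D)| <= P (r - D) - P (z - D) <= V.
        apply: PV; first exact: DtD.
          by rewrite lerD2r ltW.
        by rewrite subr_le0 (le_trans rtm).
      by rewrite distrC; apply: le_trans; exact: ler_norm.
    have P0 : 0 <= (P (r - D) - P (z - D)) / k.
      rewrite divr_ge0 ?(ltW k0)//.
      have /andP[+ _] : `|qc (r - D) - qc (z - D)| <= P (r - D) - P (z - D) <= V.
        apply: PV; first exact: DtD.
          by rewrite lerD2r ltW.
        by rewrite subr_le0 (le_trans rtm).
      by apply: le_trans.
    have hu : (- Tx 0 z - - Tx 0 r) * (T 0 z - Tm) <= (P (r - D) - P (z - D)) / k * U.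
      apply: (@le_trans _ _ ((P (r - D) - P (z - D)) / k * (T 0 z - Tm))).
        exact: ler_wpM2r.
      exact: ler_wpM2l.
    have J1 : 0 <= 2 * alpha * (\int[mu]_(x in `[0, s r]) Txx x r ^+ 2) * (r - z).
      by rewrite mulr_ge0// ltW.
    rewrite /phi add0r => HV.
    have -> : flux_energy s Tm T Tx r - flux_energy s Tm T Tx t1 -
      2 * U / k * (P (r - D) - P (t1 - D)) -
      (flux_energy s Tm T Tx z - flux_energy s Tm T Tx t1 - 2 * U / k * (P (z - D) - P (t1 - D)))
      = flux_energy s Tm T Tx r - flux_energy s Tm T Tx z - 2 * ((P (r - D) - P (z - D)) / k * U).
      by ring.
    move: HV hu J1; rewrite mulrBl; clear; lra.
  rewrite /phi lerBlDr add0r lerBlDr addrC => /le_trans; apply.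
  rewrite lerD2l; have -> : 2 * U * V / k = 2 * U / k * V by ring.
  apply: ler_wpM2l; first by rewrite divr_ge0 ?(ltW k0)// mulr_ge0.
  have /andP[_] : `|qc (tm - D) - qc (t1 - D)| <= P (tm - D) - P (t1 - D) <= V.
    apply: PV; first exact: DtD.
      by rewrite lerD2r.
    by rewrite subr_le0.
  by [].
have h1 : 0 <= 2 * (- Tx 0 t1 * (T 0 t1 - Tm)).
  rewrite mulr_ge0// mulr_ge0 ?(flux_ge0 cl)//.
  by apply: (T_boundary_ge0 cl); exact: ltW.
have hm : - Tx 0 tm * (T 0 tm - Tm) <= H / k * U.
  have /andP[? ?] := uU tm (introT andP (conj t1m mD)).
  apply: ler_pM => //; first exact: (flux_ge0 cl).
  rewrite (flux_input cl)// ler_pM2r ?invr_gt0//; apply: qH; exact: DtD.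
have key : Em <= energy s Tx t1 + 2 * U * ((H + V) / k).
  move: FE h1 hm; rewrite /flux_energy -/Em.
  have -> : 2 * U * ((H + V) / k) = 2 * (H / k * U) + 2 * U * V / k by ring.
  clear; lra.
(* Young's inequality, weighted so that exactly half of the maximal energy goes to the left side. *)
have young : 2 * U * ((H + V) / k) <= Em / 2 + 2 * L * ((H + V) / k) ^+ 2.
  set Z := (H + V) / k.
  have Y : 0 <= (U - 2 * L * Z) ^+ 2 / (2 * L) by rewrite divr_ge0 ?sqr_ge0// mulr_ge0 ?(ltW L0).
  have : (U - 2 * L * Z) ^+ 2 / (2 * L) = Em / 2 + 2 * L * Z ^+ 2 - 2 * U * Z.
    rewrite (_ : Em = U ^+ 2 / L); last by rewrite U2 mulrC mulKf ?gt_eqF.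
    by field; rewrite gt_eqF.
  by move=> E; rewrite E subr_ge0 in Y.
have EtEm : energy s Tx t <= Em by apply: tmax; rewrite in_itv/= ltW.
move: key young EtEm Et1; set Z2 := ((H + V) / k) ^+ 2; set Z1 := 2 * U * _; clear.
have -> : 4 * L * Z2 = 2 * (2 * L * Z2) by ring.
lra.
Unshelve. all: by end_near. Qed.

Lemma is_derive_expR_lin (a b t : R) :
  is_derive t 1 (fun r => expR (a * (r - b))) (a * expR (a * (t - b))).
Proof.
have E r : a * (r - b) = a * r + - (a * b) by ring.
rewrite E; under eq_fun do rewrite E.
by apply: is_derive_shift_scale; exact: is_derive_expR.
Qed.

Lemma flux_late `(cl : closed_loop alpha beta k D c sr Tm qc s T Tx Txx Tt) (t : R) :
  D <= t -> - Tx 0 t = qc 0 / k * expR (- c * (t - D)).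
Proof.
move=> Dt; have t0 : 0 < t by exact: lt_le_trans (cl_D cl) Dt.
by rewrite (flux_input cl t0) (cl_exp cl) ?subr_ge0// mulrAC.
Qed.

(** Beyond [D] the flux h is exponential, and [e^x >= 1 + x] gives [h r - h t <= c * (t - r) * h r].
    Continuity of the product with [T 0 - Tm] moves its value from [r] to [t]. *)
Lemma flux_energy_late_slope `(cl : closed_loop alpha beta k D c sr Tm qc s T Tx Txx Tt) (t : R) :
  D < t -> left_slope_le (flux_energy s Tm T Tx) t
    (2 * c * (- Tx 0 t * (T 0 t - Tm)) - 2 * alpha * \int[mu]_(x in `[0, s t]) Txx x t ^+ 2).
Proof.
move=> Dt e e0.
have D0 := cl_D cl; have c0 := cl_c cl; have t0 : 0 < t by exact: lt_trans Dt.
have e2 : 0 < e / 2 by rewrite divr_gt0.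
have ec : 0 < e / 2 / (2 * c) by rewrite divr_gt0// mulr_gt0.
have [_ _ +] := (continuous_within_itvP _ Dt).1 (flux_T_within cl (b := t) D0).
move=> /cvgrPdist_le/(_ _ ec) Hhu.
near=> r.
have rt : r < t by near: r; exact: nbhs_left_lt.
have Dr : D < r by near: r; exact: nbhs_left_gt.
have r0 : 0 < r by exact: lt_trans Dr.
have HV : flux_energy s Tm T Tx t - flux_energy s Tm T Tx r <=
    2 * ((- Tx 0 r - - Tx 0 t) * (T 0 r - Tm))
    - (2 * alpha * \int[mu]_(x in `[0, s t]) Txx x t ^+ 2 - e / 2) * (t - r).
  by near: r; exact: (flux_energy_increment cl).
have : `|- Tx 0 t * (T 0 t - Tm) - (- Tx 0 r * (T 0 r - Tm))| <= e / 2 / (2 * c).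
  by near: r.
rewrite distrC => /(le_trans (ler_norm _)) hur.
have tr0 : 0 < t - r by rewrite subr_gt0.
have h0 := flux_ge0 cl r0.
have u0 := T_boundary_ge0 cl (ltW r0).
have hd : - Tx 0 r - - Tx 0 t <= c * (t - r) * - Tx 0 r.
  have -> : - Tx 0 t = - Tx 0 r * expR (- (c * (t - r))).
    rewrite (flux_late cl (ltW Dt)) (flux_late cl (ltW Dr)) -[RHS]mulrA -expRD; congr (_ * expR _); ring.
  have := expR_ge1Dx (- (c * (t - r))) => E.
  have := ler_wpM2l h0 E.
  clear; lra.
have hdu := ler_wpM2r u0 hd.
have hur' : 2 * c * (- Tx 0 r * (T 0 r - Tm)) <= 2 * c * (- Tx 0 t * (T 0 t - Tm)) + e / 2.
  have c2 : 0 <= 2 * c by rewrite mulr_ge0// ltW.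
  have := ler_wpM2l c2 hur.
  rewrite [X in _ <= X -> _]mulrC divfK; last by rewrite gt_eqF// mulr_gt0.
  by rewrite mulrBr lerBlDl.
have hur2 := ler_wpM2r (ltW tr0) hur'.
move: HV hdu hur2.
set J := \int[mu]_(x in _) _; clear; lra.
Unshelve. all: by end_near. Qed.

(** Gronwall argument for [flux_energy] with a forcing proportional to the squared flux, which
    decays at rate [2 * c]; the condition [b <= c] avoids resonance. *)
Lemma energy_long `(cl : closed_loop alpha beta k D c sr Tm qc s T Tx Txx Tt) (L b : R) :
  0 < L -> (forall t : R, 0 <= t -> s t <= L) ->
  0 < b -> b <= c -> b <= alpha / (2 * L ^+ 2) ->
  forall t : R, D <= t ->
    energy s Tx t <= (2 * energy s Tx D +
      (2 * (2 * alpha / L + 2 * L ^+ 3 * c ^+ 2 / alpha) / c + 4 * L) * (qc 0 / k) ^+ 2)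
      * expR (- b * (t - D)).
Proof.
move=> L0 sL b0 bc bg t Dt.
have D0 := cl_D cl; have c0 := cl_c cl.
have a0 := alpha_gt0 (cl_flow cl).
set C2 := 2 * alpha / L + _; set h0 := qc 0 / k.
have C20 : 0 < C2 by rewrite addr_gt0// divr_gt0// !mulr_gt0// exprn_gt0.
have cb0 : 0 < 2 * c - b by move: c0 bc; clear; lra.
(* Makes [Z] below the solution of [Z' = - b Z + C2 h0^2 e^(- 2 c (t - D))] that equals the energy
   at time [D]. *)
pose B := C2 * h0 ^+ 2 / (2 * c - b).
have B0 : 0 <= B by rewrite divr_ge0 ?(ltW cb0)// mulr_ge0 ?sqr_ge0 ?(ltW C20).
pose A := energy s Tx D + B.
pose Z r := A * expR (- b * (r - D)) - B * expR (- (2 * c) * (r - D)).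
(* The dissipation controls the energy at rate [alpha / L ^+ 2]; half of it is spent on the boundary
   term, which explains the factor 2 in the bound on [b]. *)
have young r : 0 < r ->
   2 * c * (- Tx 0 r * (T 0 r - Tm)) - 2 * alpha * \int[mu]_(x in `[0, s r]) Txx x r ^+ 2
   <= - (alpha / (2 * L ^+ 2)) * energy s Tx r + C2 * (- Tx 0 r) ^+ 2.
  move=> r0; have sr0 := cl_s_gt0 cl (ltW r0); have srL := sL _ (ltW r0).
  have u2 := T_boundary_sq_le cl srL r0.
  have E0 := energy_ge0 s Tx r.
  have := energy_le_Txx cl r0.
  move: u2 E0; set E := energy s Tx r; set u := T 0 r - Tm; set h := - Tx 0 r.
  have -> : Tx 0 r ^+ 2 = h ^+ 2 by rewrite /h sqrrN.
  have : 0 <= \int[mu]_(x in `[0, s r]) Txx x r ^+ 2.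
    by apply: Rintegral_ge0 => x _; exact: sqr_ge0.
  set J := \int[mu]_(x in _) _ => J0 u2 E0 EJ.
  have EJ' : E <= 2 * L * h ^+ 2 + 2 * L ^+ 2 * J.
    apply: le_trans EJ _; apply: lerD.
      by apply: ler_wpM2r; [exact: sqr_ge0|rewrite ler_pM2l].
    apply: ler_wpM2r => //; rewrite ler_pM2l// ler_sqr ?nnegrE//; exact: ltW.
  have J1 : alpha / L ^+ 2 * (E - 2 * L * h ^+ 2) <= 2 * alpha * J.
    have -> : 2 * alpha * J = alpha / L ^+ 2 * (2 * L ^+ 2 * J).
      by field; rewrite gt_eqF.
    by apply: ler_wpM2l; [rewrite divr_ge0 ?exprn_ge0 ?ltW|rewrite lerBlDl].
  have Y : 2 * c * (h * u) <= alpha / (2 * L ^+ 2) * (u ^+ 2 / L) + 2 * L ^+ 3 * c ^+ 2 / alpha * h ^+ 2.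
    rewrite -subr_ge0.
    have -> : alpha / (2 * L ^+ 2) * (u ^+ 2 / L) + 2 * L ^+ 3 * c ^+ 2 / alpha * h ^+ 2 - 2 * c * (h * u) =
      (alpha * u - 2 * L ^+ 3 * c * h) ^+ 2 / (2 * L ^+ 3 * alpha).
      by field; rewrite !gt_eqF.
    by rewrite divr_ge0 ?sqr_ge0// !mulr_ge0 ?exprn_ge0// ltW.
  have Y2 : alpha / (2 * L ^+ 2) * (u ^+ 2 / L) <= alpha / (2 * L ^+ 2) * E.
    apply: ler_wpM2l; first by rewrite divr_ge0 ?mulr_ge0 ?exprn_ge0 ?ltW.
    by rewrite ler_pdivrMr// mulrC.
  have EQ : - (alpha / (2 * L ^+ 2)) * E + C2 * h ^+ 2 =
     alpha / (2 * L ^+ 2) * E + 2 * L ^+ 3 * c ^+ 2 / alpha * h ^+ 2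
     - alpha / L ^+ 2 * (E - 2 * L * h ^+ 2).
    by rewrite /C2; field; rewrite !gt_eqF.
  rewrite EQ; move: Y Y2 J1; clear; lra.
have hu_ge0 r : 0 < r -> 0 <= - Tx 0 r * (T 0 r - Tm).
  by move=> r0; rewrite mulr_ge0 ?(flux_ge0 cl)//; apply: (T_boundary_ge0 cl); exact: ltW.
have VZ : flux_energy s Tm T Tx t - Z t <= 0.
  apply: (left_slope_comparison (f := fun t => flux_energy s Tm T Tx t - Z t) Dt).
  - apply: ctsinB; first exact: (flux_energy_within cl).
    apply: continuous_within => r _.
    have d1 := is_deriveZ A (is_derive_expR_lin (- b) D r).
    have d2 := is_deriveZ B (is_derive_expR_lin (- (2 * c)) D r).
    exact: is_derive_continuous (is_deriveB d1 d2).
  - rewrite /Z subrr !mulr0 expR0 !mulr1 /A addrK subr_le0 /flux_energy gerBl.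
    by rewrite mulr_ge0// hu_ge0.
  move=> r /andP[Dr rt] VZ0.
  have r0 : 0 < r by exact: lt_trans Dr.
  have d1 := is_deriveZ (- A) (is_derive_expR_lin (- b) D r).
  have d2 := is_deriveZ B (is_derive_expR_lin (- (2 * c)) D r).
  have dZ := left_derive_le (is_derive_left_derive (is_deriveD d1 d2)).
  have dV := flux_energy_late_slope cl Dr.
  have := left_slope_leD dV dZ.
  have -> : (fun x => flux_energy s Tm T Tx x +
      (- A \*: (fun r0 => expR (- b * (r0 - D))) + B \*: (fun r0 => expR (- (2 * c) * (r0 - D)))) x) =
      (fun x => flux_energy s Tm T Tx x - Z x).
    apply/funext => x; congr (_ + _); by rewrite /Z opprB [RHS]addrC -(mulNr A).
  apply: left_slope_leW; rewrite /GRing.scale/=.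
  have Yr := young r r0.
  have E0 := energy_ge0 s Tx r.
  have hE : (- Tx 0 r) ^+ 2 = h0 ^+ 2 * expR (- (2 * c) * (r - D)).
    rewrite (flux_late cl (ltW Dr)) -/h0 exprMn; congr (_ * _).
    by rewrite expr2 -expRD; congr expR; ring.
  rewrite hE in Yr.
  have BE : C2 * (h0 ^+ 2 * expR (- (2 * c) * (r - D))) = (2 * c - b) * (B * expR (- (2 * c) * (r - D))).
    by rewrite /B; field; rewrite gt_eqF.
  rewrite BE in Yr.
  have VE : flux_energy s Tm T Tx r <= energy s Tx r.
    by rewrite /flux_energy gerBl mulr_ge0// hu_ge0.
  have bE := ler_wpM2r E0 bg.
  have bV := ler_wpM2l (ltW b0) VE.
  have bVZ := mulr_gt0 b0 VZ0.
  move: Yr bE bV bVZ; rewrite /Z.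
  set e1 := expR _; set e2 := expR _; set J := \int[mu]_(x in _) _; clear; lra.
have t0 : 0 < t by exact: lt_le_trans Dt.
have ZA : Z t <= A * expR (- b * (t - D)).
  by rewrite /Z gerBl mulr_ge0// expR_ge0.
have AB : A <= energy s Tx D + C2 / c * h0 ^+ 2.
  rewrite lerD2l /B mulrAC ler_wpM2r ?sqr_ge0// ler_wpM2l ?(ltW C20)//.
  by rewrite lef_pV2 ?posrE//; move: bc; clear; lra.
have eb0 : 0 < expR (- b * (t - D)) by exact: expR_gt0.
have h2 : (- Tx 0 t) ^+ 2 <= h0 ^+ 2 * expR (- b * (t - D)).
  rewrite (flux_late cl Dt) -/h0 exprMn ler_wpM2l ?sqr_ge0//.
  rewrite expr2 -expRD ler_expR -mulrDl ler_wpM2r ?subr_ge0//.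
  by move: bc b0 c0; clear; lra.
(* E = V + 2 h u, and 2 h u <= E / 2 + 2 L h^2 *)
have u2 := T_boundary_sq_le cl (sL _ (ltW t0)) t0.
have hu : 2 * (- Tx 0 t * (T 0 t - Tm)) <= energy s Tx t / 2 + 2 * L * (- Tx 0 t) ^+ 2.
  have Y : 2 * (- Tx 0 t * (T 0 t - Tm)) <= (T 0 t - Tm) ^+ 2 / (2 * L) + 2 * L * (- Tx 0 t) ^+ 2.
    rewrite -subr_ge0.
    have -> : (T 0 t - Tm) ^+ 2 / (2 * L) + 2 * L * (- Tx 0 t) ^+ 2 - 2 * (- Tx 0 t * (T 0 t - Tm)) =
      (T 0 t - Tm - 2 * L * - Tx 0 t) ^+ 2 / (2 * L) by field; rewrite gt_eqF.
    by rewrite divr_ge0 ?sqr_ge0// mulr_ge0// ltW.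
  apply: le_trans Y _; rewrite lerD2r ler_pdivrMr ?mulr_gt0//.
  by apply: le_trans u2 _; rewrite le_eqVlt; apply/orP; left; apply/eqP; field.
have ABe := ler_wpM2r (ltW eb0) AB.
have Lh := ler_wpM2l (ltW L0) h2.
have -> : (2 * energy s Tx D + (2 * C2 / c + 4 * L) * h0 ^+ 2) * expR (- b * (t - D)) =
  2 * ((energy s Tx D + C2 / c * h0 ^+ 2) * expR (- b * (t - D))) + 4 * (L * (h0 ^+ 2 * expR (- b * (t - D)))).
  by field; rewrite gt_eqF.
move: VZ ZA hu ABe Lh; rewrite /flux_energy.
set H2 := (- Tx 0 t) ^+ 2; set HU := - Tx 0 t * (_ - _); set X1 := h0 ^+ 2 * expR _.
set X2 := A * expR _; set X3 := (_ + _) * expR _; clear; lra.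
Qed.

End EnergyDecay.

(** * Sobolev embedding and the norm as an infimum *)

Section SobolevNorm.
Variable R : realType.
Local Notation mu := (@lebesgue_measure R).

Lemma weak_derivative_integrable (D : R) (f g : R -> R) : H1_derivative 0 D f g ->
  [/\ integrable_on 0 D g, integrable_on 0 D (fun x => `|g x|) &
      integrable_on 0 D (fun x => g x ^+ 2)].
Proof.
by move=> [_ /square_integrableP[gi g2] _]; split => //; exact: (integrable_norm gi).
Qed.

Lemma weak_derivative_variation (D a b : R) (f g : R -> R) :
  H1_derivative 0 D f g ->
  (forall y : R, y < D -> {within `[0, y], continuous f}) ->
  0 <= a -> a <= b -> b < D ->
  `|f b - f a| <= \int[mu]_(x in `[a, b]) `|g x|.
Proof.
move=> Hg cf a0 ab bD; have [gi _ _] := weak_derivative_integrable Hg.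
have cfab : {within `[a, b], continuous f}.
  by apply: continuous_subspaceW (cf b bD); apply: subset_itv; rewrite bnd_simp.
rewrite (weak_FTC ab cfab (H1_derivativeS a0 ab (ltW bD) Hg)).
apply: le_normr_Rintegral => //; exact: (integrable_onS a0 (ltW bD) gi).
Qed.

Lemma segment_integral_mono (a b c d : R) (f : R -> R) :
  a <= c -> c <= d -> d <= b -> integrable_on a b f -> (forall x, 0 <= f x) ->
  \int[mu]_(x in `[c, d]) f x <= \int[mu]_(x in `[a, b]) f x.
Proof.
move=> ac cd db fi f0.
rewrite (integral_split (le_trans ac cd) db fi).
rewrite (integral_split ac cd (integrable_onS (lexx a) db fi)).
by rewrite addrAC lerDr addr_ge0 ?Rintegral_ge0.
Qed.

(** [f x] is compared with [f y] for every [y], up to the total variation, and the squared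
    inequality is averaged over [y]. *)
Lemma Sobolev_pointwise (D x : R) (f g : R -> R) :
  H1_derivative 0 D f g ->
  (forall y : R, y < D -> {within `[0, y], continuous f}) -> 0 <= x < D ->
  f x ^+ 2 <= 2 / D * \int[mu]_(y in `[0, D]) f y ^+ 2
              + 2 * D * \int[mu]_(y in `[0, D]) g y ^+ 2.
Proof.
move=> Hg cf /andP[x0 xD]; have D0 : 0 < D by exact: le_lt_trans xD.
have [gi gni g2i] := weak_derivative_integrable Hg.
have [/square_integrableP[_ f2i] _ _] := Hg.
set V := \int[mu]_(y in `[0, D]) `|g y|.
have V2 : V ^+ 2 <= D * \int[mu]_(y in `[0, D]) g y ^+ 2.
  apply: le_trans (Cauchy_Schwarz_segment (ltW D0) gni _) _; last first.
    by rewrite subr0; under eq_Rintegral do rewrite real_normK ?num_real//.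
  by under [fun x => _]eq_fun do rewrite real_normK ?num_real//.
have osc (y : R) : 0 < y < D -> f x ^+ 2 <= 2 * f y ^+ 2 + 2 * V ^+ 2.
  move=> /andP[y0 yD].
  have : `|f x - f y| <= V.
    have [xy|yx] := leP x y.
      rewrite distrC; apply: le_trans (weak_derivative_variation Hg cf x0 xy yD) _.
      exact: (segment_integral_mono x0 xy (ltW yD) gni (fun _ => normr_ge0 _)).
    apply: le_trans (weak_derivative_variation Hg cf (ltW y0) (ltW yx) xD) _.
    exact: (segment_integral_mono (ltW y0) (ltW yx) (ltW xD) gni (fun _ => normr_ge0 _)).
  rewrite -(ler_pXn2r (n := 2)) ?nnegrE//; last by apply: Rintegral_ge0.
  rewrite real_normK ?num_real// => H.
  have := sqr_ge0 (f x - 2 * f y).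
  by move: H; clear; rewrite !expr2; nra.
have : \int[mu]_(y in `[0, D]) f x ^+ 2 <=
    \int[mu]_(y in `[0, D]) (2 * f y ^+ 2 + 2 * V ^+ 2).
  apply: segment_integral_le_oo => //.
  - exact: integrable_on_cst.
  - by apply: integrable_onD; [exact: integrable_onZ|exact: integrable_on_cst].
rewrite RintegralD//; [|exact: integrable_onZ|exact: integrable_on_cst].
rewrite RintegralZl// !segment_integral_cst ?(ltW D0)// subr0 -ler_pdivlMr// => /le_trans.
apply; rewrite mulrDl mulfK ?gt_eqF// mulrAC lerD2l.
by rewrite -mulrA ler_pM2l.
Qed.

Lemma square_integral_EFin (a b : R) (f : R -> R) : square_integrable a b f ->
  (\int[mu]_(x in `]a, b[) (f x ^+ 2)%:E)%E = (\int[mu]_(x in `[a, b]) f x ^+ 2)%:E.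
Proof.
move=> /square_integrableP[_ f2i].
rewrite -integral_oo_cc// /Rintegral fineK//; apply: integrable_fin_num => //.
by apply: integrableS f2i => //; apply: subset_itv; rewrite bnd_simp.
Qed.

Lemma H1_norm_sq_le (a b : R) (f g : R -> R) : H1_derivative a b f g ->
  (H1_norm_sq a b f <= (\int[mu]_(x in `[a, b]) f x ^+ 2
                        + \int[mu]_(x in `[a, b]) g x ^+ 2)%:E)%E.
Proof.
move=> Hg; have [f2 g2 _] := Hg.
apply: ereal_inf_lbound; exists g => //.
by rewrite !square_integral_EFin.
Qed.

(** Reduces a bound by initial norms, which may be infinite, to real inequalities for one chosen
    pair of weak derivatives. *)
Lemma H1_norm_sq_sum_ge (a b a' b' r K : R) (f f' : R -> R) (v : \bar R) : 0 < K ->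
  (forall g g', H1_derivative a b f g -> H1_derivative a' b' f' g' ->
    (v <= (K * (\int[mu]_(x in `[a, b]) f x ^+ 2 + \int[mu]_(x in `[a, b]) g x ^+ 2 + r
       + (\int[mu]_(x in `[a', b']) f' x ^+ 2 + \int[mu]_(x in `[a', b']) g' x ^+ 2)))%:E)%E) ->
  (v <= K%:E * (H1_norm_sq a b f + r%:E + H1_norm_sq a' b' f'))%E.
Proof.
move=> K0 vK; rewrite -lee_pdivrMl//.
set w := (_ * v)%E.
have nneg (p q : R) h : (0 <= H1_norm_sq p q h)%E.
  apply: le_ereal_inf_tmp => _ [g _ <-].
  by apply: adde_ge0; apply: integral_ge0 => x _; rewrite lee_fin sqr_ge0.
have [/eqP ->|fin] := boolP (H1_norm_sq a b f == +oo%E).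
  by case: (H1_norm_sq a' b' f') (nneg a' b' f') => [y| |]// _; exact: leey.
(* A finite first norm can be subtracted, so that the two infima are treated one after the other. *)
have [z zE] : exists z : R, H1_norm_sq a b f = z%:E.
  by case: (H1_norm_sq a b f) fin (nneg a b f) => // z _ _; exists z.
rewrite zE -EFinD addeC -leeBlDr//.
apply: le_ereal_inf_tmp => _ [g' Hg' <-]; have [f2' g2' _] := Hg'.
rewrite !square_integral_EFin// leeBlDr// -!EFinD.
set y := _ + \int[mu]_(x in `[a', b']) g' x ^+ 2.
suff : (w - (r + y)%:E <= H1_norm_sq a b f)%E.
  by rewrite zE leeBlDr// -EFinD; congr (_ <= _%:E)%E; ring.
apply: le_ereal_inf_tmp => _ [g Hg <-]; have [f2 g2 _] := Hg.
rewrite !square_integral_EFin// leeBlDr// -!EFinD addrA /w lee_pdivrMl// -EFinM.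
exact: vK.
Qed.

End SobolevNorm.

(** * Decay of the three terms of the norm *)

Section NormDecay.
Variable R : realType.
Local Notation mu := (@lebesgue_measure R).

(** The end [y = D] is excluded because [qc] is arbitrary at [- D]. *)
Lemma past_continuous `(cl : closed_loop alpha beta k D c sr Tm qc s T Tx Txx Tt) (y : R) :
  y < D -> {within `[0, y], continuous (fun x => qc (- x))}.
Proof.
move=> yD; apply: continuous_within => x /andP[_ xy].
have Dx : - D < - x by rewrite ltrN2 (le_lt_trans xy).
have cN : {for x, continuous (fun x : R => - x)} by apply: cvgN; exact: cvg_id.
exact: (cvg_comp _ _ cN (cl_cont cl Dx)).
Qed.

Lemma input_sq_le `(cl : closed_loop alpha beta k D c sr Tm qc s T Tx Txx Tt)
    (g : R -> R) : H1_derivative 0 D (fun x => qc (- x)) g ->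
  forall t : R, - D < t -> qc t ^+ 2 <=
    (2 / D + 2 * D) * (\int[mu]_(x in `[0, D]) qc (- x) ^+ 2 + \int[mu]_(x in `[0, D]) g x ^+ 2).
Proof.
move=> Hg; have D0 := cl_D cl; have c0 := cl_c cl.
set N0 := \int[mu]_(x in _) _; set N1 := \int[mu]_(x in _) _.
have N00 : 0 <= N0 by apply: Rintegral_ge0 => x _; exact: sqr_ge0.
have N10 : 0 <= N1 by apply: Rintegral_ge0 => x _; exact: sqr_ge0.
have D20 : 0 <= 2 / D by rewrite divr_ge0// ltW.
have D2 : 0 <= 2 * D by rewrite mulr_ge0// ltW.
have B x : 0 <= x < D -> qc (- x) ^+ 2 <= (2 / D + 2 * D) * (N0 + N1).
  move=> xI; apply: le_trans (Sobolev_pointwise Hg (past_continuous cl) xI) _.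
  by rewrite -/N0 -/N1 mulrDr lerD// ler_wpM2r// ?lerDl// lerDr.
move=> t Dt; have [t0|t0] := leP 0 t.
  apply: le_trans (_ : _ <= qc 0 ^+ 2) _; last by have := B 0; rewrite oppr0; apply; rewrite lexx.
  rewrite (cl_exp cl t0) exprMn ler_piMr ?sqr_ge0// exprn_ile1 ?expR_ge0//.
  by rewrite -expR0 ler_expR mulNr oppr_le0 mulr_ge0// ltW.
have := B (- t); rewrite opprK; apply.
by rewrite oppr_ge0 (ltW t0)/= ltrNl.
Qed.

(** At negative times the exponential factor is at least 1, so one formula covers past and
    closed-loop input. *)
Lemma input_sq_decay `(cl : closed_loop alpha beta k D c sr Tm qc s T Tx Txx Tt)
    (g : R -> R) : H1_derivative 0 D (fun x => qc (- x)) g ->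
  forall t : R, - D < t -> qc t ^+ 2 <=
    (2 / D + 2 * D) * (\int[mu]_(x in `[0, D]) qc (- x) ^+ 2 + \int[mu]_(x in `[0, D]) g x ^+ 2)
    * expR (- c * t) ^+ 2.
Proof.
move=> Hg t Dt; have D0 := cl_D cl; have c0 := cl_c cl.
have [t0|t0] := leP 0 t.
  rewrite (cl_exp cl t0) exprMn ler_wpM2r ?sqr_ge0//.
  by apply: (input_sq_le cl Hg); rewrite oppr_lt0.
have B := input_sq_le cl Hg Dt.
apply: (le_trans B); rewrite ler_peMr//; first exact: le_trans (sqr_ge0 _) B.
by rewrite exprn_ege1// -expR0 ler_expR mulNr -mulrN mulr_ge0 ?oppr_ge0// ltW.
Qed.

Lemma le_sqrt_of_sqr_le (x a : R) : x ^+ 2 <= a -> x <= Num.sqrt a.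
Proof. by move=> xa; apply: le_trans (ler_norm _) _; rewrite -sqrtr_sqr ler_wsqrtr. Qed.

(** [S] is the constant of [input_sq_le]. The first bracket is the gain of [energy_short], doubled
    as in [energy_long]; the second summand is the coefficient of [(qc 0 / k) ^+ 2] there. *)
Definition energy_gain (alpha k D c L : R) :=
  let S := 2 / D + 2 * D in
  2 * (2 + 8 * L * (S + D) / k ^+ 2) +
  (2 * (2 * alpha / L + 2 * L ^+ 3 * c ^+ 2 / alpha) / c + 4 * L) * S / k ^+ 2.

Lemma energy_gain_gt0 (alpha k D c L : R) :
  0 < alpha -> 0 < k -> 0 < D -> 0 < c -> 0 < L -> 0 < energy_gain alpha k D c L.
Proof.
move=> a0 k0 D0 c0 L0.
by do ![done|apply: addr_gt0|apply: divr_gt0|apply: exprn_gt0|apply: mulr_gt0].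
Qed.

Lemma energy_decay `(cl : closed_loop alpha beta k D c sr Tm qc s T Tx Txx Tt)
    (g0 g : R -> R) (L b : R) :
  H1_derivative 0 (s 0) (fun x => T x 0 - Tm) g0 ->
  H1_derivative 0 D (fun x => qc (- x)) g ->
  0 < L -> (forall t : R, 0 <= t -> s t <= L) ->
  0 < b -> b <= c -> b <= alpha / (2 * L ^+ 2) ->
  forall t : R, 0 < t -> energy s Tx t <= energy_gain alpha k D c L *
    (\int[mu]_(x in `[0, s 0]) g0 x ^+ 2 +
     (\int[mu]_(x in `[0, D]) qc (- x) ^+ 2 + \int[mu]_(x in `[0, D]) g x ^+ 2))
    * expR (- b * (t - D)).
Proof.
move=> Hg0 Hg L0 sL b0 bc bg.
pose S := 2 / D + 2 * D; pose K := 2 + 8 * L * (S + D) / k ^+ 2.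
rewrite /energy_gain -/S -/K; set Y := _ + (_ + _).
have D0 := cl_D cl; have c0 := cl_c cl; have k0 := k_gt0 (cl_flow cl).
have a0 := alpha_gt0 (cl_flow cl).
have := input_sq_le cl Hg.
set G := \int[mu]_(x in `[0, s 0]) _ in Y *.
set N0 := \int[mu]_(x in `[0, D]) _ in Y *; set N1 := \int[mu]_(x in `[0, D]) _ in Y *.
move=> q2.
have G0 : 0 <= G by apply: Rintegral_ge0 => x _; exact: sqr_ge0.
have N00 : 0 <= N0 by apply: Rintegral_ge0 => x _; exact: sqr_ge0.
have N10 : 0 <= N1 by apply: Rintegral_ge0 => x _; exact: sqr_ge0.
have S0 : 0 < S by rewrite addr_gt0// ?divr_gt0 ?mulr_gt0.
have Y0 : 0 <= Y by rewrite !addr_ge0.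
have k20 : 0 < k ^+ 2 by rewrite exprn_gt0.
have Lk0 : 0 < 8 * L * (S + D) / k ^+ 2 by rewrite divr_gt0// !mulr_gt0// addr_gt0.
have K0 : 0 < K by rewrite addr_gt0.
set C3 := _ / c + 4 * L.
have C30 : 0 < C3.
  by do ![done|apply: addr_gt0|apply: divr_gt0|apply: exprn_gt0|apply: mulr_gt0].
have [gi gni g2i] := weak_derivative_integrable Hg.
pose V := \int[mu]_(x in `[0, D]) `|g x|.
have V2 : V ^+ 2 <= D * N1.
  apply: le_trans (Cauchy_Schwarz_segment (ltW D0) gni _) _; last first.
    by rewrite subr0; under eq_Rintegral do rewrite real_normK ?num_real//.
  by under [fun x => _]eq_fun do rewrite real_normK ?num_real//.
pose H := Num.sqrt (S * (N0 + N1)).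
have H2 : H ^+ 2 = S * (N0 + N1).
  by rewrite sqr_sqrtr//; exact: mulr_ge0 (ltW S0) (addr_ge0 N00 N10).
(* As a function of time this is a primitive of [|g (- t)|]: its increments bound those of [qc], and
   its total growth is at most [V]. *)
pose P t := - \int[mu]_(x in `[0, - t]) `|g x|.
have PV (a b' : R) : - D < a -> a <= b' -> b' <= 0 -> `|qc b' - qc a| <= P b' - P a <= V.
  move=> Da ab b'0.
  have aD : - a < D by rewrite ltrNl.
  have PE : P b' - P a = \int[mu]_(x in `[- b', - a]) `|g x|.
    rewrite /P (@integral_split _ 0 (- a) (- b')) ?oppr_ge0 ?lerN2//.
      by rewrite opprK addrC addrAC subrr add0r.
    exact: (integrable_onS (lexx 0) (ltW aD) gni).
  rewrite PE; apply/andP; split.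
    have := weak_derivative_variation Hg (past_continuous cl) (a := - b') (b := - a).
    by rewrite !opprK distrC; apply; rewrite ?oppr_ge0 ?lerN2.
  by apply: segment_integral_mono => //; rewrite ?oppr_ge0 ?lerN2// ltW.
have cP (a : R) : - D < a -> {within `[a, 0], continuous P}.
  move=> Da; apply: ctsinN.
  have cI := @parameterized_integral_continuous R 0 D (fun x => `|g x|) (ltW D0) gni.
  apply: (ctsin_comp (h := fun t => - t) cI); first by apply: ctsinN; exact: ctsin_id.
  by move=> x; rewrite /= !in_itv/= => /andP[ax x0]; rewrite oppr_ge0 x0 lerNl (le_trans (ltW Da)).
have qH (t : R) : - D < t -> qc t <= H by move=> Dt; exact: (le_sqrt_of_sqr_le (q2 _ Dt)).
have short (t : R) : 0 < t <= D -> energy s Tx t <= K * Y.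
  move=> tI; apply: le_trans (energy_short cl Hg0 L0 sL qH PV cP tI) _.
  have HV : (H + V) ^+ 2 <= 2 * (S + D) * (N0 + N1).
    have := sqr_ge0 (H - V); have := mulr_ge0 (ltW D0) N00.
    by move: V2 H2; clear; rewrite !expr2; nra.
  have -> : K * Y = 2 * G + 8 * L * (S + D) / k ^+ 2 * G + (2 * (N0 + N1)
     + 4 * L * (2 * (S + D) * (N0 + N1) / k ^+ 2)).
    by rewrite /K /Y; ring.
  rewrite lerD//; first by rewrite lerDl mulr_ge0// ltW.
  apply: ler_wpDl; first by rewrite mulr_ge0 ?addr_ge0.
  by rewrite expr_div_n ler_pM2l ?mulr_gt0// ler_pM2r// invr_gt0.
have q0 : (qc 0 / k) ^+ 2 <= S * Y / k ^+ 2.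
  rewrite expr_div_n ler_pM2r ?invr_gt0//.
  apply: le_trans (q2 0 _) _; first by rewrite oppr_lt0.
  by rewrite ler_pM2l// lerDr.
have M0 : K * Y <= (2 * K + C3 * S / k ^+ 2) * Y.
  apply: ler_wpM2r => //.
  have : 0 < C3 * S / k ^+ 2 by rewrite divr_gt0// mulr_gt0.
  by move: K0; clear; lra.
move=> t t0; have [tD|Dt] := leP t D.
  apply: le_trans (short _ _) _; first by rewrite t0.
  apply: le_trans M0 _; rewrite ler_peMr//.
    apply: mulr_ge0 => //; rewrite addr_ge0 ?mulr_ge0 ?invr_ge0 ?(ltW K0) ?(ltW C30) ?(ltW S0)// ltW//.
  by rewrite -expR0 ler_expR mulNr -mulrN opprB mulr_ge0 ?subr_ge0// ltW.
apply: le_trans (energy_long cl L0 sL b0 bc bg (ltW Dt)) _.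
have q0' := ler_wpM2l (ltW C30) q0.
have sD : energy s Tx D <= K * Y by rewrite short// lexx andbT.
rewrite -/C3; apply: ler_wpM2r; first exact: expR_ge0.
have -> : (2 * K + C3 * S / k ^+ 2) * Y = 2 * (K * Y) + C3 * (S * Y / k ^+ 2) by ring.
by apply: lerD => //; rewrite ler_pM2l.
Qed.

Lemma deviation_sq_le `(cl : closed_loop alpha beta k D c sr Tm qc s T Tx Txx Tt) (L t : R) :
  s t <= L -> 0 < t ->
  \int[mu]_(x in `[0, s t]) (T x t - Tm) ^+ 2 <= L ^+ 2 * energy s Tx t.
Proof.
move=> sL t0; have st0 := cl_s_gt0 cl (ltW t0).
have E0 := energy_ge0 s Tx t.
apply: (@le_trans _ _ (\int[mu]_(x in `[0, s t]) (s t * energy s Tx t))).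
  apply: segment_integral_le.
  - by apply: continuous_integrable_on; apply: ctsinX; exact: (T_slice cl (ltW t0)).
  - exact: integrable_on_cst.
  by move=> x; exact: (temperature_sq_le cl t0).
rewrite segment_integral_cst ?(ltW st0)// subr0 mulrAC -expr2 ler_wpM2r//.
by rewrite ler_sqr ?nnegrE ?(ltW st0)// (le_trans (ltW st0)).
Qed.

(* Solve the feedback law for the interface error. *)
Lemma interface_error_le `(cl : closed_loop alpha beta k D c sr Tm qc s T Tx Txx Tt)
    (B L t : R) :
  (forall t : R, - D < t -> qc t ^+ 2 <= B * expR (- c * t) ^+ 2) ->
  s t <= L -> 0 < t ->
  (s t - sr) ^+ 2 <= 3 * (beta / k) ^+ 2 *
    ((c ^- 2 + D ^+ 2 * expR (c * D) ^+ 2) * B * expR (- c * t) ^+ 2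
     + (k / alpha) ^+ 2 * L ^+ 3 * energy s Tx t).
Proof.
move=> decay sL t0.
have D0 := cl_D cl; have c0 := cl_c cl; have k0 := k_gt0 (cl_flow cl).
have b0 := beta_gt0 (cl_flow cl); have a0 := alpha_gt0 (cl_flow cl).
have st0 := cl_s_gt0 cl (ltW t0); have L0 := lt_le_trans st0 sL.
have B0 : 0 <= B.
  have := decay 0; rewrite mulr0 expR0 expr1n mulr1 oppr_lt0 => /(_ D0).
  exact: le_trans (sqr_ge0 _).
have DtD : - D < t - D by rewrite ltrBrDr addNr.
have cqc : {within `[t - D, t], continuous qc}.
  by apply: continuous_within => x /andP[Dx _]; apply: (cl_cont cl); exact: lt_le_trans Dx.
have law := cl_law cl (ltW t0).
set I := \int[mu]_(theta in _) _ in law; set U := \int[mu]_(x in _) _ in law.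
have Ile : I ^+ 2 <= D ^+ 2 * expR (c * D) ^+ 2 * (B * expR (- c * t) ^+ 2).
  have : `|I| <= Num.sqrt B * expR (c * D) * expR (- c * t) * (t - (t - D)).
    apply: norm_integral_le; [by rewrite gerBl ltW|exact: continuous_integrable_on|].
    move=> x /andP[Dx xt].
    have Dx' : - D < x by exact: lt_le_trans Dx.
    rewrite ger0_norm ?(cl_qc_ge0 cl)// -mulrA -expRD.
    apply: (@le_trans _ _ (Num.sqrt B * expR (- c * x))).
      rewrite -[expR _]ger0_norm ?expR_ge0// -sqrtr_sqr -sqrtrM//.
      by apply: le_sqrt_of_sqr_le; exact: decay.
    rewrite ler_wpM2l ?sqrtr_ge0// ler_expR.
    have -> : c * D + - c * t = - c * (t - D) by ring.
    by rewrite !mulNr lerN2 ler_pM2l.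
  rewrite opprB addrC subrK => H.
  have := ler_pM (normr_ge0 _) (normr_ge0 _) H H.
  rewrite -expr2 real_normK ?num_real// => /le_trans; apply.
  rewrite -[in leRHS](sqr_sqrtr B0) le_eqVlt; apply/orP; left; apply/eqP; ring.
have Ule : U ^+ 2 <= L ^+ 3 * energy s Tx t.
  apply: le_trans (Cauchy_Schwarz_segment (ltW st0) _ _) _.
  - by apply: continuous_integrable_on; exact: (T_slice cl (ltW t0)).
  - by apply: continuous_integrable_on; apply: ctsinX; exact: (T_slice cl (ltW t0)).
  rewrite subr0 exprS -mulrA; apply: ler_pM => //; first exact: ltW.
    by apply: Rintegral_ge0 => x _; exact: sqr_ge0.
  exact: (deviation_sq_le cl).
have Dt : - D < t by apply: lt_trans t0; rewrite oppr_lt0.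
have err : s t - sr = - (beta / k * (qc t / c + I + k / alpha * U)).
  by rewrite law; field; rewrite !gt_eqF.
have qle : (qc t / c) ^+ 2 <= c ^- 2 * (B * expR (- c * t) ^+ 2).
  by rewrite expr_div_n mulrC ler_pM2l ?invr_gt0 ?exprn_gt0//; exact: decay.
have Ule' : (k / alpha * U) ^+ 2 <= (k / alpha) ^+ 2 * (L ^+ 3 * energy s Tx t).
  by rewrite exprMn ler_wpM2l ?sqr_ge0.
have sq3 : (qc t / c + I + k / alpha * U) ^+ 2 <=
    3 * ((qc t / c) ^+ 2 + I ^+ 2 + (k / alpha * U) ^+ 2).
  move: (qc t / c) (k / alpha * U) => x y.
  have := sqr_ge0 (x - I); have := sqr_ge0 (x - y); have := sqr_ge0 (I - y).
  by clear; rewrite !expr2; nra.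
have -> : 3 * (beta / k) ^+ 2 *
    ((c ^- 2 + D ^+ 2 * expR (c * D) ^+ 2) * B * expR (- c * t) ^+ 2
     + (k / alpha) ^+ 2 * L ^+ 3 * energy s Tx t) =
  (beta / k) ^+ 2 * (3 * (c ^- 2 * (B * expR (- c * t) ^+ 2) +
    D ^+ 2 * expR (c * D) ^+ 2 * (B * expR (- c * t) ^+ 2) +
    (k / alpha) ^+ 2 * (L ^+ 3 * energy s Tx t))) by ring.
rewrite err sqrrN exprMn; apply: ler_wpM2l; first exact: sqr_ge0.
apply: le_trans sq3 _; rewrite ler_pM2l//.
by apply: lerD => //; apply: lerD.
Qed.

(** Before [D] the window still holds past input, whose weak derivative does not decay; there the
    factor in front of its norm is at least 1. From [D] on the window is a pure exponential. *)
Lemma input_window `(cl : closed_loop alpha beta k D c sr Tm qc s T Tx Txx Tt)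
    (g : R -> R) (B b t : R) :
  H1_derivative 0 D (fun x => qc (- x)) g ->
  (forall t : R, - D < t -> qc t ^+ 2 <= B * expR (- c * t) ^+ 2) ->
  0 <= b -> 0 < t ->
  exists2 G, H1_derivative 0 D (fun x => qc (t - x)) G &
    \int[mu]_(x in `[0, D]) qc (t - x) ^+ 2 + \int[mu]_(x in `[0, D]) G x ^+ 2 <=
    D * (1 + c ^+ 2) * (B * expR (c * D) ^+ 2 * expR (- c * t) ^+ 2)
    + expR (- b * (t - D)) * \int[mu]_(x in `[0, D]) g x ^+ 2.
Proof.
move=> Hg decay b0 t0; have D0 := cl_D cl; have c0 := cl_c cl.
set N1 := \int[mu]_(x in `[0, D]) g x ^+ 2.
have N10 : 0 <= N1 by apply: Rintegral_ge0 => x _; exact: sqr_ge0.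
set Q := B * _ * _.
have B0 : 0 <= B.
  have := decay 0; rewrite mulr0 expR0 expr1n mulr1 oppr_lt0 => /(_ D0).
  exact: le_trans (sqr_ge0 _).
have Q0 : 0 <= Q by rewrite !mulr_ge0 ?sqr_ge0.
have tx x : x <= D -> - D < t - x by move: t0; clear; lra.
have qQ x : x <= D -> qc (t - x) ^+ 2 <= Q.
  move=> xD; apply: le_trans (decay _ (tx _ xD)) _.
  rewrite /Q -mulrA; apply: ler_wpM2l => //; rewrite -exprMn -expRD.
  rewrite ler_sqr ?nnegrE ?expR_ge0// ler_expR.
  have -> : c * D + - c * t = - c * (t - D) by ring.
  by rewrite !mulNr lerN2 ler_pM2l// lerD2l lerN2.
have cq : {within `[0, D], continuous (fun x => qc (t - x))}.
  apply: continuous_within => x /andP[_ xD].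
  have ct : {for x, continuous (fun x : R => t - x)}.
    by apply: cvgB; [exact: cvg_cst|exact: cvg_id].
  exact: (cvg_comp _ _ ct (cl_cont cl (tx _ xD))).
have IQ : \int[mu]_(x in `[0, D]) qc (t - x) ^+ 2 <= Q * D.
  have := @segment_integral_le R 0 D (fun x => qc (t - x) ^+ 2) (fun=> Q).
  rewrite segment_integral_cst ?(ltW D0)// subr0; apply.
  - by apply: continuous_integrable_on; exact: ctsinX.
  - exact: integrable_on_cst.
  - by move=> x /andP[_ xD]; exact: qQ.
pose e x := qc 0 * expR (c * (x - t)).
have eE x : x <= t -> qc (t - x) = e x.
  by move=> xt; rewrite (cl_exp cl) ?subr_ge0// mulNr -mulrN opprB.
have de (x : R) : is_derive x 1 e (c * e x).
  rewrite /e mulrCA; exact: (is_deriveZ (qc 0) (is_derive_expR_lin c t x)).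
have ce (a' b' : R) : {within `[a', b'], continuous e}.
  by apply: continuous_within => x _; exact: is_derive_continuous (de x).
have ce' (a' b' : R) : {within `[a', b'], continuous (fun x => c * e x)}.
  by apply: ctsinM; [exact: ctsin_cst|exact: ce].
have eQ (y : R) : 0 <= y -> y <= t -> y <= D -> \int[mu]_(x in `[0, y]) (c * e x) ^+ 2 <= c ^+ 2 * Q * D.
  move=> y0 yt yD; apply: (@le_trans _ _ (c ^+ 2 * Q * y)); last first.
    by apply: ler_wpM2l => //; rewrite mulr_ge0 ?sqr_ge0.
  have := @segment_integral_le R 0 y (fun x => (c * e x) ^+ 2) (fun=> c ^+ 2 * Q).
  rewrite segment_integral_cst// subr0; apply.
  - by apply: continuous_integrable_on; exact: ctsinX.
  - exact: integrable_on_cst.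
  move=> x /andP[x0 xy]; rewrite exprMn ler_wpM2l ?sqr_ge0// -eE ?(le_trans xy)//.
  by apply: qQ; exact: le_trans yD.
have -> : D * (1 + c ^+ 2) * Q = Q * D + c ^+ 2 * Q * D by ring.
have [tD|Dt] := ltP t D.
  have eq0 : e t = qc (- 0) by rewrite /e subrr mulr0 expR0 mulr1 oppr0.
  have := glued_H1_derivative t0 tD Hg (past_continuous cl) (ce 0 t) (ce' 0 t) (fun x _ => de x) eq0.
  set F := fun x => if _ then _ else _; set G := fun x => if _ then _ else _.
  have -> : F = fun x => qc (t - x).
    by apply/funext => x; rewrite /F; case: ifPn => [/eE//|_]; rewrite opprB.
  move=> [HG IG]; exists G => //.
  have := eQ t (ltW t0) (lexx _) (ltW tD).
  have : N1 <= expR (- b * (t - D)) * N1.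
    by rewrite ler_peMl// -expR0 ler_expR mulNr -mulrN mulr_ge0// opprB subr_ge0 ltW.
  move: IG IQ; rewrite -/N1; clear.
  set X1 := \int[mu]_(x in _) _; set X2 := \int[mu]_(x in _) _; set X3 := \int[mu]_(x in _) _.
  set X4 := _ * N1; lra.
exists (fun x => c * e x).
  apply: classical_H1_derivative => //; first exact: ltW.
  move=> x /andP[_ xD]; apply: (@near_eq_is_derive R R R e).
  near=> z; rewrite eE//; apply: (@le_trans _ _ D) => //; apply: ltW.
  by near: z; exact: lt_nbhsl.
have := eQ D (ltW D0) Dt (lexx _).
have : 0 <= expR (- b * (t - D)) * N1 by rewrite mulr_ge0// expR_ge0.
move: IQ; clear.
set X1 := \int[mu]_(x in _) _; set X3 := \int[mu]_(x in _) _.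
set X4 := _ * N1; lra.
Unshelve. all: by end_near. Qed.

(** The summands belong to the temperature, the interface error and the input, in this order. The
    factors [expR (b * D)] convert decay counted from time [D] into decay counted from 0, and the
    final 1 covers [t = 0]. *)
Definition Xi_gain (alpha beta k D c L b : R) :=
  let S := 2 / D + 2 * D in
  let E := energy_gain alpha k D c L * expR (b * D) in
  (L ^+ 2 + 1) * E +
  3 * (beta / k) ^+ 2 * ((c ^- 2 + D ^+ 2 * expR (c * D) ^+ 2) * S + (k / alpha) ^+ 2 * L ^+ 3 * E) +
  D * (1 + c ^+ 2) * (S * expR (c * D) ^+ 2) + expR (b * D) + 1.

Lemma Xi_gain_gt1 (alpha beta k D c L b : R) :
  0 < alpha -> 0 < beta -> 0 < k -> 0 < D -> 0 < c -> 0 < L -> 1 < Xi_gain alpha beta k D c L b.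
Proof.
move=> a0 b0 k0 D0 c0 L0; have E0 := energy_gain_gt0 a0 k0 D0 c0 L0.
rewrite /Xi_gain ltrDr.
by do ![done|exact: expR_gt0|exact: E0|apply: addr_gt0|apply: divr_gt0
  |rewrite invr_gt0|apply: exprn_gt0|apply: mulr_gt0].
Qed.

Lemma Xi_decay `(cl : closed_loop alpha beta k D c sr Tm qc s T Tx Txx Tt) (L b t : R) :
  0 < L -> (forall t : R, 0 <= t -> s t <= L) ->
  0 < b -> b <= c -> b <= alpha / (2 * L ^+ 2) -> 0 <= t ->
  (Xi D sr Tm qc T s t <=
   (Xi_gain alpha beta k D c L b)%:E * Xi D sr Tm qc T s 0 * (expR (- b * t))%:E)%E.
Proof.
move=> L0 sL b0 bc bg t0.
have D0 := cl_D cl; have c0 := cl_c cl; have k0 := k_gt0 (cl_flow cl).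
have be0 := beta_gt0 (cl_flow cl); have a0 := alpha_gt0 (cl_flow cl).
have M1 : 1 < Xi_gain alpha beta k D c L b by exact: Xi_gain_gt1.
have M0 := lt_trans ltr01 M1.
have q0E : (fun x => qc (0 - x)) = (fun x => qc (- x)) by apply/funext => x; rewrite sub0r.
rewrite muleAC -EFinM {2}/Xi q0E.
apply: H1_norm_sq_sum_ge => [|g0 g Hg0 Hg]; first by rewrite mulr_gt0 ?expR_gt0.
set N := \int[mu]_(x in _) (T x 0 - Tm) ^+ 2; set G := \int[mu]_(x in _) g0 x ^+ 2.
set N0 := \int[mu]_(x in _) qc _ ^+ 2; set N1 := \int[mu]_(x in _) g x ^+ 2.
have Ng0 : 0 <= N by apply: Rintegral_ge0 => x _; exact: sqr_ge0.
have Gg0 : 0 <= G by apply: Rintegral_ge0 => x _; exact: sqr_ge0.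
have N0g0 : 0 <= N0 by apply: Rintegral_ge0 => x _; exact: sqr_ge0.
have N1g0 : 0 <= N1 by apply: Rintegral_ge0 => x _; exact: sqr_ge0.
have r0 := sqr_ge0 (s 0 - sr).
set Z := _ + (N0 + N1).
have Z0 : 0 <= Z by rewrite !addr_ge0.
(* At [t = 0] there is no classical [Tx]; the same weak derivatives serve on both sides and a gain
   above 1 suffices. *)
move: t0; rewrite le_eqVlt => /orP[/eqP <-|t0].
  rewrite /Xi q0E mulr0 expR0 mulr1.
  apply: le_trans (leeD (leeD (H1_norm_sq_le Hg0) (lexx _)) (H1_norm_sq_le Hg)) _.
  by rewrite -!EFinD lee_fin -/N -/G -/N0 -/N1 -/Z ler_peMl// ltW.
have decay := input_sq_decay cl Hg.
have Edecay := energy_decay cl Hg0 Hg L0 sL b0 bc bg t0.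
have err := interface_error_le cl decay (sL _ (ltW t0)) t0.
have [W HW Wle] := input_window cl Hg decay (ltW b0) t0.
have dev := deviation_sq_le cl (sL _ (ltW t0)) t0.
apply: le_trans (leeD (leeD (H1_norm_sq_le (T_H1_derivative cl t0)) (lexx _)) (H1_norm_sq_le HW)) _.
rewrite -!EFinD lee_fin.
rewrite -/N0 -/N1 in err Wle; rewrite -/G -/N0 -/N1 in Edecay.
move: Wle; set W0 := _ + \int[mu]_(x in _) W x ^+ 2 => Wle.
move: dev; set V := \int[mu]_(x in _) (T x t - Tm) ^+ 2 => dev.
rewrite -/(energy s Tx t).
set E := energy s Tx t in err Edecay dev *.
set S := 2 / D + 2 * D in err Wle.
have S0 : 0 < S by rewrite addr_gt0// ?divr_gt0 ?mulr_gt0.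
pose eb := expR (- b * t); pose X := Z * eb.
have eb0 : 0 < eb by exact: expR_gt0.
have ebD : expR (- b * (t - D)) = expR (b * D) * eb.
  by rewrite /eb -expRD; congr expR; ring.
have ec : expR (- c * t) ^+ 2 <= eb.
  rewrite expr2 -expRD ler_expR -mulrDl ler_wpM2r ?(ltW t0)//.
  by move: bc c0 b0; clear; lra.
have g0' := energy_gain_gt0 a0 k0 D0 c0 L0.
have F1 : E <= energy_gain alpha k D c L * expR (b * D) * X.
  apply: le_trans Edecay _; rewrite ebD.
  have -> : energy_gain alpha k D c L * expR (b * D) * X =
    energy_gain alpha k D c L * Z * (expR (b * D) * eb) by rewrite /X; ring.
  rewrite ler_wpM2r ?mulr_ge0 ?expR_ge0// ler_pM2l// /Z.
  by move: Ng0 r0; clear; lra.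
have F2 : S * (N0 + N1) * expR (- c * t) ^+ 2 <= S * X.
  rewrite -mulrA ler_pM2l//; apply: ler_pM => //; first by rewrite addr_ge0.
  by rewrite lerDr !addr_ge0.
have F3 : expR (- b * (t - D)) * N1 <= expR (b * D) * X.
  rewrite ebD -mulrA ler_pM2l ?expR_gt0// /X [Z * _]mulrC ler_pM2l// /Z.
  by move: Ng0 Gg0 r0 N0g0; clear; lra.
have X0 : 0 <= X by rewrite mulr_ge0// ltW.
have F2' : S * (N0 + N1) * expR (c * D) ^+ 2 * expR (- c * t) ^+ 2 <= S * expR (c * D) ^+ 2 * X.
  by rewrite mulrAC [leRHS]mulrAC ler_wpM2r ?sqr_ge0.
pose A1 := c ^- 2 + D ^+ 2 * expR (c * D) ^+ 2.
have A10 : 0 <= A1.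
  by rewrite addr_ge0//; [rewrite invr_ge0 sqr_ge0|rewrite mulr_ge0 ?sqr_ge0].
have A20 : 0 <= (k / alpha) ^+ 2 * L ^+ 3 by rewrite mulr_ge0 ?sqr_ge0// exprn_ge0// ltW.
have err2 : A1 * (S * (N0 + N1)) * expR (- c * t) ^+ 2 + (k / alpha) ^+ 2 * L ^+ 3 * E <=
   A1 * (S * X) + (k / alpha) ^+ 2 * L ^+ 3 * (energy_gain alpha k D c L * expR (b * D) * X).
  by rewrite -[A1 * _ * _]mulrA; apply: lerD; apply: ler_wpM2l.
have A30 : 0 <= 3 * (beta / k) ^+ 2 by rewrite mulr_ge0 ?sqr_ge0.
have err3 := le_trans err (ler_wpM2l A30 err2).
have A40 : 0 <= D * (1 + c ^+ 2).
  by apply: mulr_ge0 (ltW D0) (addr_ge0 ler01 (sqr_ge0 c)).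
have Wle2 := le_trans Wle (lerD (ler_wpM2l A40 F2') F3).
have dev2 := ler_wpM2l (sqr_ge0 L) F1.
have -> : Xi_gain alpha beta k D c L b * eb * Z =
    L ^+ 2 * (energy_gain alpha k D c L * expR (b * D) * X) + energy_gain alpha k D c L * expR (b * D) * X
    + 3 * (beta / k) ^+ 2 * (A1 * (S * X) + (k / alpha) ^+ 2 * L ^+ 3 * (energy_gain alpha k D c L * expR (b * D) * X))
    + (D * (1 + c ^+ 2) * (S * expR (c * D) ^+ 2 * X) + expR (b * D) * X) + X.
  by rewrite /Xi_gain -/S -/A1 /X; ring.
move: (le_trans dev dev2) F1 err3 Wle2 X0; clear.
set x1 := L ^+ 2 * _; set x2 := _ * X; set x3 := 3 * _ * _; set x4 := _ + expR _ * X.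
lra.
Qed.

End NormDecay.

(** * From the assumptions to the closed loop, and the setpoint bound *)

Section Feedback.
Variable R : realType.
Local Notation mu := (@lebesgue_measure R).

Lemma closed_loop_of_solution (alpha beta k D c sr Tm s0 : R) (T0 qc s : R -> R)
    (T : R -> R -> R) : 0 < alpha -> 0 < beta -> 0 < k -> 0 < D -> 0 < c ->
  assumption_A1 Tm s0 T0 -> assumption_A2 D qc ->
  assumption_A3 alpha beta k D sr Tm s0 T0 qc ->
  stefan_solution alpha beta k D Tm s0 T0 qc T s ->
  control_law alpha beta k D c sr Tm qc T s ->
  exists Tx Txx Tt, closed_loop alpha beta k D c sr Tm qc s T Tx Txx Tt.
Proof.
move=> a0 b0 k0 D0 c0 [s00 [H H0 HT0]] A2 [qoo A3] sol law.
have [Tx [Txx [Tt [cT [cTx cTxx cTt] dT cs [heat flux interf ds [s0E T0E]]]]]] := sol.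
have sf : stefan_flow alpha beta k D Tm qc s T Tx Txx Tt by split.
have qi : integrable_on (- D) 0 qc := integrable_oo_cc qoo.
have cu : {within `[0, s 0], continuous (fun x => T x 0 - Tm)}.
  by apply: ctsinB; [exact: liquid_slice_cont cT|exact: ctsin_cst].
have Tge x : 0 < x < s 0 -> 0 <= T x 0 - Tm.
  move=> /andP[x0 xs]; rewrite s0E in xs.
  rewrite (T0E _ (introT andP (conj (ltW x0) (ltW xs)))) subr_ge0.
  by have /andP[] := HT0 x (introT andP (conj x0 xs)).
(* A1 speaks of the open interval only; the end points follow from continuity at 0 and from the
   interface condition. *)
have T0ge x : 0 <= x <= s 0 -> Tm <= T x 0.
  rewrite -[Tm <= _]subr_ge0 => /andP[+ xs].
  rewrite le_eqVlt => /orP[/eqP <-|x0].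
    rewrite leNgt; apply/negP => u0.
    have [|d [/andP[d0 ds0] neg]] := neg_right_of (x0 := 0) cu _ u0.
      by rewrite lexx s0E.
    have d20 : 0 < d / 2 by rewrite divr_gt0.
    have d2d : d / 2 < d by rewrite ltr_pdivrMr// ltr_pMr// ltr1n.
    have := neg (d / 2); rewrite !ltW// => /(_ isT).
    by rewrite ltNge Tge// d20 (lt_le_trans d2d).
  move: xs; rewrite le_eqVlt => /orP[/eqP ->|xs]; first by rewrite interf// subrr.
  by apply: Tge; rewrite x0.
(* Up to the factor [k / beta], the bracket of the feedback law at time 0 is the left side of A3
   minus the setpoint. *)
have q0 : 0 < qc 0.
  rewrite law// sub0r mulNr -mulrN mulr_gt0// oppr_gt0.
  move: A3; rewrite integral_oo_cc; last first.
    rewrite (_ : (fun t => qc t / k) = (fun t => k^-1 * qc t)); first exact: integrable_onZ.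
    by apply/funext => t; rewrite mulrC.
  under eq_Rintegral do rewrite mulrC.
  rewrite RintegralZl// -s0E.
  have -> : \int[mu]_(x in `]0, s 0[) (T0 x - Tm) = \int[mu]_(x in `[0, s 0]) (T x 0 - Tm).
    rewrite -integral_oo_cc; last exact: continuous_integrable_on.
    apply: eq_Rintegral => x; rewrite inE/= in_itv/= => /andP[x0 xs].
    by rewrite T0E// -s0E (ltW x0) (ltW xs).
  set I := \int[mu]_(x in _) qc x; set U := \int[mu]_(x in _) _ => A3.
  have -> : I + k / alpha * U + k / beta * (s 0 - sr) =
     k / beta * (s 0 + beta * (k^-1 * I + alpha^-1 * U) - sr).
    by field; rewrite !gt_eqF.
  by rewrite pmulr_rlt0 ?divr_gt0// subr_lt0.
exists Tx, Txx, Tt.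
by apply: (closed_loop_of_feedback sf D0 c0 law qi A2 q0) => //; rewrite s0E.
Qed.

Lemma interface_lt_setpoint `(cl : closed_loop alpha beta k D c sr Tm qc s T Tx Txx Tt) (t : R) :
  0 <= t -> s t < sr.
Proof.
(* At [t = 0] the window reaches [- D], where the sign of [qc] is unknown; monotonicity of [s]
   allows a later time instead. *)
wlog t0 : t / 0 < t => [H t0|_].
  have t1 : 0 < t + 1 by rewrite ltr_wpDl.
  by apply: le_lt_trans (H _ t1 (ltW t1)); apply: (cl_s_mono cl) => //; rewrite lerDl.
have D0 := cl_D cl; have c0 := cl_c cl; have k0 := k_gt0 (cl_flow cl).
have b0 := beta_gt0 (cl_flow cl); have a0 := alpha_gt0 (cl_flow cl).
have : 0 < qc t by rewrite (cl_exp cl (ltW t0)) mulr_gt0 ?(cl_qc0 cl) ?expR_gt0.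
rewrite (cl_law cl (ltW t0)) mulNr -mulrN pmulr_rgt0// oppr_gt0.
set I := \int[mu]_(x in _) qc x; set U := \int[mu]_(x in _) _ => neg.
have U0 : 0 <= k / alpha * U.
  apply: mulr_ge0; first by rewrite divr_ge0// ltW.
  apply: Rintegral_ge0 => x; rewrite /= in_itv/= => xI.
  by rewrite subr_ge0; exact: (cl_T_ge cl (ltW t0)).
have I0 : 0 <= I.
  apply: Rintegral_ge0 => x; rewrite /= in_itv/= => /andP[tx _].
  by apply: (cl_qc_ge0 cl); apply: lt_le_trans tx; rewrite ltrBrDr addNr.
have : k / beta * (s t - sr) < 0 by move: neg U0 I0; clear; lra.
by rewrite pmulr_rlt0 ?divr_gt0// subr_lt0.
Qed.

End Feedback.

(** * Validity of the model and exponential stability *)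

Unset Implicit Arguments.

Theorem theorem1 (R : realType) (alpha beta k D c sr : R) :
  0 < alpha -> 0 < beta -> 0 < k -> 0 < D -> 0 < c ->
  exists M b : R,
    [/\ 0 < M, 0 < b &
      forall (Tm s0 : R) (T0 qc : R -> R) (T : R -> R -> R) (s : R -> R),
        assumption_A1 Tm s0 T0 ->
        assumption_A2 D qc ->
        assumption_A3 alpha beta k D sr Tm s0 T0 qc ->
        stefan_solution alpha beta k D Tm s0 T0 qc T s ->
        control_law alpha beta k D c sr Tm qc T s ->
        (forall x t : R, 0 < t -> 0 <= x <= s t -> Tm <= T x t) /\
        (forall t : R, 0 <= t ->
           (Xi D sr Tm qc T s t
            <= M%:E * Xi D sr Tm qc T s 0 * (expR (- b * t))%:E)%E)].
Proof.
move=> a0 b0 k0 D0 c0.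
(* The constants are fixed before the data, when [sr] may still have any sign; this [L] is positive
   and exceeds [sr], hence every [s t]. The rate is the slower of input decay and heat
   dissipation. *)
pose L := `|sr| + 1; pose b := Num.min c (alpha / (2 * L ^+ 2)).
have L0 : 0 < L by rewrite ltr_wpDl.
have bpos : 0 < b by rewrite lt_min c0 divr_gt0// mulr_gt0// exprn_gt0.
exists (Xi_gain alpha beta k D c L b), b; split => //.
  by apply: lt_trans ltr01 _; exact: Xi_gain_gt1.
move=> Tm s0 T0 qc T s A1 A2 A3 sol law.
have [Tx [Txx [Tt cl]]] := closed_loop_of_solution a0 b0 k0 D0 c0 A1 A2 A3 sol law.
split=> [x t t0 xI|t t0]; first exact: (cl_T_ge cl (ltW t0)).
apply: (Xi_decay cl L0) => //.
- move=> r r0; apply: ltW; apply: lt_trans (interface_lt_setpoint cl r0) _.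
  by apply: le_lt_trans (ler_norm sr) _; rewrite ltrDl.
- by rewrite ge_min lexx.
- by rewrite ge_min lexx orbT.
Qed.
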